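(* Let $\mathbb{K}$ be an algebraically closed field, let $\mathbb{P}V$ be the $n$-dimensional projective space over $\mathbb{K}$, and let $v_d\colon\mathbb{P}V\to\mathbb{P}S^dV$ be the $d$-th Veronese embedding. Let $r$ be a positive integer. For each vector bundle $\mathcal{E}$ on $\mathbb{P}V$ of rank $e$, let $Z_{r,\mathcal{E}}\subseteq\mathbb{P}S^dV$ be the vanishing set of the $(re+1)\times(re+1)$ minors of the map $j^{\mathcal{E}}$ associated with $\mathcal{E}$ (equivalently, $Z_{r,\mathcal{E}}=\{[F] : \operatorname{rank} j^{\mathcal{E}}(F)\leq re\}$), and let $$Z_r=\bigcap_{\mathcal{E}} Z_{r,\mathcal{E}},$$ the intersection being over all vector bundles $\mathcal{E}$ (of all finite ranks) on $\mathbb{P}V$. Suppose that either (i) $n\geq 6$ and $r\geq 14$, or (ii) $n=5$ and $r\geq 42$, or (iii) $n=4$ and $r\geq 140$. Suppose moreover that $d\geq 2r-1$. Then $$\sigma_r(v_d(\mathbb{P}V))\subsetneq Z_r .$$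
   Context: The Veronese embedding $v_d$ is the embedding of $X=\mathbb{P}V$ by the complete linear system of $\mathcal{L}=\mathcal{O}_{\mathbb{P}V}(d)$, and $S^dV$ is identified with $H^0(\mathbb{P}V,\mathcal{O}(d))^*$. For a projective variety $X\subseteq\mathbb{P}W$, the $r$-th secant variety is the Zariski closure $\sigma_r(X)=\overline{\bigcup_{p_1,\dots,p_r\in X}\langle p_1,\dots,p_r\rangle}\subseteq\mathbb{P}W$, where $\langle\cdot\rangle$ is projective linear span. For a vector bundle (locally free sheaf of finite rank) $\mathcal{E}$ on $X=\mathbb{P}V$ with dual $\mathcal{E}^\vee$, the canonical morphism $\mathcal{E}\otimes\mathcal{L}\otimes\mathcal{E}^\vee\to\mathcal{L}$ induces a linear map $m\colon H^0(X,\mathcal{E})\otimes H^0(X,\mathcal{L}\otimes\mathcal{E}^\vee)\to H^0(X,\mathcal{L})$, and hence, by rearranging factors, a linear map $$j^{\mathcal{E}}\colon H^0(X,\mathcal{L})^*\to H^0(X,\mathcal{E})^*\otimes H^0(X,\mathcal{L}\otimes\mathcal{E}^\vee)^*,$$ where $j^{\mathcal{E}}(F)$ is the bilinear form $(s,t)\mapsto F(m(s\otimes t))$. After choosing bases of $H^0(X,\mathcal{E})$ and $H^0(X,\mathcal{L}\otimes\mathcal{E}^\vee)$, $j^{\mathcal{E}}$ is a matrix whose entries are elements of $H^0(X,\mathcal{L})$, i.e. linear forms on $S^dV$; its minors are homogeneous forms on $\mathbb{P}S^dV$. The rank of $j^{\mathcal{E}}(F)$ is its rank as a matrix. *)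

(* Defs.v *)
From HB Require Import structures.
From mathcomp Require Import all_boot all_order all_algebra ring.
From mathcomp Require Import boolp classical_sets functions.
From mathcomp.multinomials Require Import mpoly.

Set Implicit Arguments.
Unset Strict Implicit.
Unset Printing Implicit Defensive.

Import GRing.Theory.
Local Open Scope ring_scope.
Local Open Scope classical_set_scope.

Section ProjectiveSpace.
Variables (K : fieldType) (W : vectType K).

(* Points of PW are the lines of W. *)
Record proj := Proj { line : {vspace W}; _ : \dim line == 1%N }.

HB.instance Definition _ := [isSub for line].

Fact dim_point (x : W) : x != 0 -> \dim <[x]>%VS == 1%N.
Proof. by move=> x0; rewrite dim_vline x0. Qed.

Definition point (x : W) (x0 : x != 0) : proj := Proj (dim_point x0).

(* Homogeneous polynomial functions of degree k on W, read in the coordinates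
   of a fixed basis; the class of functions does not depend on that basis. *)
Definition is_form (k : nat) (G : W -> K) : Prop :=
  exists2 P : {mpoly K[\dim {:W}]}, P \is k.-homog
    & forall w, G w = P.@[fun i => coord (vbasis {:W}) i w].

Definition zclosed (C : set proj) : Prop :=
  exists I : set (W -> K), (forall G, I G -> exists k, is_form k G) /\
    C = [set p | forall G w, I G -> w \in line p -> G w = 0].

Definition zclosure (S : set proj) : set proj :=
  [set p | forall C, zclosed C -> S `<=` C -> C p].

Definition pspan (r : nat) (p : 'I_r -> proj) : set proj :=
  [set q | (line q <= \sum_i line (p i))%VS].

Definition secant_variety (r : nat) (X : set proj) : set proj :=
  zclosure [set q | exists2 p : 'I_r -> proj, (forall i, X (p i)) & pspan p q].

Record zopen := ZOpen { opens :> proj -> Prop; _ : zclosed (~` opens) }.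

End ProjectiveSpace.

Arguments proj {K} W.
Arguments is_form {K W} k G.
Arguments zopen {K} W.

Section Forms.
Variables (K : fieldType) (W : vectType K).
Implicit Types (G H : W -> K).

Lemma is_form_const (c : K) : is_form 0 (fun _ : W => c).
Proof.
exists c%:MP => [|w]; last by rewrite mevalC.
by rewrite -[c%:MP]mulr1 mul_mpolyC rpredZ // dhomog1.
Qed.

Lemma is_formM k l G H :
  is_form k G -> is_form l H -> is_form (k + l) (fun w => G w * H w).
Proof.
move=> [P hP PE] [Q hQ QE]; exists (P * Q); first exact: dhomogM.
by move=> w; rewrite mevalM PE QE.
Qed.

Lemma is_formB k G H :
  is_form k G -> is_form k H -> is_form k (fun w => G w - H w).
Proof.
move=> [P hP PE] [Q hQ QE]; exists (P - Q); first exact: rpredB.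
by move=> w; rewrite mevalB PE QE.
Qed.

Lemma is_formZ k G (c : K) (w : W) : is_form k G -> G (c *: w) = c ^+ k * G w.
Proof.
move=> [P hP PE]; rewrite !PE !mevalE mulr_sumr.
apply: eq_big_seq => m mP; rewrite mulrCA; congr (_ * _).
under eq_bigr => i _ do rewrite linearZ /= exprMn.
rewrite big_split /= prodrXr; congr (_ ^+ _ * _).
by rewrite -mdegE; apply: (dhomogP _ _ _ hP).
Qed.

Lemma zclosed0 : zclosed (set0 : set (proj W)).
Proof.
exists [set fun=> 1]; split=> [G ->|]; first by exists 0%N; apply: is_form_const.
apply/seteqP; split=> p //= /(_ _ 0 erefl (mem0v _)) /eqP.
by rewrite oner_eq0.
Qed.

Lemma zopenT_subproof : zclosed (~` [set: proj W]).
Proof. by rewrite setCT; apply: zclosed0. Qed.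

Definition zopenT : zopen W := ZOpen zopenT_subproof.

End Forms.

Arguments zopenT {K W}.

Section Twists.
Variables (K : fieldType) (V : vectType K).
Implicit Types (U : zopen V) (k : nat).

(* Vectors of homogeneous coordinates of the points of U. *)
Definition cone U : set V :=
  [set x | x != 0 /\ exists2 p : proj V, U p & x \in line p].

(* Sections of O(k) over U are functions of the homogeneous coordinates that
   are, near every point p, a quotient A / B of forms with
   deg A = deg B + k. The open sets (B != 0) are a basis of the topology, so it
   suffices to use those as neighbourhoods of p. *)
Definition regular k U (f : {x | cone U x} -> K) : Prop :=
  forall p : proj V, U p -> exists m A B, [/\ is_form (m + k) A, is_form m B,
    forall x, x \in line p -> x != 0 -> B x != 0 &
    forall x (hx : cone U x), B x != 0 -> f (exist _ x hx) = A x / B x].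

Definition regular_pred k U : {pred {x | cone U x} -> K} :=
  fun f => `[< regular k f >].

Fact regular_pred_zmod k U : zmod_closed (@regular_pred k U).
Proof.
split=> [|f g /asboolP rf /asboolP rg]; apply/asboolP.
  move=> p Up; exists 0%N, (fun=> 0), (fun=> 1); split.
  - exists 0 => [|w]; [exact: dhomog0 | by rewrite meval0].
  - exact: is_form_const.
  - by move=> *; apply: oner_neq0.
  - by move=> x hx _; rewrite mul0r.
move=> p Up; have [m [A [B [fA fB B0 fE]]]] := rf p Up.
have [m' [A' [B' [fA' fB' B0' gE]]]] := rg p Up.
exists (m + m')%N, (fun x => A x * B' x - A' x * B x), (fun x => B x * B' x).
split; [| exact: is_formM | |].
- apply: is_formB.
    by rewrite addnAC; apply: is_formM.
  by rewrite -addnA addnC; apply: is_formM.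
- by move=> x xp x0; rewrite mulf_neq0 ?B0 ?B0'.
- move=> x hx; rewrite mulf_eq0 negb_or => /andP[Bx B'x].
  rewrite /GRing.add /= /GRing.opp /= fE // gE //.
  by rewrite -mulNr addf_div // mulNr.
Qed.

HB.instance Definition _ k U :=
  GRing.isZmodClosed.Build _ (@regular_pred k U) (@regular_pred_zmod k U).

Record twist k U := Twist
  { twist_fun :> {x | cone U x} -> K; _ : twist_fun \in @regular_pred k U }.

HB.instance Definition _ k U := [isSub for @twist_fun k U].
HB.instance Definition _ k U := [Choice of twist k U by <:].
HB.instance Definition _ k U := [SubChoice_isSubZmodule of twist k U by <:].

Lemma regularM k l U (f g : {x | cone U x} -> K) :
  regular k f -> regular l g -> regular (k + l) (f * g).
Proof.
move=> rf rg p Up; have [m [A [B [fA fB B0 fE]]]] := rf p Up.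
have [m' [A' [B' [fA' fB' B0' gE]]]] := rg p Up.
exists (m + m')%N, (fun x => A x * A' x), (fun x => B x * B' x); split.
- by rewrite addnACA; apply: is_formM.
- exact: is_formM.
- by move=> x xp x0; rewrite mulf_neq0 ?B0 ?B0'.
- move=> x hx; rewrite mulf_eq0 negb_or => /andP[Bx B'x].
  by rewrite /GRing.mul /= fE // gE // mulf_div.
Qed.

Fact regular_pred_subring U : subring_closed (@regular_pred 0 U).
Proof.
split=> [|f g|f g /asboolP rf /asboolP rg]; last 2 first.
- by have [_] := @regular_pred_zmod 0 U; apply.
- by apply/asboolP; apply: (regularM rf rg).
apply/asboolP.
move=> p Up; exists 0%N, (fun=> 1), (fun=> 1); split; try exact: is_form_const.
  by move=> *; apply: oner_neq0.
by move=> x hx _; rewrite divr1.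
Qed.

Definition regfun U := twist 0 U.

HB.instance Definition _ U := [isSub of regfun U for @twist_fun 0 U].
HB.instance Definition _ U := [Choice of regfun U by <:].
HB.instance Definition _ U := GRing.SubChoice_isSubComPzRing.Build _ _ (regfun U)
  (@regular_pred_subring U).

Fact twist_scale_subproof k U (a : regfun U) (s : twist k U) :
  (twist_fun a * twist_fun s) \in @regular_pred k U.
Proof.
by apply/asboolP; apply: (@regularM 0); apply/asboolP; [case: a | case: s].
Qed.

Definition twist_scale k U (a : regfun U) (s : twist k U) : twist k U :=
  Twist (twist_scale_subproof a s).

Fact twist_scaleA k U (a b : regfun U) (s : twist k U) :
  twist_scale a (twist_scale b s) = twist_scale (a * b) s.
Proof. by apply/val_inj; rewrite /= mulrA. Qed.

Fact twist_scale1 k U : left_id 1 (@twist_scale k U).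
Proof. by move=> s; apply/val_inj; rewrite /= mul1r. Qed.

Fact twist_scaleDr k U : right_distributive (@twist_scale k U) +%R.
Proof. by move=> a s t; apply/val_inj; rewrite /= mulrDr. Qed.

Fact twist_scaleDl k U (s : twist k U) : {morph (@twist_scale k U)^~ s : a b / a + b}.
Proof. by move=> a b; apply/val_inj; rewrite /= mulrDl. Qed.

HB.instance Definition _ k U := GRing.Zmodule_isLmodule.Build (regfun U)
  (twist k U) (@twist_scaleA k U) (@twist_scale1 k U) (@twist_scaleDr k U)
  (@twist_scaleDl k U).

Lemma cone_sub U U' : U' `<=` U -> cone U' `<=` cone U.
Proof. by move=> sU x [x0 [p /sU Up px]]; split=> //; exists p. Qed.

Definition restr_fun U U' (sU : U' `<=` U) (f : {x | cone U x} -> K)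
  (x : {x | cone U' x}) : K := f (exist _ (sval x) (cone_sub sU (svalP x))).

Fact twist_res_subproof k U U' (sU : U' `<=` U) (s : twist k U) :
  restr_fun sU s \in @regular_pred k U'.
Proof.
apply/asboolP => p /sU Up; have /asboolP rf := valP s.
have [m [A [B [fA fB B0 fE]]]] := rf p Up.
by exists m, A, B; split=> // x hx Bx; rewrite /restr_fun /= fE.
Qed.

Definition twist_res k U U' (sU : U' `<=` U) (s : twist k U) : twist k U' :=
  Twist (twist_res_subproof sU s).

(* Presheaves of modules over O = O(0). In `is_sheaf`, agreement on an overlap is
   tested on all open subsets of it. *)
Record omod := OMod {
  sect :> forall U, lmodType (regfun U);
  res : forall U U', U' `<=` U -> sect U -> sect U';
  resD : forall U U' (sU : U' `<=` U), {morph res sU : s t / s + t};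
  resZ : forall U U' (sU : U' `<=` U) (a : regfun U) (s : sect U),
    res sU (a *: s) = (twist_res sU a : regfun U') *: res sU s;
  res_id : forall U (sU : U `<=` U) (s : sect U), res sU s = s;
  res_comp : forall U U' U'' (sU : U' `<=` U) (sU' : U'' `<=` U')
    (sU'' : U'' `<=` U) (s : sect U), res sU' (res sU s) = res sU'' s }.

Definition is_sheaf (E : omod) : Prop :=
  forall (I : Type) (U : zopen V) (C : I -> zopen V) (sC : forall i, C i `<=` U),
  (forall p, U p -> exists i, C i p) ->
  (forall s t : E U, (forall i, res (sC i) s = res (sC i) t) -> s = t) /\
  (forall c : forall i, E (C i),
    (forall i j (U' : zopen V) (si : U' `<=` C i) (sj : U' `<=` C j),
      res si (c i) = res sj (c j)) ->
    exists s : E U, forall i, res (sC i) s = c i).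

(* Every point has a neighbourhood on which E has a basis of e sections, that
   is, on which E is isomorphic to the free O-module of rank e. *)
Definition locally_free (e : nat) (E : omod) : Prop :=
  forall p : proj V, exists U : zopen V, U p /\
    exists b : 'I_e -> E U, forall (U' : zopen V) (sU : U' `<=` U) (s : E U'),
    exists! a : 'I_e -> regfun U', s = \sum_i a i *: res sU (b i).

Definition vector_bundle (e : nat) (E : omod) : Prop :=
  is_sheaf E /\ locally_free e E.

Record omod_hom (E F : omod) := OModHom {
  hom_fun :> forall U, {linear E U -> F U};
  hom_res : forall U U' (sU : U' `<=` U) (s : E U),
    hom_fun U' (res sU s) = res sU (hom_fun U s) }.

Fact twist_resD k U U' (sU : U' `<=` U) :
  {morph @twist_res k U U' sU : s t / s + t}.
Proof. by move=> s t; apply/val_inj. Qed.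

Fact twist_resZ k U U' (sU : U' `<=` U) (a : regfun U) (s : twist k U) :
  twist_res sU (a *: s) = (twist_res sU a : regfun U') *: twist_res sU s.
Proof. exact/val_inj. Qed.

Fact twist_res_id k U (sU : U `<=` U) (s : twist k U) : twist_res sU s = s.
Proof.
apply/val_inj/funext => -[x hx]; rewrite /= /restr_fun /=.
by congr (twist_fun s _); apply: eq_exist.
Qed.

Fact twist_res_comp k U U' U'' (sU : U' `<=` U) (sU' : U'' `<=` U')
  (sU'' : U'' `<=` U) (s : twist k U) :
  twist_res sU' (twist_res sU s) = twist_res sU'' s.
Proof.
apply/val_inj/funext => -[x hx]; rewrite /= /restr_fun /=.
by congr (twist_fun s _); apply: eq_exist.
Qed.

Definition O_ k : omod := OMod (@twist_resD k) (@twist_resZ k) (@twist_res_id k)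
  (@twist_res_comp k).

End Twists.

Section PolynomialFunctions.
Variable K : closedFieldType.

Lemma fresh (s : seq K) : exists x, x \notin s.
Proof.
have /closed_nonrootP[x] : \prod_(z <- s) ('X - z%:P) != 0 :> {poly K}.
  by rewrite monic_neq0 // monic_prod_XsubC.
by rewrite root_prod_XsubC; exists x.
Qed.

Lemma infinite_field : exists x : nat -> K, injective x.
Proof.
pose next s := xchoose (fresh s).
pose l := fix l n := if n is m.+1 then next (l m) :: l m else [::].
exists (fun n => next (l n)).
have sub m n : (m < n)%N -> next (l m) \in l n.
  elim: n => // n IH; rewrite ltnS leq_eqVlt inE => /orP[/eqP->|/IH ->].
    by rewrite eqxx.
  by rewrite orbT.
have neq m n : (m < n)%N -> next (l m) != next (l n).
  move/sub => mn; apply: contraNneq (xchooseP (fresh (l n))) => E.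
  by rewrite -/(next (l n)) -E.
move=> m n /eqP E; case: (ltngtP m n) => // /neq; first by rewrite E.
by rewrite eq_sym E.
Qed.

Lemma poly_eqfun (p q : {poly K}) (s : seq K) :
  (forall t, t \notin s -> p.[t] = q.[t]) -> p = q.
Proof.
move=> H; apply/eqP; rewrite -subr_eq0.
have /eqP : (p - q) * \prod_(z <- s) ('X - z%:P) = 0.
  apply/eqP/negbNE/negP => /closed_nonrootP[x]; rewrite rootM root_prod_XsubC.
  by rewrite negb_or => /andP[+ /H pq]; rewrite /root !hornerE pq subrr eqxx.
rewrite mulf_eq0 => /orP[//|]; rewrite (negPf (monic_neq0 _)) //.
by rewrite monic_prod_XsubC.
Qed.

Lemma regular_fun_poly (h : K -> K) :
  (forall t0, exists A B : {poly K}, B.[t0] != 0 /\ forall t, B.[t] * h t = A.[t]) ->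
  exists q : {poly K}, forall t, h t = q.[t].
Proof.
move=> H; have [A0 [B0 [B00 E0]]] := H 0.
have: exists A B : {poly K}, B != 0 /\ forall t, B.[t] * h t = A.[t].
  exists A0, B0; split=> //; apply: contraNneq B00 => ->; by rewrite horner0.
case=> A [B]; move: {2}(size B) (leqnn (size B)) => s.
elim: s A B => [|s IH] A B.
  by rewrite leqn0 size_poly_eq0 => /eqP-> []; rewrite eqxx.
move=> sB [Bn0 E]; have [/closed_rootP[t0 rt0]|] := boolP (size B != 1%N); last first.
  move/negPn/size_poly1P => [c c0 Bc]; exists (c^-1 *: A) => t.
  by rewrite hornerZ -E Bc hornerC mulKf.
have [B1 B1E] : exists B1, B = B1 * ('X - t0%:P) by apply/factor_theorem.
have [A1 A1E] : exists A1, A = A1 * ('X - t0%:P).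
  by apply/factor_theorem; rewrite /root -E (rootP rt0) mul0r.
have B1n0 : B1 != 0 by apply: contraNneq Bn0 => B10; rewrite B1E B10 mul0r.
apply: (IH A1 B1).
  by move: sB; rewrite B1E size_Mmonic ?monicXsubC // size_XsubC addn2 /=.
split=> // t; have [->|tt0] := eqVneq t t0; last first.
  have t0' : t - t0 != 0 by rewrite subr_eq0.
  apply: (mulIf t0'); move: (E t); rewrite B1E A1E !hornerE => <-.
  by rewrite mulrAC.
have [A' [B' [B't0 E']]] := H t0.
have /(congr1 (fun p => p.[t0])) : B' * A1 = B1 * A'.
  apply: (@poly_eqfun _ _ [:: t0]) => u; rewrite inE => ut0.
  have u0 : u - t0 != 0 by rewrite subr_eq0.
  have Eu : B1.[u] * (u - t0) * h u = A1.[u] * (u - t0).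
    by have := E u; rewrite B1E A1E !hornerM hornerXsubC.
  by apply: (mulIf u0); rewrite !hornerM -E' -mulrA -Eu; ring.
by rewrite !hornerM -E' mulrCA => /(mulfI B't0) <-.
Qed.

(* A function that is polynomial of degree at most d in each variable
   separately is polynomial. *)
Lemma sep_poly (m d : nat) (h : ('I_m -> K) -> K) :
  (forall i y, exists2 q : {poly K}, (size q <= d.+1)%N &
     forall t, h (fun j => if j == i then t else y j) = q.[t]) ->
  exists P : {mpoly K[m]}, forall y, h y = P.@[y].
Proof.
have [x xI] := infinite_field.
suff: forall (s : seq 'I_m) (h : ('I_m -> K) -> K),
  (forall y z, {in s, y =1 z} -> h y = h z) ->
  (forall i y, exists2 q : {poly K}, (size q <= d.+1)%N &
     forall t, h (fun j => if j == i then t else y j) = q.[t]) ->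
  exists P : {mpoly K[m]}, forall y, h y = P.@[y].
  move=> S; apply: (S (enum 'I_m)) => y z yz; congr h; apply/funext => i.
  by apply: yz; rewrite mem_enum.
elim=> [|i s IH] {}h dep sep.
  by exists (h (fun=> 0))%:MP => y; rewrite mevalC; apply: dep.
pose hk (k : 'I_d.+1) y := h (fun j => if j == i then x k else y j).
have /choice[P PE] : forall k : 'I_d.+1, exists P : {mpoly K[m]}, forall y, hk k y = P.@[y].
  move=> k; apply: IH => [y z yz|j y].
    apply: dep => j; rewrite inE; case: eqP => //= _; exact: yz.
  have [->|ji] := eqVneq j i.
    exists (hk k y)%:P; first by rewrite (leq_trans (size_polyC_leq1 _)).
    move=> t; rewrite hornerC; congr h; apply/funext => l /=; by case: eqP.
  have [q sq qE] := sep j (fun l => if l == i then x k else y l).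
  exists q => // t; rewrite -qE; congr h; apply/funext => l /=.
  by have [->|] := eqVneq l i; rewrite ?(negPf ji) // eq_sym (negPf ji).
pose L k : {mpoly K[m]} := (map_poly (@mpolyC m K) (tnth (d.+1.-lagrange x) k)).['X_i].
exists (\sum_(k < d.+1) P k * L k) => y.
have [q sq qE] := sep i y.
have -> : h y = q.[y i].
  by rewrite -qE; congr h; apply/funext => j; case: eqP => // ->.
rewrite {1}(lagrange_gen _ xI sq) // horner_sum raddf_sum /=.
apply: eq_bigr => k _; rewrite mevalM -PE hornerM hornerC -qE; congr (_ * _).
rewrite /L -[X in meval _ X]/(_).
rewrite -horner_map /= -map_poly_comp /= mevalXU map_poly_id // => c _ /=.
exact: mevalC.
Qed.

Lemma meval_line m (P : {mpoly K[m]}) (u v : 'I_m -> K) :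
  exists q : {poly K}, forall t, P.@[fun i => u i + t * v i] = q.[t].
Proof.
exists (\sum_(a <- msupp P) (P@_a)%:P * \prod_i ((u i)%:P + 'X * (v i)%:P) ^+ a i).
move=> t; rewrite mevalE horner_sum; apply: eq_bigr => a _.
rewrite hornerM hornerC horner_prod; congr (_ * _); apply: eq_bigr => i _.
by rewrite !hornerE.
Qed.

Lemma homog_of_scale m d (P : {mpoly K[m]}) :
  (forall y c, P.@[fun i => c * y i] = c ^+ d * P.@[y]) ->
  exists2 Q : {mpoly K[m]}, Q \is d.-homog & forall y, P.@[y] = Q.@[y].
Proof.
move=> H; exists (pihomog mdeg d P); first exact: pihomogP.
move=> y; pose N := (maxn (msize P) d.+1).
have PN : P = \sum_(k < N) pihomog mdeg k P.
  by apply: pihomog_partitionE; rewrite leq_maxl.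
have dN : (d < N)%N by rewrite leq_max ltnSn orbT.
have scale k c : (pihomog mdeg k P).@[fun i => c * y i] = c ^+ k * (pihomog mdeg k P).@[y].
  rewrite !mevalE mulr_sumr; apply: eq_big_seq => a aP.
  rewrite mulrCA; congr (_ * _); under eq_bigr do rewrite exprMn.
  rewrite big_split /= prodrXr; congr (_ ^+ _ * _).
  by rewrite -mdegE; apply: (dhomogP _ _ _ (pihomogP mdeg k P)).
have : \sum_(k < N) (pihomog mdeg k P).@[y] *: 'X^k = P.@[y] *: 'X^d :> {poly K}.
  apply: (@poly_eqfun _ _ [::]) => c _; rewrite horner_sum hornerZ hornerXn mulrC -H.
  rewrite [in RHS]PN raddf_sum /=; apply: eq_bigr => k _.
  by rewrite scale hornerZ hornerXn mulrC.
move/(congr1 (fun p : {poly K} => p`_d)); rewrite coef_sum coefZ coefXn eqxx mulr1 => <-.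
rewrite (bigD1 (Ordinal dN)) //= coefZ coefXn eqxx mulr1 big1 ?addr0 // => k kd.
by rewrite coefZ coefXn eq_sym -val_eqE /= in kd *; rewrite (negPf kd) mulr0.
Qed.

Lemma is_form_line (W : vectType K) k (G : W -> K) x e : is_form k G ->
  exists q : {poly K}, forall t, G (x + t *: e) = q.[t].
Proof.
move=> [P _ PE]; have [q qE] := meval_line P (fun i => coord (vbasis {:W}) i x)
  (fun i => coord (vbasis {:W}) i e).
exists q => t; rewrite -qE PE; apply: meval_eq => i.
by rewrite linearD linearZ.
Qed.

End PolynomialFunctions.

Section GlobalSections.
Variables (K : closedFieldType) (n d : nat).
Notation V := 'rV[K]_n.+1.

Lemma coneT (x : V) : x != 0 -> cone zopenT x.
Proof. by move=> x0; split=> //; exists (point x0) => //; apply: memv_line. Qed.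

(* H^0(PV, O(d)) is the space of forms of degree d on V. *)
Theorem twist_global (f : O_ V d zopenT) : exists P : dhomog n.+1 K d,
  forall x (hx : cone zopenT x), twist_fun f (exist _ x hx) = P.@[x 0].
Proof.
pose g x := if pselect (x != 0) is left x0 then f (exist _ x (coneT x0)) else 0.
have fg x (hx : cone zopenT x) : f (exist _ x hx) = g x.
  rewrite /g; case: pselect => [x0|/negP]; last by have [x0] := hx; rewrite x0.
  by congr (twist_fun f _); apply: eq_exist.
have gl x : x != 0 -> exists m A B, [/\ is_form (m + d) A, is_form m B, B x != 0 &
    forall y : V, y != 0 -> B y != 0 -> g y = A y / B y].
  move=> x0; have /asboolP rf := valP f.
  have [m [A [B [fA fB B0 E]]]] := rf (point x0) I.
  exists m, A, B; split=> //; first by rewrite B0 ?memv_line.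
  by move=> y y0 By; rewrite -(fg _ (coneT y0)) E.
have gZ c x : x != 0 -> c != 0 -> g (c *: x) = c ^+ d * g x.
  move=> x0 c0; have [m [A [B [fA fB Bx E]]]] := gl x x0.
  have cm : c ^+ m != 0 by rewrite expf_neq0.
  rewrite (E x) // (E (c *: x)); last 2 first.
  - by rewrite scaler_eq0 negb_or c0.
  - by rewrite (is_formZ _ _ fB) mulf_neq0.
  rewrite (is_formZ _ _ fA) (is_formZ _ _ fB) exprD.
  by field; rewrite cm Bx.
have lineP (x e : V) : (forall t, x + t *: e != 0) ->
    exists q : {poly K}, forall t, g (x + t *: e) = q.[t].
  move=> xe0; apply: regular_fun_poly => t0.
  have [m [A [B [fA fB Bx E]]]] := gl _ (xe0 t0).
  have [a aE] := is_form_line x e fA; have [b bE] := is_form_line x e fB.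
  exists (a * b), (b * b); rewrite !hornerE -bE mulf_neq0 //; split=> // t.
  rewrite !hornerE -aE -bE; have [->|Bt] := eqVneq (B (x + t *: e)) 0.
    by rewrite mulr0 mul0r mulr0.
  by rewrite E //; field.
have indep_deg (x e : V) :
    (forall a b, a *: x + b *: e = 0 -> a = 0 /\ b = 0) ->
    exists2 q : {poly K}, (size q <= d.+1)%N & forall t, g (x + t *: e) = q.[t].
  move=> ind; have [t|q qE] := lineP x e.
    apply/eqP => E; have /ind[/eqP] : 1 *: x + t *: e = 0.
      by rewrite scale1r.
    by rewrite oner_eq0.
  have [t|r rE] := lineP e x.
    apply/eqP => E; have /ind[_ /eqP] : t *: x + 1 *: e = 0.
      by rewrite scale1r addrC.
    by rewrite oner_eq0.
  exists q => //; pose M := size r.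
  pose r' := \sum_(i < M) r`_i *: 'X^(M - i).
  have size_r' : (size r' <= M.+1)%N.
    apply: (leq_trans (size_sum _ _ _)); apply/bigmax_leqP => i _.
    apply: (leq_trans (size_scale_leq _ _)).
    by rewrite size_polyXn ltnS leq_subr.
  have E : q * 'X^M = r' * 'X^d.
    apply: (@poly_eqfun _ _ _ [:: 0]) => t; rewrite inE => t0.
    have xe : e + t^-1 *: x != 0.
      apply/eqP => E; have /ind[_ /eqP] : t^-1 *: x + 1 *: e = 0.
        by rewrite scale1r addrC.
      by rewrite oner_eq0.
    have qt : q.[t] = t ^+ d * r.[t^-1].
      rewrite -qE -rE -gZ //; congr g.
      by rewrite scalerDr scalerA divff // scale1r addrC.
    rewrite !hornerM !hornerXn qt [in RHS]mulrC -mulrA; congr (_ * _).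
    rewrite horner_coef mulr_suml /r' horner_sum; apply: eq_bigr => i _.
    rewrite hornerZ hornerXn -mulrA exprVn; congr (_ * _).
    by rewrite expfB // mulrC.
  have [->|q0] := eqVneq q 0; first by rewrite size_poly0.
  have : (size (q * 'X^M)%R <= M + d.+1)%N.
    rewrite E; have [->|r0] := eqVneq r' 0; first by rewrite mul0r size_poly0.
    by rewrite size_mulXn // addnC addnS -addSn leq_add2r.
  by rewrite size_mulXn // leq_add2l.
have const (x y : V) : d = 0%N -> x != 0 -> y != 0 -> g x = g y.
  move=> d0 x0 y0; have [[c yc]|dep] := pselect (exists c, y = c *: x).
    rewrite yc gZ // ?d0 ?expr0 ?mul1r //.
    by apply: contraNneq y0 => c0; rewrite yc c0 scale0r.
  have ind a b : a *: x + b *: (y - x) = 0 -> a = 0 /\ b = 0.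
    move=> E; have b0 : b = 0.
      apply/eqP/negPn/negP => b0; apply: dep; exists (1 - b^-1 * a).
      have /(congr1 (fun z => b^-1 *: z)) := E.
      rewrite scalerDr !scalerA mulVf // scale1r scaler0 => /eqP.
      by rewrite addrCA addr_eq0 => /eqP->; rewrite opprD opprK scalerBl scale1r addrC.
    move: E; rewrite b0 scale0r addr0 => /eqP; rewrite scaler_eq0 (negPf x0) orbF.
    by move/eqP.
  have [q sq qE] := indep_deg _ _ ind; move: sq; rewrite d0 => /size1_polyC qc.
  have := qE 0; have := qE 1; rewrite qc !hornerC scale1r scale0r addr0 => <-.
  by rewrite addrC subrK.
pose v0 : V := const_mx 1.
have v00 : v0 != 0.
  by apply/eqP => /matrixP/(_ 0 0)/eqP; rewrite !mxE oner_eq0.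
pose gg (x : V) := if x == 0 then 0 ^+ d * g v0 else g x.
have ggZ c (x : V) : gg (c *: x) = c ^+ d * gg x.
  rewrite /gg scaler_eq0; have [->|c0] /= := eqVneq c 0.
    have [d0|d0] := posnP d; last by rewrite expr0n gtn_eqF // !mul0r.
    rewrite d0 !expr0 !mul1r; case: eqP => // /eqP x0; exact: const.
  have [_|x0] := eqVneq x 0; last exact: gZ.
  have [->|d0] := posnP d; first by rewrite !expr0 !mul1r.
  by rewrite expr0n gtn_eqF // mul0r mulr0.
have sep (x e : V) :
    exists2 q : {poly K}, (size q <= d.+1)%N & forall t, gg (x + t *: e) = q.[t].
  have [->|e0] := eqVneq e 0.
    exists (gg x)%:P; first by rewrite (leq_trans (size_polyC_leq1 _)).
    by move=> t; rewrite scaler0 addr0 hornerC.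
  have [[c ->]|dep] := pselect (exists c, x = c *: e).
    exists (gg e *: ('X + c%:P) ^+ d).
      apply: (leq_trans (size_scale_leq _ _)).
      by apply: (leq_trans (size_exp_leq _ _)); rewrite size_XaddC mul1n.
    by move=> t; rewrite -scalerDl ggZ hornerZ horner_exp !hornerE mulrC [t + c]addrC.
  have ind a b : a *: x + b *: e = 0 -> a = 0 /\ b = 0.
    move=> E; have a0 : a = 0.
      apply/eqP/negPn/negP => a0; apply: dep; exists (- (a^-1 * b)).
      have /(congr1 (fun z => a^-1 *: z)) := E.
      rewrite scalerDr !scalerA mulVf // scale1r scaler0 => /eqP.
      by rewrite addr_eq0 => /eqP->; rewrite scaleNr.
    move: E; rewrite a0 scale0r add0r => /eqP; rewrite scaler_eq0 (negPf e0) orbF.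
    by move/eqP.
  have [q sq qE] := indep_deg x e ind; exists q => // t; rewrite -qE /gg.
  case: eqP => // E; have /ind[/eqP] : 1 *: x + t *: e = 0.
    by rewrite scale1r.
  by rewrite oner_eq0.
have [i y|P PE] := @sep_poly K n.+1 d (fun y => gg (\row_i y i)).
  have [q sq qE] := sep (\row_j (if j == i then 0 else y j)) (delta_mx 0 i).
  exists q => // t; rewrite -qE; congr gg; apply/rowP => j; rewrite !mxE eqxx /=.
  by case: eqP => _; rewrite ?mulr1 ?mulr0 ?add0r ?addr0.
have [y c|Q hQ QE] := @homog_of_scale K _ d P.
  rewrite -!PE -ggZ; congr gg; by apply/rowP => i; rewrite !mxE.
exists (DHomog hQ) => x hx /=; rewrite fg -QE -PE.
have -> : \row_i x 0 i = x by apply/rowP => i; rewrite !mxE.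
by rewrite /gg; case: hx => /negPf ->.
Qed.

End GlobalSections.

Section Veronese.
Variables (K : closedFieldType) (n d : nat).
Notation V := 'rV[K]_n.+1.

(* S^d V is identified with the dual of H^0(PV, O(d)). *)
Definition SdV : vectType K := 'Hom(dhomog n.+1 K d, K^o).

Definition eval_form (x : V) (P : dhomog n.+1 K d) : K^o := P.@[x 0].

Fact eval_form_linear x : linear (eval_form x).
Proof. by move=> a P Q; rewrite /eval_form /= mevalD mevalZ. Qed.

HB.instance Definition _ x := GRing.isLinear.Build K (dhomog n.+1 K d) K^o _
  (eval_form x) (eval_form_linear x).

Fact dim_veronese (p : proj V) :
  \dim <[linfun (eval_form (vpick (line p))) : SdV]>%VS == 1%N.
Proof.
apply: dim_point; apply/eqP => ev0.
have [i xi] : exists i, vpick (line p) 0 i != 0.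
  have [i xi|x0] := pickP (fun i => vpick (line p) 0 i != 0); first by exists i.
  have : vpick (line p) == 0.
    by apply/eqP/rowP => i; rewrite mxE; apply/eqP; move/negbFE: (x0 i).
  by rewrite vpick0 -dimv_eq0; case: p {ev0 x0} => l /= /eqP->.
have hX : ('X_i ^+ d : {mpoly K[n.+1]}) \is d.-homog.
  by rewrite -[X in X.-homog]mul1n dhomogMn // dhomogX /= mdeg1.
have /lfunP/(_ (DHomog hX)) := ev0.
rewrite lfunE lfunE /= /eval_form /= rmorphXn /= mevalXU => /eqP.
by rewrite expf_eq0 (negPf xi) andbF.
Qed.

Definition veronese (p : proj V) : proj SdV := Proj (dim_veronese p).

Definition form_of (f : O_ V d zopenT) : dhomog n.+1 K d :=
  sval (cid (twist_global f)).

Section Bundle.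
Variable E : omod V.

Definition H0 : Type := E zopenT.

(* H^0(PV, O(d) (x) E^vee), as the space of O-linear morphisms E -> O(d);
   under this identification the contraction E (x) O(d) (x) E^vee -> O(d) is the
   evaluation of morphisms. *)
Definition H0_twisted_dual : Type := omod_hom E (O_ V d).

Definition mult (s : H0) (t : H0_twisted_dual) : dhomog n.+1 K d :=
  form_of (t zopenT s).

Definition jmap (F : SdV) (s : H0) (t : H0_twisted_dual) : K := F (mult s t).

(* The k x k minors of j^E are taken on arbitrary families of k sections. As a
   minor is multilinear and alternating in its rows and columns, their common
   zeros are those of the minors in any bases. *)
Definition minors_vanish (k : nat) (F : SdV) : Prop :=
  forall (s : 'I_k -> H0) (t : 'I_k -> H0_twisted_dual),
    \det (\matrix_(i < k, j < k) jmap F (s i) (t j)) = 0.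

Definition Z_bundle (r e : nat) : set (proj SdV) :=
  [set p | forall F : SdV, F \in line p -> minors_vanish (r * e + 1) F].

End Bundle.

Definition Z_all (r : nat) : set (proj SdV) :=
  [set p | forall (e : nat) (E : omod V), vector_bundle e E -> Z_bundle E r e p].

End Veronese.

Arguments SdV : clear implicits.
Arguments veronese {K n} d p.
Arguments Z_all : clear implicits.

(* Main.v *)
Require Import Defs.
From HB Require Import structures.
From mathcomp Require Import all_boot all_order all_algebra perm ring zify.
From mathcomp Require Import boolp classical_sets functions.
From mathcomp.multinomials Require Import mpoly.

Set Implicit Arguments.
Unset Strict Implicit.
Unset Printing Implicit Defensive.

Import GRing.Theory.
Local Open Scope ring_scope.
Local Open Scope classical_set_scope.

(* If F is a functional on forms of degree d that factors through the coordinate ring of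
   a scheme of length r (a point of the cactus variety), then j^E(F) factors through the
   restriction of E to that scheme, a space of dimension r e, whence F lies in Z_r. So it
   suffices to find such an F outside the secant variety.

   For n = 5 and n = 4, functionals of order 2k+1 at a point of P^n (k = 2, resp. k = 4)
   factor through schemes of length 2 C(n+k, k), that is, 42 and 140; letting them and
   r - 42, resp. r - 140, points with weights move gives the cone over the cactus variety a
   tangent space of dimension larger than r (n+1), whereas r (n+1) parameters describe the
   cone over the secant variety.

   For n >= 6, F is the sum of a functional dual to a cubic in six variables, whose
   apolar algebra has Hilbert function (1, 6, 6, 1) and length 14, and of one supported
   on a scheme of length r - 14 in a line, both in P^6. Let a = r - 1 and b = d - a. If F
   is a sum of r points and its catalecticant S^a -> (S^b)^* has rank r, then
   products of elements of the left and right kernels vanish doubly at those points, and so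
   span a space of codimension at least 7 r. For the chosen F the codimension is at most
   90 + 7 (r - 14) < 7 r; the inequality on ranks is a polynomial condition on F. *)

(** For n = 6 a count of parameters cannot succeed: functionals of order 3 at a moving point of P^6
    depend on at most 84 + 6 = 90 parameters, fewer than the 98 of 14 weighted points. Hence the
    semicontinuous invariant, the codimension of the products of kernel elements. The square of the
    apolar ideal of the cubic misses only six dimensions in degree 4 and none in degree 5, which
    keeps its codimension below that of 14 points; the scheme in a line is a limit of points and
    adds as much as points would.

    For n = 5 the count is tight: 42 points have 42 x 6 = 252 parameters, and the functionals of
    order 5 at a fixed point already form a space of dimension C(10, 5) = 252. One direction that
    moves the support decides.

    Coefficients of monomials replace derivatives throughout, so that the arguments hold in every
    characteristic. *)

Section Evaluation.
Variable K : closedFieldType.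

Lemma digits_inj n D (a b : 'I_n -> nat) :
  (forall i, a i < D)%N -> (forall i, b i < D)%N ->
  (\sum_i a i * D ^ i = \sum_i b i * D ^ i)%N -> a =1 b.
Proof.
elim: n a b => [|n IH] a b aD bD; first by move=> _ [].
rewrite !big_ord_recl /= !expn0 !muln1.
have E (c : 'I_n.+1 -> nat) : (\sum_(i < n) c (lift ord0 i) * D ^ bump 0 i =
    (\sum_(i < n) c (lift ord0 i) * D ^ i) * D)%N.
  by rewrite big_distrl /=; apply: eq_bigr => i _; rewrite expnS mulnCA mulnC.
rewrite !E => H; have D0 : (0 < D)%N by apply: leq_ltn_trans (aD ord0).
have H0 : a ord0 = b ord0.
  by move/(congr1 (modn^~ D)): H; rewrite !(addnC _ (_ * D)%N) !modnMDl !modn_small.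
move: H; rewrite H0 => /addnI/eqP; rewrite eqn_pmul2r // => /eqP/IH H i.
case: (unliftP ord0 i) => [j|] -> //.
by apply: (H _ _ j).
Qed.

(* Kronecker's substitution reduces this to polynomials in one variable. *)
Lemma meval_eq0 n (P : {mpoly K[n]}) : (forall x, P.@[x] = 0) -> P = 0.
Proof.
move=> P0; pose D := (msize P).+1; pose h (i : 'I_n) : {poly K} := 'X^(D ^ i).
have hP : mmap (@polyC K) h P = 0.
  apply: (@poly_eqfun _ _ _ [::]) => t _; rewrite horner0 -(P0 (fun i => t ^+ (D ^ i))).
  rewrite /mmap horner_sum mevalE; apply: eq_bigr => m _.
  rewrite hornerM hornerC /mmap1 horner_prod; congr (_ * _).
  by apply: eq_bigr => i _; rewrite horner_exp hornerXn.
apply/mpolyP => m0; rewrite mcoeff0; have [m0P|/memN_msupp_eq0//] := boolP (m0 \in msupp P).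
have bnd m : m \in msupp P -> forall i, (m i < D)%N.
  move=> /msize_mdeg_lt mP i; rewrite ltnS; apply: leq_trans (ltnW mP).
  by rewrite mdegE (bigD1 i) //= leq_addr.
have E m : mmap1 h m = 'X^(\sum_i m i * D ^ i).
  rewrite /mmap1 -prodrXr; apply: eq_bigr => i _.
  by rewrite /h -exprM mulnC.
move/(congr1 (fun q : {poly K} => q`_(\sum_i m0 i * D ^ i))): hP.
rewrite coef0 /mmap coef_sum (bigD1_seq m0) ?msupp_uniq //= E coefCM coefXn eqxx mulr1.
rewrite big1_seq ?addr0 // => m /andP[mm0 mP]; rewrite E coefCM coefXn.
case: eqP => [/digits_inj e|_]; last by rewrite mulr0.
by case/eqP: mm0; apply/mnmP => i; apply/esym/e => j; apply: bnd.
Qed.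

End Evaluation.

(** * Forms on a vector space *)

Section FormClosure.
Variables (K : fieldType) (W : vectType K).
Implicit Types (G H : W -> K).

Lemma is_form_ext k G H : G =1 H -> is_form k G -> is_form k H.
Proof. by move=> GH [P hP PE]; exists P => // w; rewrite -GH. Qed.

Lemma is_form0 k : is_form k (fun _ : W => 0 : K).
Proof. by exists 0 => [|w]; [exact: dhomog0 | rewrite meval0]. Qed.

Lemma is_formMl k (c : K) G : is_form k G -> is_form k (fun w => c * G w).
Proof. by move=> fG; rewrite -[k]add0n; apply: is_formM => //; apply: is_form_const. Qed.

Lemma is_formD k G H : is_form k G -> is_form k H -> is_form k (fun w => G w + H w).
Proof.
move=> fG fH; apply: (is_form_ext (G := fun w => G w - -1 * H w)) => [w|].
  by rewrite mulN1r opprK.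
by apply: is_formB => //; apply: is_formMl.
Qed.

Lemma is_form_sum k (I : Type) (s : seq I) (Q : pred I) (G : I -> W -> K) :
  (forall i, Q i -> is_form k (G i)) -> is_form k (fun w => \sum_(i <- s | Q i) G i w).
Proof.
move=> fG; elim: s => [|i s IH].
  by apply: is_form_ext (is_form0 _) => w; rewrite big_nil.
have [Qi|Qi] := boolP (Q i).
  by apply: is_form_ext (is_formD (fG i Qi) IH) => w; rewrite big_cons Qi.
by apply: is_form_ext IH => w; rewrite big_cons (negPf Qi).
Qed.

Lemma is_form_prod (I : Type) (s : seq I) (k : I -> nat) (G : I -> W -> K) :
  (forall i, is_form (k i) (G i)) ->
  is_form (\sum_(i <- s) k i) (fun w => \prod_(i <- s) G i w).
Proof.
move=> fG; elim: s => [|i s IH].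
  rewrite big_nil; apply: is_form_ext (is_form_const _ 1) => w.
  by rewrite big_nil.
rewrite big_cons; apply: is_form_ext (is_formM (fG i) IH) => w.
by rewrite big_cons.
Qed.

Lemma is_form_det k m (M : 'I_m -> 'I_m -> W -> K) :
  (forall i j, is_form k (M i j)) ->
  is_form (m * k) (fun w => \det (\matrix_(i, j) M i j w)).
Proof.
move=> fM; have -> : (m * k = \sum_(i < m) k)%N by rewrite sum_nat_const card_ord.
apply: is_form_sum => s _; apply: is_formMl.
have := is_form_prod (index_enum 'I_m) (fun i => fM i (s i)).
by apply: is_form_ext => w; apply: eq_bigr => i _; rewrite mxE.
Qed.

Lemma is_form_lin G : (forall c u v, G (c *: u + v) = c * G u + G v) -> is_form 1 G.
Proof.
move=> Glin; have G0 : G 0 = 0.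
  by apply: (@addIr _ (G 0)); rewrite add0r -{1}[G 0]mul1r -Glin scaler0 add0r.
exists (\sum_(i < \dim {:W}) G (vbasis {:W})`_i *: 'X_i) => [|w].
  by apply: rpred_sum => i _; apply: dhomogZ; rewrite dhomogX /= mdeg1.
have Gsum (I : Type) (s : seq I) (c : I -> K) (u : I -> W) :
    G (\sum_(i <- s) c i *: u i) = \sum_(i <- s) c i * G (u i).
  by elim: s => [|i s IH]; rewrite ?big_nil ?big_cons ?Glin ?IH.
rewrite {1}(coord_vbasis (memvf w)) Gsum raddf_sum /=.
by apply: eq_bigr => i _; rewrite mevalZ mevalXU mulrC.
Qed.

Lemma is_form_meval m k (P : {mpoly K[m]}) (y : 'I_m -> W -> K) e :
  P \is k.-homog -> (forall i, is_form e (y i)) ->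
  is_form (k * e) (fun w => P.@[fun i => y i w]).
Proof.
move=> hP fy; suff: is_form (k * e) (fun w : W =>
    \sum_(a <- msupp P) (if a \in msupp P then P@_a * \prod_i y i w ^+ a i else 0)).
  by apply: is_form_ext => w; rewrite mevalE; apply: eq_big_seq => a ->.
apply: is_form_sum => a _; have [aP|aP] := boolP (a \in msupp P); last exact: is_form0.
apply: is_formMl; rewrite -(dhomogP _ _ _ hP a aP) /= mdegE big_distrl /=.
apply: (@is_form_prod _ _ (fun i => a i * e)%N (fun i w => y i w ^+ a i)) => i.
elim: (a i) => [|l IH]; first exact: is_form_const.
apply: is_form_ext (is_formM (fy i) IH) => w; by rewrite exprS.
Qed.

End FormClosure.

Lemma dhomog_comp (K : idomainType) m n k (P : {mpoly K[m]}) (L : m.-tuple {mpoly K[n]}) :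
  P \is k.-homog -> (forall i, tnth L i \is 1.-homog) -> P \mPo L \is k.-homog.
Proof.
move=> hP hL; rewrite comp_mpolyEX big_seq; apply: rpred_sum => a aP.
rewrite dhomogZ // comp_mpolyX -(dhomogP _ _ _ hP a aP) /= mdegE.
elim/big_ind2: _ => [|p k1 q k2 hp hq|i _]; first exact: dhomog1.
  exact: dhomogM.
by have := dhomogMn (a i) (hL i); rewrite mul1n.
Qed.

Section RowForms.
Variables (K : fieldType) (n : nat).
Notation V := 'rV[K]_n.

(** [is_form] reads coordinates in [vbasis]; the linear substitution [L] passes to the standard
    coordinates of row vectors. *)
Lemma is_form_mpolyP k (G : V -> K) : is_form k G ->
  exists2 P : {mpoly K[n]}, P \is k.-homog & forall w, G w = P.@[w 0].
Proof.
case=> P hP PE; pose b := vbasis {:V}.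
pose L (i : 'I_(\dim {:V})) : {mpoly K[n]} := \sum_j coord b i (delta_mx 0 j) *: 'X_j.
exists (P \mPo [tuple L i | i < _]) => [|w].
  by apply: dhomog_comp => // i; rewrite tnth_mktuple; apply: rpred_sum => j _;
     apply: dhomogZ; rewrite dhomogX /= mdeg1.
rewrite comp_mpoly_meval PE; apply: meval_eq => i; rewrite tnth_mktuple raddf_sum /=.
rewrite {1}[w]row_sum_delta linear_sum; apply: eq_bigr => j _.
by rewrite linearZ /= mevalZ mevalXU mulrC.
Qed.

End RowForms.

(** * The cactus variety lies in Z_r *)

Section LocalFunctionals.
Variables (K : closedFieldType) (n : nat).
Notation V := 'rV[K]_n.+1.
Notation poly := {mpoly K[n.+1]}.

(* phi is a functional on the coordinate ring of a scheme of length at most l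
   supported at the point x. *)
Definition local_functional (x : V) (l : nat) (phi : poly -> K) : Prop :=
  [/\ x != 0,
      exists N, forall h g, h.@[x 0] = 0 -> phi (h ^+ N * g) = 0
    & exists al be : 'I_l -> poly -> K,
        forall g h, phi (g * h) = \sum_i al i g * be i h].

Variables (x : V) (l : nat) (phi : {linear poly -> K^o}).
Hypothesis phix : local_functional x l phi.

(** As 1 - c B vanishes at x, its N-th power is killed by [phi], and the truncated geometric series
    inverts B as far as [phi] can see. *)
Lemma local_inverse B : B.@[x 0] != 0 ->
  exists B', forall g, phi (B * B' * g) = phi g.
Proof.
case: phix => _ [N phiN] _ Bx; pose c := (B.@[x 0])^-1.
exists (c *: \sum_(i < N) (1 - c *: B) ^+ i) => g.
have -> : B * (c *: \sum_(i < N) (1 - c *: B) ^+ i) = 1 - (1 - c *: B) ^+ N.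
  by rewrite -[RHS]opprB subrX1 addrAC subrr sub0r mulNr opprK -scalerAr -scalerAl.
rewrite mulrBl mul1r linearB /= phiN ?subr0 //.
by rewrite mevalB meval1 mevalZ mulVf // subrr.
Qed.

(** This lets [phi] act on germs of rational functions at x: denominators that do not vanish there
    are replaced by the inverses of [local_inverse]. *)
Lemma local_germ m (P H : poly) (A B B' C D D' : 'I_m -> poly) :
  H.@[x 0] != 0 -> (forall j, (B j).@[x 0] != 0) -> (forall j, (D j).@[x 0] != 0) ->
  (forall j g, phi (B j * B' j * g) = phi g) ->
  (forall j g, phi (D j * D' j * g) = phi g) ->
  (forall y : V, H.@[y 0] != 0 -> (forall j, (B j).@[y 0] != 0) ->
    (forall j, (D j).@[y 0] != 0) ->
    P.@[y 0] = \sum_j (A j).@[y 0] / (B j).@[y 0] * ((C j).@[y 0] / (D j).@[y 0])) ->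
  phi P = \sum_j phi (A j * B' j * (C j * D' j)).
Proof.
move=> Hx Bx Dx BB DD PE; pose u := H * (\prod_j B j) * (\prod_j D j).
pose v j := H * (\prod_(i | i != j) B i) * (\prod_(i | i != j) D i).
have uv j : u = v j * B j * D j by rewrite /u (bigD1 j) //= [X in _ * X](bigD1 j) //= /v; ring.
have ux : u.@[x 0] != 0.
  rewrite !mevalM !mulf_neq0 // rmorph_prod; apply/prodf_neq0 => j _ //=.
have [u' uu'] := local_inverse ux.
have E : u * P = \sum_j v j * (A j * C j).
  (* The identity is known only where [u] does not vanish; one more factor [u] makes it hold
     everywhere. *)
  apply/eqP; rewrite -subr_eq0; apply/eqP/(mulfI (x := u)).
    by apply: contraNneq ux => ->; rewrite meval0.
  rewrite mulr0; apply: meval_eq0 => y0; rewrite mevalM.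
  have [->|uy] := eqVneq u.@[y0] 0; first by rewrite mul0r.
  pose y : V := \row_i y0 i.
  have yE Q : Q.@[y0] = Q.@[y 0] by apply: meval_eq => i; rewrite mxE.
  have /and3P[Hy] : [&& H.@[y 0] != 0, (\prod_j B j).@[y 0] != 0
      & (\prod_j D j).@[y 0] != 0].
    by move: uy; rewrite yE !mevalM !mulf_eq0 !negb_or -!andbA.
  rewrite !yE.
  rewrite !rmorph_prod /= => /prodf_neq0 By /prodf_neq0 Dy.
  rewrite mevalB; suff -> : (\sum_j v j * (A j * C j)).@[y 0] = u.@[y 0] * P.@[y 0].
    by rewrite [(u * P).@[_]]mevalM subrr mulr0.
  rewrite PE //; [|by move=> j; apply: By|by move=> j; apply: Dy].
  rewrite raddf_sum mulr_sumr; apply: eq_bigr => j _.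
  have := By j isT; have := Dy j isT; rewrite /= (uv j) !mevalM => Djy Bjy.
  by field; apply/andP; split.
rewrite -uu' mulrAC E mulr_suml linear_sum; apply: eq_bigr => j _ /=.
rewrite -[RHS]uu' (uv j).
rewrite -(BB j) -(DD j); congr (phi _); ring.
Qed.

End LocalFunctionals.

Section BundleRank.
Variables (K : closedFieldType) (n d : nat).
Notation V := 'rV[K]_n.+1.
Notation poly := {mpoly K[n.+1]}.

Lemma twist_fun_sum k (U : zopen V) (I : Type) (s : seq I) (f : I -> twist k U) y :
  twist_fun (\sum_(i <- s) f i) y = \sum_(i <- s) twist_fun (f i) y.
Proof. by elim: s => [|i s IH]; rewrite ?big_nil // !big_cons -IH. Qed.

Lemma zopen_form (U : zopen V) (x : V) (x0 : x != 0) : U (Defs.point x0) ->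
  exists2 H : poly, H.@[x 0] != 0 & forall y : V, H.@[y 0] != 0 -> cone U y.
Proof.
have [I [If IE]] : zclosed (~` opens U) by case: U.
move=> Ux; have : ~ (~` opens U) (Defs.point x0) by move/(_ Ux).
rewrite IE => /existsNP[G] /existsNP[w] /not_implyP[IG] /not_implyP[/vlineP[c wc] Gw].
have [k fG] := If G IG; have [P hP PE] := is_form_mpolyP fG.
have Px : P.@[x 0] != 0.
  apply/eqP => Px; apply: Gw; rewrite wc (is_formZ _ _ fG) PE Px mulr0 //.
have [i xi] : exists i, x 0 i != 0.
  have [i xi|x00] := pickP (fun i => x 0 i != 0); first by exists i.
  by case/negP: (x0); apply/eqP/rowP => i; rewrite mxE; apply/eqP; move/negbFE: (x00 i).
(* The factor 'X_i excludes y = 0, which P alone would admit in degree 0. *)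
exists ('X_i * P) => [|y]; first by rewrite mevalM mevalXU mulf_neq0.
rewrite mevalM mevalXU mulf_eq0 negb_or => /andP[yi Py].
have y0 : y != 0 by apply: contraNneq yi => ->; rewrite mxE.
split=> //; exists (Defs.point y0); last exact: memv_line.
apply: contrapT => Uy; have : (~` opens U) (Defs.point y0) by [].
rewrite IE => /(_ G y IG (memv_line _)) /eqP.
by rewrite PE (negPf Py).
Qed.

Lemma regular_germ k (U : zopen V) (f : twist k U) (x : V) (x0 : x != 0) :
  U (Defs.point x0) -> exists AB : poly * poly, AB.2.@[x 0] != 0 /\
  forall (y : V) (hy : cone U y), AB.2.@[y 0] != 0 ->
    twist_fun f (exist _ y hy) = AB.1.@[y 0] / AB.2.@[y 0].
Proof.
move=> Ux; have /asboolP rf := valP f.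
have [m [A [B [fA fB B0 fE]]]] := rf _ Ux.
have [P _ PE] := is_form_mpolyP fA; have [Q _ QE] := is_form_mpolyP fB.
exists (P, Q) => /=; rewrite -QE B0 ?memv_line //; split=> // y hy.
by rewrite -QE -PE; apply: fE.
Qed.

(* Near the support of phi, the matrix factors through e-tuples of germs of
   functions, on which phi sees at most l dimensions each. *)
Lemma jmap_rank e (E : omod V) (F : SdV K n d) x l (phi : {linear poly -> K^o}) k
    (s : 'I_k -> H0 E) (t : 'I_k -> H0_twisted_dual d E) :
  vector_bundle e E -> local_functional x l phi ->
  (forall P : dhomog n.+1 K d, F P = phi P) ->
  (\rank (\matrix_(i, j) jmap F (s i) (t j)) <= e * l)%N.
Proof.
move=> [_ lf] phix FE; have [x0 _ [al [be abE]]] := phix.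
have [U [Ux [b bB]]] := lf (Defs.point x0).
pose sU : U `<=` zopenT := fun _ _ => I.
have sUU : U `<=` U by [].
have /choice[a aE] i : exists a : 'I_e -> regfun U, res sU (s i) = \sum_j a j *: b j.
  have [a [aE _]] := bB U sUU (res sU (s i)); exists a; rewrite aE.
  by apply: eq_bigr => j _; rewrite res_id.
pose tau j m : twist d U := t j U (b m).
have tE i j : twist_res sU (t j zopenT (s i)) = \sum_m a i m *: tau j m.
  have := hom_res (t j) sU (s i); rewrite aE linear_sum /= => <-.
  by apply: eq_bigr => m _; rewrite linearZ.
have [H Hx HU] := zopen_form Ux.
have /choice[AB ABE] (im : 'I_k * 'I_e) := regular_germ (a im.1 im.2 : twist 0 U) Ux.
have /choice[CD CDE] (jm : 'I_k * 'I_e) := regular_germ (tau jm.1 jm.2) Ux.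
have /choice[B' BB] im := local_inverse phix (proj1 (ABE im)).
have /choice[D' DD] jm := local_inverse phix (proj1 (CDE jm)).
pose u i m := (AB (i, m)).1 * B' (i, m); pose v j m := (CD (j, m)).1 * D' (j, m).
have jE i j : jmap F (s i) (t j) = \sum_m phi (u i m * v j m).
  rewrite /jmap FE /mult; set P := form_of _.
  apply: (local_germ (H := H) phix (B := fun m => (AB (i, m)).2) (D := fun m => (CD (j, m)).2)) => //.
  - by move=> m; case: (ABE (i, m)).
  - by move=> m; case: (CDE (j, m)).
  move=> y Hy By Dy; have hy := HU _ Hy.
  have /(congr1 (fun f => twist_fun f (exist _ y hy))) := tE i j.
  rewrite twist_fun_sum /= /restr_fun /= /P /form_of; case: cid => /= Q QE.
  rewrite QE => ->; apply: eq_bigr => m _.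
  have [_ <-] := CDE (j, m); last exact: Dy.
  by have [_ <-] := ABE (i, m); last exact: By.
pose f (c : 'I_(e * l)) := enum_val (cast_ord (esym (mxvec_cast e l)) c).
pose X : 'M[K]_(k, e * l) := \matrix_(i, c) al (f c).2 (u i (f c).1).
pose Y : 'M[K]_(e * l, k) := \matrix_(c, j) be (f c).2 (v j (f c).1).
suff -> : \matrix_(i, j) jmap F (s i) (t j) = X *m Y.
  exact: leq_trans (mulmx_max_rank _ _) _.
apply/matrixP => i j; rewrite !mxE jE.
under eq_bigr do rewrite abE.
rewrite pair_big /= (reindex f) /=.
  by apply: eq_bigr => c _; rewrite !mxE.
apply: onW_bij; apply: bij_comp; first exact: enum_val_bij.
exact: Bijective (cast_ordK _) (cast_ordKV _).
Qed.

End BundleRank.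

Section SecantAndZ.
Variables (K : closedFieldType) (n d : nat).
Notation V := 'rV[K]_n.+1.
Notation poly := {mpoly K[n.+1]}.
Notation S := (SdV K n d).

(* The affine cone over the r-th cactus variety. *)
Definition cactus (r : nat) (F : S) : Prop :=
  exists m (x : 'I_m -> V) (l : 'I_m -> nat) (phi : 'I_m -> {linear poly -> K^o}),
  [/\ forall i, local_functional (x i) (l i) (phi i), (\sum_i l i <= r)%N &
      forall P : dhomog n.+1 K d, F P = \sum_i phi i P].

Lemma mxrank_sum (I : Type) (s : seq I) p q (M : I -> 'M[K]_(p, q)) :
  (\rank (\sum_(i <- s) M i)%R <= \sum_(i <- s) \rank (M i))%N.
Proof.
elim: s => [|i s IH]; first by rewrite !big_nil mxrank0.
by rewrite !big_cons (leq_trans (mxrank_add _ _)) // leq_add2l.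
Qed.

Lemma cactus_minors r F e (E : omod V) : cactus r F -> vector_bundle e E ->
  minors_vanish E (r * e + 1) F.
Proof.
case=> m [x [l [phi [phix lr FE]]]] vE s t; set M := \matrix_(i, j) _.
pose Fi i : S := linfun (phi i \o @mpoly_of_dhomog n.+1 K d).
have ME : M = \sum_i \matrix_(a, b) jmap (Fi i) (s a) (t b).
  apply/matrixP => a b; rewrite summxE !mxE /jmap FE; apply: eq_bigr => i _.
  by rewrite mxE lfunE.
have rM : (\rank M <= r * e)%N.
  rewrite ME (leq_trans (mxrank_sum _ _)) //.
  rewrite (@leq_trans (\sum_i e * l i)) //; last by rewrite -big_distrr /= mulnC leq_mul.
  apply: leq_sum => i _; apply: (jmap_rank _ _ vE (phix i)) => P.
  by rewrite lfunE.
apply/eqP; apply: contraTT rM => dM.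
by rewrite mxrank_unit ?unitmxE ?unitfE // -ltnNge addn1.
Qed.

Lemma cactus_Z_all r (q : proj S) : (forall F, F \in line q -> cactus r F) ->
  Z_all K n d r q.
Proof. by move=> cq e E vE F /cq cF; apply: cactus_minors. Qed.

Lemma local_functionalZ (x : V) l (phi : poly -> K) c :
  local_functional x l phi -> local_functional x l (fun g => c * phi g).
Proof.
case=> x0 [N phiN] [al [be abE]]; split=> //.
  by exists N => h g hx; rewrite phiN ?mulr0.
exists (fun i g => c * al i g), be => g h; rewrite abE mulr_sumr.
by apply: eq_bigr => i _; rewrite mulrA.
Qed.

Lemma cactusZ r c F : cactus r F -> cactus r (c *: F).
Proof.
case=> m [x [l [phi [phix lr FE]]]].
exists m, x, l, (fun i => c \*: phi i); split=> // [i|P].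
  exact: local_functionalZ.
by rewrite scale_lfunE FE -[RHS](mulr_sumr).
Qed.

Lemma cactus_point r F (F0 : F != 0) : cactus r F -> Z_all K n d r (Defs.point F0).
Proof. by move=> cF; apply: cactus_Z_all => _ /vlineP[c ->]; apply: cactusZ. Qed.

Definition evS (x : V) : S := linfun (eval_form (d := d) x).

Lemma local_eval (x : V) : x != 0 -> local_functional x 1 (fun g => g.@[x 0]).
Proof.
move=> x0; split=> //.
  by exists 1%N => h g hx; rewrite mevalM expr1 hx mul0r.
exists (fun _ g => g.@[x 0]), (fun _ g => g.@[x 0]) => g h.
by rewrite big_ord1 mevalM.
Qed.

Lemma secant_cone r (q : proj S) (p : 'I_r -> proj S) :
  (forall i, range (veronese d) (p i)) -> pspan p q -> exists x : 'I_r -> V,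
  (forall i, x i != 0) /\
  forall F, F \in line q -> exists c : 'I_r -> K, F = \sum_i c i *: evS (x i).
Proof.
move=> pv pq; have /choice[v vE] i : exists v : proj V, veronese d v = p i.
  by have [v _ <-] := pv i; exists v.
exists (fun i => vpick (line (v i))); split=> [i|F Fq].
  rewrite vpick0 -dimv_eq0; by case: (v i) => l /= /eqP ->.
have /memv_sumP[u uP ->] : F \in (\sum_i line (p i))%VS by apply: subvP Fq.
have /choice[c cE] i : exists c, u i = c *: evS (vpick (line (v i))).
  by apply/vlineP; have := uP i isT; rewrite -vE.
by exists c; apply: eq_bigr => i _; rewrite cE.
Qed.

Lemma Z_all_closed r : zclosed (Z_all K n d r).
Proof.
exists [set G | exists e (E : omod V) s t, vector_bundle e E /\
  G = fun F => \det (\matrix_(i < r * e + 1, j < r * e + 1) jmap (E := E) F (s i) (t j))].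
split=> [_ [e [E [s [t [vE ->]]]]]|].
  exists ((r * e + 1) * 1)%N; apply: is_form_det => i j; apply: is_form_lin => c u v.
  by rewrite /jmap add_lfunE scale_lfunE.
apply/seteqP; split=> [q qZ _ F [e [E [s [t [vE ->]]]]] Fq|q qI e E vE F Fq s t].
  exact: (qZ e E vE F Fq s t).
by apply: (qI (fun F => _) F _ Fq); exists e, E, s, t.
Qed.

Lemma secant_sub_Z_all r : secant_variety r (range (@veronese K n d)) `<=` Z_all K n d r.
Proof.
move=> q; apply; first exact: Z_all_closed.
move=> {}q [p pv pq]; have [x [x0 xq]] := secant_cone pv pq.
apply: cactus_Z_all => F /xq[c ->].
pose phi i : {linear poly -> K^o} := c i \*: (meval (x i 0) : {linear poly -> K^o}).
exists r, x, (fun=> 1%N), phi; split=> [i||P].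
- exact/local_functionalZ/local_eval.
- by rewrite sum1_card card_ord.
- rewrite sum_lfunE; apply: eq_bigr => i _.
  by rewrite scale_lfunE lfunE.
Qed.

Lemma not_secant r k (G : S -> K) F (F0 : F != 0) : is_form k G ->
  (forall (c : 'I_r -> K) x, G (\sum_i c i *: evS (x i)) = 0) -> G F != 0 ->
  ~ secant_variety r (range (@veronese K n d)) (Defs.point F0).
Proof.
move=> fG GS GF sF; suff : [set q : proj S | forall w, w \in line q -> G w = 0] (Defs.point F0).
  by move/(_ F (memv_line _))/eqP; rewrite (negPf GF).
apply: sF => [|q [p pv pq] w].
  exists [set G]; split=> [_ ->|]; first by exists k.
  apply/seteqP; split=> q qG; first by move=> _ w ->; apply: qG.
  by move=> w; apply: qG.
by have [x [_ xq]] := secant_cone pv pq; move=> /xq[c ->].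
Qed.

(** Both cases of the theorem end here: it is enough to find a form that vanishes on all sums of r
    weighted points and not at some functional of the cactus cone. *)
Lemma secant_proper r k (G : S -> K) F : is_form k G ->
  (forall (c : 'I_r -> K) x, G (\sum_i c i *: evS (x i)) = 0) ->
  cactus r F -> G F != 0 ->
  secant_variety r (range (@veronese K n d)) `<` Z_all K n d r.
Proof.
move=> fG GS cF GF; split; first exact: secant_sub_Z_all.
have F0 : F != 0.
  apply: contraNneq GF => ->; have := GS (fun=> 0) (fun=> 0).
  by rewrite big1 => [->|i _]; rewrite ?scale0r.
by move=> /(_ _ (@cactus_point r F F0 cF)); apply: not_secant fG GS GF.
Qed.

End SecantAndZ.

(** * Counting parameters *)

Section AlgebraicDependence.
Variable K : fieldType.

(** If D > (a + 1)^M, then (a D + 1)^M <= (a + 1)^M D^M < D^(M + 1) <= D^N. *)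
Lemma pow_dominates N M a : (M < N)%N -> exists2 D, (0 < D)%N & ((a * D + 1) ^ M < D ^ N)%N.
Proof.
move=> MN; exists ((a + 1) ^ M + 1)%N; first by rewrite [X in (_ < X)%N]addn1.
set D := ((a + 1) ^ M + 1)%N; have D0 : (0 < D)%N by rewrite /D [X in (_ < X)%N]addn1.
apply: (@leq_ltn_trans ((a + 1) ^ M * D ^ M)).
  rewrite -expnMn; have [->|M0] := posnP M; first by rewrite !expn0.
  by rewrite leq_exp2r //; move: D0; nia.
apply: (@leq_trans (D * D ^ M)); first by rewrite ltn_pmul2r ?expn_gt0 ?D0 // /D [X in (_ < X)%N]addn1.
by rewrite -expnS leq_pexp2l.
Qed.

Lemma mdeg_msize_leq n (p : {mpoly K[n]}) s m :
  (msize p <= s.+1)%N -> m \in msupp p -> (mdeg m <= s)%N.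
Proof. by move=> ps /msize_mdeg_lt mp; rewrite -ltnS (leq_trans mp). Qed.

Lemma msizeM_idomain n (p q : {mpoly K[n]}) :
  (msize (p * q) <= (msize p + msize q).-1)%N.
Proof.
have [->|p0] := eqVneq p 0; first by rewrite mul0r msize0.
have [->|q0] := eqVneq q 0; first by rewrite mulr0 msize0.
by rewrite msizeM.
Qed.

(** The D^N monomials in the [R i] with exponents below D have degree at most N s D, hence lie in a
    space of dimension L^M, which is smaller by [pow_dominates]. A linear dependence among them is
    the relation. *)
Lemma algebraic_dependence N M (R : 'I_N -> {mpoly K[M]}) : (M < N)%N ->
  exists2 P : {mpoly K[N]}, P != 0 & P \mPo [tuple R i | i < N] = 0.
Proof.
move=> MN; pose s := \max_i msize (R i).
have [D D0 DN] := pow_dominates (N * s) MN.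
pose L := (N * s * D + 1)%N; pose A := {ffun 'I_N -> 'I_D}; pose B := {ffun 'I_M -> 'I_L}.
pose mA (f : A) : 'X_{1..N} := [multinom f i : nat | i < N].
pose mB (g : B) : 'X_{1..M} := [multinom g i : nat | i < M].
pose Rf (f : A) := 'X_[mA f] \mPo [tuple R i | i < N].
pose Mx := \matrix_(i < #|A|, j < #|B|) (Rf (enum_val i))@_(mB (enum_val j)).
have : kermx Mx != 0.
  rewrite kermx_eq0 /row_free neq_ltn; apply/orP; left.
  apply: leq_ltn_trans (rank_leq_col _) _.
  by rewrite !card_ffun !card_ord.
case/rowV0Pn => c /sub_kermxP cM c0.
pose P : {mpoly K[N]} := \sum_i c 0 i *: 'X_[mA (enum_val i)].
have mA_inj : injective mA.
  move=> f g /mnmP fg; apply/ffunP => i; apply/val_inj.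
  by have := fg i; rewrite !mnmE.
exists P.
  apply: contraNneq c0 => P0; apply/eqP/rowP => j; rewrite mxE.
  have := congr1 (mcoeff (mA (enum_val j))) P0; rewrite mcoeff0 raddf_sum (bigD1 j) //= mcoeffZ mcoeffX.
  rewrite eqxx mulr1 big1 ?addr0 // => i ij; rewrite mcoeffZ mcoeffX.
  by rewrite (inj_eq mA_inj) (inj_eq enum_val_inj) (negPf ij) mulr0.
rewrite raddf_sum /=; apply/mpolyP => m; rewrite mcoeff0 raddf_sum /=.
have [mL|mL] := boolP [forall i, m i < L]%N.
  have mb : m = mB [ffun i => Ordinal (forallP mL i)].
    by apply/mnmP => i; rewrite mnmE ffunE.
  have := congr1 (fun v : 'rV_#|B| => v 0 (enum_rank [ffun i => Ordinal (forallP mL i)])) cM.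
  rewrite !mxE => E; rewrite -[RHS]E; apply: eq_bigr => i _.
  by rewrite comp_mpolyZ mcoeffZ !mxE enum_rankK -mb.
apply: big1 => i _; rewrite comp_mpolyZ mcoeffZ; apply/eqP; rewrite mulf_eq0.
apply/orP; right; rewrite mcoeff_eq0; apply: contra mL => mR; apply/forallP => j.
rewrite /L addn1 ltnS; apply: (@leq_trans (mdeg m)).
  by rewrite mdegE (bigD1 j) //= leq_addr.
apply: mdeg_msize_leq mR; rewrite comp_mpolyX.
apply: (@leq_trans (\sum_(l < N) s * mA (enum_val i) l).+1).
  elim/big_ind2: _ => [|p a q b pa qb|l _]; first by rewrite msize1.
    by apply: leq_trans (msizeM_idomain _ _) _; lia.
  rewrite tnth_mktuple; elim: (mA _ l) => [|k IH]; first by rewrite msize1.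
  rewrite exprS; apply: leq_trans (msizeM_idomain _ _) _.
  have sl : (msize (R l) <= s)%N by apply: (@leq_bigmax_cond _ _ (fun i => msize (R i))).
  by rewrite mulnS; lia.
rewrite ltnS -mulnA -[N in (N * _)%N]card_ord -sum_nat_const; apply: leq_sum => l _.
by rewrite leq_mul2l mnmE ltnW ?orbT.
Qed.

End AlgebraicDependence.

Section LowestPart.
Variable K : closedFieldType.

Lemma meval_scale_dhomog n k (P : {mpoly K[n]}) c y : P \is k.-homog ->
  P.@[fun i => c * y i] = c ^+ k * P.@[y].
Proof.
move=> hP; rewrite !mevalE mulr_sumr; apply: eq_big_seq => a aP.
rewrite mulrCA; congr (_ * _); under eq_bigr do rewrite exprMn.
rewrite big_split /= prodrXr; congr (_ ^+ _ * _).
by rewrite -mdegE; apply: (dhomogP _ _ _ hP).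
Qed.

Lemma pihomog_partition n (P : {mpoly K[n]}) : P = \sum_(k < msize P) pihomog mdeg k P.
Proof. exact: pihomog_partitionE. Qed.

Lemma homogeneous_part_vanishes n (P : {mpoly K[n]}) y :
  (forall c, P.@[fun i => c * y i] = 0) -> forall k, (pihomog mdeg k P).@[y] = 0.
Proof.
move=> P0 k; have [kP|Pk] := ltnP k (msize P); last first.
  rewrite pihomogE big_seq_cond big1 ?meval0 // => m /andP[mP /eqP mk].
  by have := msize_mdeg_lt mP; rewrite /= in mk; rewrite mk ltnNge Pk.
have : \sum_(j < msize P) (pihomog mdeg j P).@[y] *: 'X^j = 0 :> {poly K}.
  apply: (@poly_eqfun _ _ _ [::]) => c _; rewrite horner0 -(P0 c) horner_sum.
  rewrite [in RHS](pihomog_partition P) raddf_sum /=; apply: eq_bigr => j _.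
  by rewrite hornerZ hornerXn (meval_scale_dhomog _ _ (pihomogP mdeg j P)) mulrC.
move/(congr1 (fun p : {poly K} => p`_k)); rewrite coef0 coef_sum.
rewrite (bigD1 (Ordinal kP)) //= coefZ coefXn eqxx mulr1 big1 ?addr0 // => j jk.
by rewrite coefZ coefXn eq_sym -val_eqE /= in jk *; rewrite (negPf jk) mulr0.
Qed.

(* A nonzero P cannot vanish on curves through one point with arbitrary tangent
   vectors there: its lowest homogeneous part at that point would vanish. *)
Lemma vanish_on_curves n (P : {mpoly K[n]}) (q : 'I_n -> K) :
  (forall v : 'I_n -> K, exists p : 'I_n -> {poly K},
    [/\ forall i, (p i)`_0 = q i, forall i, (p i)`_1 = v i &
        forall t, P.@[fun i => (p i).[t]] = 0]) -> P = 0.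
Proof.
move=> H; pose tr (c : 'I_n -> K) := [tuple 'X_i + (c i)%:MP | i < n] : n.-tuple {mpoly K[n]}.
have trE c Q y : (Q \mPo tr c).@[y] = Q.@[fun i => y i + c i].
  rewrite comp_mpoly_meval; apply: meval_eq => i.
  by rewrite tnth_mktuple mevalD mevalXU mevalC.
suff P0 : P \mPo tr q = 0.
  apply: meval_eq0 => y; have := trE q P (fun i => y i - q i).
  rewrite P0 meval0 => E; rewrite [RHS]E; apply: meval_eq => i; by rewrite subrK.
set Q := P \mPo tr q; suff Q0 k : pihomog mdeg k Q = 0.
  by rewrite [Q]pihomog_partition big1.
elim/ltn_ind: k => k IH; apply: meval_eq0 => v.
have [p [p0 p1 Pp]] := H v.
pose u i : {poly K} := \poly_(j < (size (p i)).-1) (p i)`_j.+1.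
have pu i : p i = (q i)%:P + 'X * u i.
  apply/polyP => -[|j]; rewrite coefD coefC coefXM /= ?addr0 // add0r coef_poly.
  by case: ltnP => // js; rewrite nth_default // (leq_trans (leqSpred _)).
pose ev (R : {mpoly K[n]}) : {poly K} := mmap (@polyC K) u R.
have evE R t : (ev R).[t] = R.@[fun i => (u i).[t]].
  rewrite /ev /mmap horner_sum mevalE; apply: eq_bigr => m _.
  rewrite hornerM hornerC /mmap1 horner_prod; congr (_ * _).
  by apply: eq_bigr => i _; rewrite horner_exp.
have uv i : (u i)`_0 = v i.
  rewrite -p1 coef_poly; case: ltnP => // ; rewrite leqn0 => /eqP s0.
  by rewrite nth_default // (leq_trans (leqSpred _)) // s0.
(* Along the curve q + t u(t), the polynomial P takes the value sum_j t^j Q_j(u(t)). Once the lower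
   parts are zero, the coefficient of t^k is Q_k(u(0)) = Q_k(v). *)
have E : \sum_(j < msize Q) 'X^j * ev (pihomog mdeg j Q) = 0.
  apply: (@poly_eqfun _ _ _ [::]) => t _; rewrite horner0.
  have -> : 0 = Q.@[fun i => t * (u i).[t]].
    rewrite trE -(Pp t); apply: meval_eq => i.
    by rewrite pu hornerD hornerC hornerM hornerX addrC.
  rewrite [in RHS](pihomog_partition Q) raddf_sum horner_sum /=; apply: eq_bigr => j _.
  by rewrite hornerM hornerXn evE (meval_scale_dhomog _ _ (pihomogP mdeg j Q)).
have [kQ|Qk] := ltnP k (msize Q); last first.
  rewrite pihomogE big_seq_cond big1 ?meval0 // => m /andP[mP /eqP mk].
  by have := msize_mdeg_lt mP; rewrite /= in mk; rewrite mk ltnNge Qk.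
move/(congr1 (fun p : {poly K} => p`_k)): E; rewrite coef0 coef_sum.
rewrite (bigD1 (Ordinal kQ)) //= coefXnM ltnn subnn big1 ?addr0 => [|j jk].
  rewrite -horner_coef0 evE => E; rewrite -[RHS]E; apply: meval_eq => i.
  by rewrite horner_coef0 uv.
rewrite coefXnM; case: ltnP => // jk'.
have jk1 : (j < k)%N by rewrite ltn_neqAle jk' andbT.
by rewrite IH // /ev mmap0 coef0.
Qed.

End LowestPart.

Section DimensionCount.
Variables (K : closedFieldType) (n d r : nat).
Notation V := 'rV[K]_n.+1.
Notation S := (SdV K n d).

(* The cone over the secant variety is parametrized by r vectors, so that more than
   r(n+1) linear forms satisfy a relation on it. *)
Lemma secant_relation N (Q : 'I_N -> dhomog n.+1 K d) : (0 < d)%N -> (r * n.+1 < N)%N ->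
  exists k (P : {mpoly K[N]}), [/\ P != 0, P \is k.-homog &
    forall (c : 'I_r -> K) (x : 'I_r -> V),
      P.@[fun i => (\sum_j c j *: evS d (x j)) (Q i)] = 0].
Proof.
move=> d0 MN; pose R i : {mpoly K[r * n.+1]} :=
  \sum_(l < r) (val (Q i) \mPo [tuple 'X_(mxvec_index l j) | j < n.+1]).
have [P P0 PR] := algebraic_dependence R MN.
have PS (c : 'I_r -> K) (x : 'I_r -> V) :
    P.@[fun i => (\sum_j c j *: evS d (x j)) (Q i)] = 0.
  (* A d-th root of the weight is absorbed into the vector, so that each point costs n + 1
     parameters and not n + 2. *)
  have /choice[b bE] j : exists b, b ^+ d = c j.
    have [b] := @solve_monicpoly K d (fun i => if i == 0%N then c j else 0) d0.
    move=> E; exists b; rewrite {}E (bigD1 (Ordinal d0)) //= expr0 mulr1 big1 ?addr0 //.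
    by move=> i; rewrite -val_eqE /= => /negPf ->; rewrite mul0r.
  pose z k := mxvec (\matrix_(l, j) (b l * x l 0 j)) 0 k.
  have := congr1 (meval z) PR; rewrite meval0 comp_mpoly_meval => E.
  rewrite -[RHS]E; apply: meval_eq => i; rewrite tnth_mktuple raddf_sum sum_lfunE /=.
  apply: eq_bigr => l _; rewrite scale_lfunE lfunE /= /eval_form -bE.
  rewrite -[_ *: _](meval_scale_dhomog _ _ (dhomog_is_dhomog (Q i))) comp_mpoly_meval.
  by apply: meval_eq => j; rewrite tnth_mktuple mevalXU /z mxvecE mxE.
(* The cone is stable under scaling, so each homogeneous part of a relation is again a relation. *)
have [k Pk] : exists k, pihomog mdeg k P != 0.
  apply: contrapT => /forallNP Pk; case/eqP: P0.
  rewrite [P]pihomog_partition big1 // => k _; apply/eqP/negPn/negP; exact: Pk.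
exists k, (pihomog mdeg k P); split=> // [|c x]; first exact: pihomogP.
apply: homogeneous_part_vanishes => a; rewrite -(PS (fun j => a * c j) x).
apply: meval_eq => i; rewrite !sum_lfunE mulr_sumr; apply: eq_bigr => l _.
by rewrite !scale_lfunE -scalerA.
Qed.

(** A relation from [secant_relation] that also held on the cactus cone would vanish along curves
    through [q] in every direction [v], so it would be zero by [vanish_on_curves]. *)
Lemma dimension_count (I : finType) (Q : I -> dhomog n.+1 K d) (q : I -> K) :
  (0 < d)%N -> (r * n.+1 < #|I|)%N ->
  (forall v : I -> K, exists (F : K -> S) (p : I -> {poly K}),
    [/\ forall t, cactus r (F t), forall t i, F t (Q i) = (p i).[t],
        forall i, (p i)`_0 = q i & forall i, (p i)`_1 = v i]) ->
  secant_variety r (range (@veronese K n d)) `<` Z_all K n d r.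
Proof.
move=> d0 rI H; have [k [P [P0 hP PS]]] := secant_relation (fun i => Q (enum_val i)) d0 rI.
have [F [cF PF]] : exists F : S, cactus r F /\ P.@[fun i => F (Q (enum_val i))] != 0.
  apply: contrapT => /forallNP noF; case/eqP: P0.
  apply: (vanish_on_curves (q := q \o enum_val)) => v.
  have [F [p [cF Fp pq pv]]] := H (v \o enum_rank).
  exists (p \o enum_val); split=> [i|i|t] /=; first exact: pq.
    by rewrite pv /= enum_valK.
  apply/eqP/negPn/negP => Pt; apply: (noF (F t)); split=> //.
  by move: Pt; congr (_ != _); apply: meval_eq => i; rewrite Fp.
apply: (secant_proper _ PS cF PF).
apply: (is_form_meval (y := fun i (w : S) => w (Q (enum_val i))) hP (e := 1)) => i.
apply: is_form_lin => c u v; by rewrite add_lfunE scale_lfunE.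
Qed.

End DimensionCount.

(** * Osculating functionals *)

Section Order.
Variables (K : fieldType) (m : nat).
Notation poly := {mpoly K[m]}.

Definition order_ge N (g : poly) : Prop := forall a, (mdeg a < N)%N -> g@_a = 0.

Lemma order_geM N M g h : order_ge N g -> order_ge M h -> order_ge (N + M) (g * h).
Proof.
move=> gN hM a aNM; rewrite mcoeffM big1 // => -[b c] /= /eqP abc.
have [bN|Nb] := ltnP (mdeg b) N; first by rewrite gN ?mul0r.
have E : mdeg a = (mdeg b + mdeg c)%N by rewrite {1}abc mdegD.
by rewrite (hM c) ?mulr0 //; rewrite -(ltn_add2l (mdeg b)) -E (leq_trans aNM) // leq_add2r.
Qed.

Lemma order_geX N g : g@_0%MM = 0 -> order_ge N (g ^+ N).
Proof.
move=> g0; elim: N => [a|N IH]; first by rewrite ltn0.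
rewrite exprS -add1n; apply: order_geM => // a.
by rewrite ltnS leqn0 mdeg_eq0 => /eqP ->.
Qed.

(** Weighted sums of coefficients stand for differential operators at the origin, of order below N,
    without factorials. *)
Definition coef_fun N (w : 'X_{1..m} -> K) (g : poly) : K^o :=
  \sum_(a : 'X_{1..m < N}) w a * g@_a.

Fact coef_fun_linear N w : linear (coef_fun N w).
Proof.
move=> c g h; rewrite /coef_fun scaler_sumr -big_split /=; apply: eq_bigr => a _.
by rewrite mcoeffD mcoeffZ mulrDr [c *: _]mulrCA.
Qed.

HB.instance Definition _ N w :=
  GRing.isLinear.Build K poly K^o _ (coef_fun N w) (coef_fun_linear N w).

Lemma coef_fun_order N w g : order_ge N g -> coef_fun N w g = 0.
Proof. by move=> gN; apply: big1 => a _; rewrite gN ?mulr0 ?bmdeg. Qed.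

Lemma coef_funX N w a : coef_fun N w 'X_[a] = if (mdeg a < N)%N then w a else 0.
Proof.
rewrite /coef_fun; case: ltnP => aN; last first.
  apply: big1 => b _; rewrite mcoeffX; case: eqP => [ab|_]; last by rewrite mulr0.
  by move: aN; rewrite ab leqNgt bmdeg.
rewrite (bigD1 (BMultinom aN)) //= mcoeffX eqxx mulr1 big1 ?addr0 // => b ba.
by rewrite mcoeffX eq_sym -[_ == _](bmeqP b (BMultinom aN)) (negPf ba) mulr0.
Qed.

End Order.

Section Osculating.
Variables (K : closedFieldType) (n m k : nat).
Notation V := 'rV[K]_n.+1.
Notation poly := {mpoly K[n.+1]}.
Notation low := 'X_{1..m < k.+1}.

(* For a functional of order 2k+1, the bilinear form (g, h) |-> f (g h) only involves
   products in which one factor has degree at most k. *)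
Lemma osculating_local w (s : n.+1.-tuple {mpoly K[m]}) (x : V) :
  x != 0 -> (forall i, (tnth s i)@_0%MM = x 0 i) ->
  local_functional x (#|{: low}| + #|{: low}|) (coef_fun k.*2.+2 w \o comp_mpoly s).
Proof.
move=> x0 sx; pose f : {linear {mpoly K[m]} -> K^o} := coef_fun k.*2.+2 w.
split=> //.
  exists k.*2.+2 => h g hx /=; rewrite rmorphM rmorphXn.
  apply: coef_fun_order; rewrite -{1}[k.*2.+2]addn0; apply: order_geM => //.
  apply: order_geX; rewrite -[RHS]hx.
  rewrite /= (comp_mpolyEX h) raddf_sum mevalE; apply: eq_bigr => a _ /=.
  rewrite mcoeffZ comp_mpolyX rmorph_prod; congr (_ * _); apply: eq_bigr => i _.
  by rewrite rmorphXn /= sx.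
pose lo (g : {mpoly K[m]}) := \sum_(a : low) g@_a *: 'X_[a].
have hi g : order_ge k.+1 (g - lo g).
  by move=> a ak; rewrite mcoeffB /lo (mcoeff_mpoly (fun b => g@_b)) // subrr.
pose c g := g \mPo s.
pose nu (i : 'I_#|{: low}|) : 'X_{1..m} := (enum_val i : low).
(* With hi g = g - lo g, one has g h = lo g h + hi g lo h + hi g hi h, and the last term has order
   2k + 2, so [f] kills it. The first half of the indices carries lo g h, the second half hi g lo
   h. *)
pose be (i : 'I_(#|{: low}| + #|{: low}|)) h := match fintype.split i with
  | inl a => f ('X_[nu a] * c h) | inr b => (c h)@_(nu b) end.
pose al (i : 'I_(#|{: low}| + #|{: low}|)) g := match fintype.split i with
  | inl a => (c g)@_(nu a) | inr b => f ((c g - lo (c g)) * 'X_[nu b]) end.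
exists al, be => g h /=; rewrite rmorphM -/(c g) -/(c h) -[coef_fun _ _ _]/(f _).
rewrite big_split_ord /= /al /be.
under eq_bigr do rewrite (unsplitK (inl _)).
under [X in _ = _ + X]eq_bigr do rewrite (unsplitK (inr _)).
have -> : c g * c h = lo (c g) * c h + (c g - lo (c g)) * lo (c h)
    + (c g - lo (c g)) * (c h - lo (c h)).
  by rewrite -addrA -mulrDr [lo (c h) + _]addrC subrK -mulrDl [lo _ + _]addrC subrK.
have f0 : f ((c g - lo (c g)) * (c h - lo (c h))) = 0.
  apply: coef_fun_order;
  by rewrite -addnn -addSn -addnS; apply: order_geM.
rewrite !linearD f0 addr0.
have loE g' : lo g' = \sum_(i < #|{: low}|) g'@_(nu i) *: 'X_[nu i].
  by rewrite /lo (reindex (@enum_val _ (mem {: low}))) //; apply/onW_bij/enum_val_bij.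
have fsum (F : 'I_#|{: low}| -> {mpoly K[m]}) : (f (\sum_i F i) : K) = \sum_i (f (F i) : K).
  exact: linear_sum.
have fZ (c' : K) g' : (f (c' *: g') : K) = c' * f g' by exact: linearZ.
congr (_ + _).
  by rewrite (loE (c g)) mulr_suml fsum; apply: eq_bigr => a _; rewrite -scalerAl fZ.
rewrite (loE (c h)) mulr_sumr fsum; apply: eq_bigr => a _.
by rewrite -scalerAr fZ mulrC.
Qed.

End Osculating.

Section CactusClosure.
Variables (K : closedFieldType) (n d : nat).
Notation V := 'rV[K]_n.+1.
Notation poly := {mpoly K[n.+1]}.
Notation S := (SdV K n d).
Implicit Types F : S.

Definition restrS (phi : {linear poly -> K^o}) : S := linfun (phi \o @mpoly_of_dhomog n.+1 K d).

Lemma restrSE phi (P : dhomog n.+1 K d) : restrS phi P = phi P.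
Proof. by rewrite lfunE. Qed.

Lemma cactus_local x l (phi : {linear poly -> K^o}) :
  local_functional x l phi -> cactus l (restrS phi).
Proof.
move=> xphi; exists 1%N, (fun=> x), (fun=> l), (fun=> phi).
by split=> [//||P]; rewrite big_ord1 ?restrSE.
Qed.

Lemma cactus0 : cactus 0 (0 : S).
Proof.
exists 0%N, (fun=> 0), (fun=> 0%N), (fun=> @coef_fun K n.+1 0 (fun=> 0)).
by split=> [[]||P] //; rewrite big_ord0 ?lfunE.
Qed.

Lemma cactusD r1 r2 F1 F2 : cactus r1 F1 -> cactus r2 F2 -> cactus (r1 + r2) (F1 + F2).
Proof.
case=> m1 [x1 [l1 [phi1 [phix1 lr1 FE1]]]] [m2 [x2 [l2 [phi2 [phix2 lr2 FE2]]]]].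
pose glue T (f : 'I_m1 -> T) (g : 'I_m2 -> T) i :=
  match fintype.split i with inl j => f j | inr j => g j end.
have gl T f g j : @glue T f g (lshift m2 j) = f j by rewrite /glue (unsplitK (inl _)).
have gr T f g j : @glue T f g (rshift m1 j) = g j by rewrite /glue (unsplitK (inr _)).
exists (m1 + m2)%N, (glue _ x1 x2), (glue _ l1 l2), (glue _ phi1 phi2); split=> [i||P].
- by rewrite /glue; case: fintype.splitP.
- rewrite big_split_ord /=; under eq_bigr do rewrite gl.
  by under [X in (_ + X)%N]eq_bigr do rewrite gr; apply: leq_add.
- rewrite add_lfunE FE1 FE2 big_split_ord /=; congr (_ + _).
    by apply: eq_bigr => j _; rewrite gl.
  by apply: eq_bigr => j _; rewrite gr.
Qed.

Lemma cactus_leq r1 r2 F : (r1 <= r2)%N -> cactus r1 F -> cactus r2 F.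
Proof.
move=> r12 [m [x [l [phi [phix lr FE]]]]]; exists m, x, l, phi; split=> //.
exact: leq_trans r12.
Qed.

Lemma cactus_evS (x : V) : x != 0 -> cactus 1 (evS d x).
Proof.
move=> x0; have -> : evS d x = restrS (meval (x 0) : {linear poly -> K^o}).
  by apply/lfunP => P; rewrite !lfunE.
exact/cactus_local/local_eval.
Qed.

Lemma cactus_sum_evS s (c : 'I_s -> K) (x : 'I_s -> V) : (forall i, x i != 0) ->
  cactus s (\sum_i c i *: evS d (x i)).
Proof.
elim: s c x => [|s IH] c x x0; first by rewrite big_ord0; apply: cactus0.
rewrite big_ord_recl; apply: (cactusD (r1 := 1)); first exact/cactusZ/cactus_evS.
exact: IH.
Qed.

End CactusClosure.

Section Homogenization.

Definition homogenize n k (a : 'X_{1..n}) : 'X_{1..n.+1} :=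
  [multinom if unlift ord0 i is Some j then a j else (k - mdeg a)%N | i < n.+1].

Lemma homogenize0 n k (a : 'X_{1..n}) : homogenize k a ord0 = (k - mdeg a)%N.
Proof. by rewrite mnmE unlift_none. Qed.

Lemma homogenizeS n k (a : 'X_{1..n}) j : homogenize k a (lift ord0 j) = a j.
Proof. by rewrite mnmE liftK. Qed.

Lemma mdeg_homogenize n k (a : 'X_{1..n}) : (mdeg a <= k)%N -> mdeg (homogenize k a) = k.
Proof.
move=> ak; rewrite mdegE big_ord_recl homogenize0.
by under eq_bigr do rewrite homogenizeS; rewrite -mdegE subnK.
Qed.

Lemma homogenize_inj n k : injective (@homogenize n k).
Proof.
by move=> a b ab; apply/mnmP => j; rewrite -(homogenizeS k) ab homogenizeS.
Qed.

(** Homogenizing is a bijection onto the monomials of degree k in n + 1 variables. *)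
Lemma card_low n k : #|{: 'X_{1..n < k.+1}}| = 'C(k + n, k).
Proof.
rewrite -size_basis cardE -(size_map (fun a : 'X_{1..n < k.+1} => homogenize k a)).
apply/perm_size/uniq_perm; last 1 first.
- move=> b; rewrite -basis_cover; apply/mapP/eqP => [[a _ ->]|bk].
    by rewrite mdeg_homogenize // -ltnS bmdeg.
  pose a : 'X_{1..n} := [multinom b (lift ord0 j) | j < n].
  have ba : (mdeg b = b ord0 + mdeg a)%N.
    rewrite !mdegE big_ord_recl; congr (_ + _)%N; by apply: eq_bigr => j _; rewrite mnmE.
  have ak : (mdeg a < k.+1)%N by rewrite ltnS -bk ba leq_addl.
  exists (BMultinom ak); first by rewrite mem_enum.
  apply/mnmP => i; case: (unliftP ord0 i) => [j|] ->.
    by rewrite homogenizeS mnmE.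
  by rewrite homogenize0 /= -(addnK (mdeg a) (b ord0)) -ba bk.
- rewrite map_inj_uniq ?enum_uniq // => a b /homogenize_inj ab; exact/val_inj.
- exact: uniq_basis.
Qed.

End Homogenization.

Section FirstOrder.
Variable K : fieldType.

Lemma coef0_expXM (c : K) e (q : {poly K}) :
  ((c *: 'X) ^+ e * q)`_0 = if e == 0%N then q`_0 else 0.
Proof.
case: e => [|e]; first by rewrite expr0 mul1r.
by rewrite exprZn -scalerAl coefZ coefXnM /= mulr0.
Qed.

Lemma coef1_expXM (c : K) e (q : {poly K}) :
  ((c *: 'X) ^+ e * q)`_1 =
  if e == 0%N then q`_1 else if e == 1%N then c * q`_0 else 0.
Proof.
case: e => [|[|e]]; first by rewrite expr0 mul1r.
  by rewrite expr1 -scalerAl coefZ coefXM.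
by rewrite exprZn -scalerAl coefZ coefXnM /= mulr0.
Qed.

End FirstOrder.

Section OsculatingCurve.
Variables (K : closedFieldType) (n' k : nat).
Notation n := n'.+2.
Notation V := 'rV[K]_n.+1.
Notation poly := {mpoly K[n.+1]}.

Variables (w0 w : 'X_{1..n} -> K) (c : K).

(** Taylor expansion in the chart x_0 = 1 at [base_point t], which moves with speed [c] along the
    first affine coordinate; in [osc t] the weights move as well, with velocity [w]. *)
Definition shift (t : K) : n.+1.-tuple {mpoly K[n]} :=
  [tuple if unlift ord0 i is Some j then (if j == ord0 then (c * t)%:MP else 0) + 'X_j
         else 1 | i < n.+1].

Definition base_point (t : K) : V :=
  \row_i if unlift ord0 i is Some j then (if j == ord0 then c * t else 0) else 1.

Definition osc (t : K) : {linear poly -> K^o} :=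
  coef_fun k.*2.+2 (fun a => w0 a + t * w a) \o comp_mpoly (shift t).

Lemma osc_local t : local_functional (base_point t)
  (#|{: 'X_{1..n < k.+1}}| + #|{: 'X_{1..n < k.+1}}|) (osc t).
Proof.
apply: osculating_local => [|i].
  apply/eqP => /rowP/(_ ord0)/eqP; rewrite !mxE unlift_none.
  by rewrite oner_eq0.
rewrite tnth_mktuple mxE; case: unlift => [j|]; last by rewrite mcoeff1 eqxx.
rewrite mcoeffD mcoeffX mnm1_eq0 addr0.
by case: ifP => _; rewrite ?mcoeff0 // mcoeffC eqxx mulr1.
Qed.

(** The exponents of the i-th term when the power of c t + x_1 coming from the monomial M is
    expanded. *)
Definition mtail (M : 'X_{1..n.+1}) (i : nat) : 'X_{1..n} :=
  [multinom if j == ord0 then i else M (lift ord0 j) | j < n].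

Lemma mdeg_mtail M i : (mdeg (mtail M i) = i + \sum_(j < n'.+1) M (lift ord0 (lift ord0 j)))%N.
Proof.
rewrite mdegE /mtail [LHS]big_ord_recl mnmE /=; congr (_ + _)%N.
by apply: eq_bigr => j _; rewrite mnmE.
Qed.

(* The values of osc t, as polynomials in t. *)
Definition oscX (M : 'X_{1..n.+1}) : {poly K} :=
  \sum_(i < (M (lift ord0 ord0)).+1)
    ((c *: 'X) ^+ (M (lift ord0 ord0) - i) *
     (if (mdeg (mtail M i) < k.*2.+2)%N then
        (w0 (mtail M i))%:P + w (mtail M i) *: 'X else 0)) *+ 'C(M (lift ord0 ord0), i).

Definition oscP (Q : poly) : {poly K} := \sum_(M <- msupp Q) Q@_M *: oscX M.

Lemma oscX_horner t M : osc t 'X_[M] = (oscX M).[t].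
Proof.
have E : 'X_[M] \mPo shift t = \sum_(i < (M (lift ord0 ord0)).+1)
    ((c * t) ^+ (M (lift ord0 ord0) - i) *: 'X_[mtail M i]) *+ 'C(M (lift ord0 ord0), i).
  rewrite comp_mpolyX big_ord_recl tnth_mktuple unlift_none expr1n mul1r.
  rewrite big_ord_recl tnth_mktuple liftK /= exprDn mulr_suml; apply: eq_bigr => i _.
  rewrite mulrnAl; congr (_ *+ _); rewrite -rmorphXn /= -mulrA mul_mpolyC; congr (_ *: _).
  rewrite [RHS]mpolyXE_id big_ord_recl /mtail mnmE eqxx; congr (_ * _).
  by apply: eq_bigr => j _; rewrite tnth_mktuple liftK mnmE /= add0r.
rewrite /osc /= E linear_sum /oscX horner_sum; apply: eq_bigr => i _.
rewrite hornerMn raddfMn /= linearZ /= coef_funX; congr (_ *+ _).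
rewrite hornerM horner_exp hornerZ hornerX; case: ifP => _; last by rewrite horner0 [_ *: _]mulr0 mulr0.
by rewrite hornerD hornerC hornerZ hornerX [t * _]mulrC.
Qed.

Lemma oscP_horner t Q : osc t Q = (oscP Q).[t].
Proof.
rewrite [in LHS](mpolyE Q) linear_sum /oscP horner_sum; apply: eq_bigr => M _.
by rewrite hornerZ -oscX_horner; apply: linearZ.
Qed.

Lemma oscP_X M : oscP 'X_[M] = oscX M.
Proof. by rewrite /oscP msuppX big_seq1 mcoeffX eqxx scale1r. Qed.

(** All monomials have affine degree at least 2k + 3, and the functional sees degrees up to 2k + 1
    only; the difference has to come from at least two factors c t. *)
Lemma oscP_high (Q : poly) d e : (k.*2.+3 + e <= d)%N -> Q \is d.-homog ->
  (forall M, M \in msupp Q -> M ord0 <= e)%N -> (oscP Q)`_0 = 0 /\ (oscP Q)`_1 = 0.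
Proof.
move=> ed hQ Qe.
have term M i : M \in msupp Q -> (i <= M (lift ord0 ord0))%N ->
    (mdeg (mtail M i) < k.*2.+2)%N -> (1 < M (lift ord0 ord0) - i)%N.
  move=> MQ iM; rewrite mdeg_mtail; have := dhomogP _ _ _ hQ _ MQ.
  have := Qe _ MQ; rewrite /= mdegE big_ord_recl [X in (_ + X)%N]big_ord_recl.
  by move: (\sum_(j < n'.+1) _)%N => S; lia.
split; rewrite coef_sum big_seq big1 // => M MQ; rewrite coefZ coef_sum big1 ?mulr0 // => i _;
  rewrite coefMn; have iM : (i <= M (lift ord0 ord0))%N by rewrite -ltnS.
  rewrite coef0_expXM; case: ltnP => [lt|_]; last by rewrite coef0 if_same mul0rn.
  by have := term M i MQ iM lt; case: (_ - _)%N => // a _; rewrite mul0rn.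
rewrite coef1_expXM; case: ltnP => [lt|_]; last by rewrite !coef0 mulr0 !if_same mul0rn.
by have := term M i MQ iM lt; case: (_ - _)%N => [|[|a]] // _; rewrite mul0rn.
Qed.

Let trunc (f : 'X_{1..n} -> K) (a : 'X_{1..n}) := if (mdeg a < k.*2.+2)%N then f a else 0.

Lemma oscX_coef0 M : (oscX M)`_0 = trunc w0 (mtail M (M (lift ord0 ord0))).
Proof.
rewrite coef_sum big_ord_recr /= coefMn coef0_expXM subnn binn big1 ?add0r => [|i _].
  rewrite /trunc; case: ifP => _; last by rewrite coef0.
  by rewrite coefD coefC coefZ coefX mulr0 addr0.
rewrite coefMn coef0_expXM; case: eqP => [/eqP|_]; last by rewrite mul0rn.
by rewrite subn_eq0 leqNgt ltn_ord.
Qed.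

(** The first term is due to the motion of the weights, the second to that of the base point. *)
Lemma oscX_coef1 M : (oscX M)`_1 = trunc w (mtail M (M (lift ord0 ord0))) +
  c * trunc w0 (mtail M (M (lift ord0 ord0)).-1) *+ M (lift ord0 ord0).
Proof.
rewrite coef_sum big_ord_recr /= coefMn coef1_expXM subnn binn addrC; congr (_ + _).
  rewrite /trunc; case: ifP => _; last by rewrite coef0.
  by rewrite coefD coefC coefZ coefX mulr1 add0r.
case: (M _) => [|m]; first by rewrite big_ord0.
rewrite big_ord_recr /= coefMn coef1_expXM subSnn /= binSn big1 ?add0r => [|i _].
  rewrite /trunc; case: ifP => _; last by rewrite coef0 mulr0.
  by rewrite coefD coefC coefZ coefX mulr0 addr0.
rewrite coefMn coef1_expXM subSn; last exact/ltnW/ltn_ord.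
by rewrite eqSS subn_eq0 [(m <= i)%N]leqNgt ltn_ord /= mul0rn.
Qed.

End OsculatingCurve.

Lemma dhomog_bigprod (K : idomainType) n (I : Type) (s : seq I) (Q : pred I)
    (f : I -> {mpoly K[n]}) (e : I -> nat) :
  (forall i, Q i -> f i \is (e i).-homog) ->
  \prod_(i <- s | Q i) f i \is (\sum_(i <- s | Q i) e i).-homog.
Proof.
move=> h; elim/big_rec2: _ => [|i m p Qi hp]; first exact: dhomog1.
exact/dhomogM/hp/h.
Qed.

Section Degree0.
Variables (K : idomainType) (n : nat).
Implicit Types Q : {mpoly K[n.+1]}.

Definition deg0_le e Q := all (fun M : 'X_{1..n.+1} => M ord0 <= e)%N (msupp Q).

Lemma deg0_leM e1 e2 P Q : deg0_le e1 P -> deg0_le e2 Q -> deg0_le (e1 + e2) (P * Q).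
Proof.
move=> /allP hP /allP hQ; apply/allP => M /msuppM_le/allpairsP[[M1 M2] /= [/hP h1 /hQ h2 ->]].
by rewrite mnmDE leq_add.
Qed.

Lemma deg0_leX e Q m : deg0_le e Q -> deg0_le (m * e) (Q ^+ m).
Proof.
move=> hQ; elim: m => [|m IH]; first by rewrite /deg0_le msupp1 /= mnm0E.
by rewrite exprS mulSn deg0_leM.
Qed.

Lemma deg0_leXU i : deg0_le (i == ord0) 'X_i.
Proof. by rewrite /deg0_le msuppX /= mnm1E; case: eqP. Qed.

Lemma deg0_leB e P Q c : deg0_le e P -> deg0_le e Q -> deg0_le e (P - c *: Q).
Proof.
move=> /allP hP /allP hQ; apply/allP => M /msuppB_le; rewrite mem_cat => /orP[/hP //|].
by move/msuppZ_le/hQ.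
Qed.

Lemma deg0_le_prod (I : Type) (s : seq I) (q : pred I) f :
  (forall i, q i -> deg0_le 0 (f i)) -> deg0_le 0 (\prod_(i <- s | q i) f i).
Proof.
move=> h; elim/big_ind: _ => [|P Q hP hQ|i qi]; first by rewrite /deg0_le msupp1 /= mnm0E.
  by rewrite -[0%N]addn0 deg0_leM.
exact: h.
Qed.

Lemma deg0_leW e e' Q : (e <= e')%N -> deg0_le e Q -> deg0_le e' Q.
Proof. by move=> ee' /allP h; apply/allP => M /h /leq_trans; apply. Qed.

End Degree0.

(** * Weighted points moving away from a line at infinity *)

Section MovingPoints.
Variables (K : closedFieldType) (n' s d : nat) (tau : 'I_s -> K).
Hypothesis tau_inj : injective tau.
Hypothesis sd : (s.*2 <= d)%N.
Notation n := n'.+2.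
Notation V := 'rV[K]_n.+1.
Notation poly := {mpoly K[n.+1]}.
Let i1 : 'I_n.+1 := lift ord0 ord0.
Let i2 : 'I_n.+1 := lift ord0 (lift ord0 ord0).

Definition hker (i : 'I_s) : poly := \prod_(j | j != i) ('X_i2 - tau j *: 'X_i1).

(** To first order these see only the i-th point (0, 1, tau i, 0, ...), because the square of
    [hker i] vanishes doubly at the others. The last factor is a local coordinate at that point or,
    for l = i1, a function without zero there, which sees the weight. The degree is 2 (s - 1) + (d -
    2 s + 1) + 1 = d. *)
Definition Qpt (i : 'I_s) (l : 'I_n.+1) : poly :=
  hker i ^+ 2 * 'X_i1 ^+ (d - s.*2.-1) * (if l == i2 then 'X_i2 - tau i *: 'X_i1 else 'X_l).

Lemma Qpt_homog i l : Qpt i l \is d.-homog.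
Proof.
have s0 : (0 < s)%N by case: s i => [[]|].
have X1 j : ('X_j : poly) \is 1.-homog by rewrite dhomogX /= mdeg1.
have lin t : ('X_i2 - t *: 'X_i1 : poly) \is 1.-homog by rewrite rpredB // dhomogZ.
have hk : hker i \is (s.-1).-homog.
  have := @dhomog_bigprod _ _ _ (index_enum 'I_s) (fun j => j != i) _ (fun=> 1%N) (fun j _ => lin (tau j)).
  by rewrite sum1_card cardC1 card_ord.
have -> : d = (s.-1 * 2 + 1 * (d - s.*2.-1) + 1)%N by move: sd s0; rewrite -!muln2; lia.
apply: dhomogM; last by case: ifP.
by apply: dhomogM; apply: dhomogMn.
Qed.

Lemma Qpt_deg0 i l : deg0_le 1 (Qpt i l).
Proof.
have lin t : deg0_le 0 ('X_i2 - t *: 'X_i1 : poly) by apply: deg0_leB; apply: deg0_leXU.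
rewrite /Qpt -[1%N]add0n; apply: deg0_leM.
  rewrite -[0%N]addn0; apply: deg0_leM.
    by apply: (deg0_leX (e := 0)); apply: deg0_le_prod => j _.
  by rewrite -[0%N](muln0 (d - s.*2.-1)%N); apply/deg0_leX/deg0_leXU.
case: ifP => _; first exact: deg0_leW (lin _).
by apply: deg0_leW (deg0_leXU _ l); case: eqP.
Qed.

Variable v : 'I_s -> 'I_n.+1 -> K.

Let h0 i := \prod_(j | j != i) (tau i - tau j).

Lemma h0_neq0 i : h0 i != 0.
Proof.
apply/prodf_neq0 => j ji; rewrite subr_eq0; apply: contraNneq ji => /tau_inj ->.
by [].
Qed.

(** The coordinate x_1 stays 1, and its velocity [v i i1] goes into the weight [wt i]. The value
    [h0 i ^+ 2] of [hker i ^+ 2] at the starting point normalizes the velocities. *)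
Definition chi (i : 'I_s) (l : 'I_n.+1) : {poly K} :=
  if l == i1 then 1 else (if l == i2 then (tau i)%:P else 0) + (v i l / h0 i ^+ 2) *: 'X.

Definition ptX (i : 'I_s) (Q : poly) : {poly K} := mmap (@polyC K) (chi i) Q.

HB.instance Definition _ i := GRing.RMorphism.copy (ptX i) (mmap (@polyC K) (chi i)).

Lemma ptXM i P Q : ptX i (P * Q) = ptX i P * ptX i Q.
Proof. exact: rmorphM. Qed.

Lemma ptXXn i P e : ptX i (P ^+ e) = ptX i P ^+ e.
Proof. exact: rmorphXn. Qed.

Definition pt (i : 'I_s) (t : K) : V := \row_l (chi i l).[t].

Lemma ptX_horner i t Q : (ptX i Q).[t] = Q.@[pt i t 0].
Proof.
rewrite /ptX /mmap horner_sum mevalE; apply: eq_bigr => M _.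
rewrite hornerM hornerC /mmap1 horner_prod; congr (_ * _).
by apply: eq_bigr => l _; rewrite horner_exp mxE.
Qed.

Lemma pt_neq0 i t : pt i t != 0.
Proof.
apply/eqP => /rowP/(_ i1)/eqP; rewrite !mxE /chi eqxx hornerC.
by rewrite oner_eq0.
Qed.

Let hh i := ptX i (hker i).

(* The weight of the i-th point makes up for the first-order change of hker i. *)
Definition kap i := (v i i1 - (hh i ^+ 2)`_1) / h0 i ^+ 2.

Definition wt i : {poly K} := 1 + kap i *: 'X.

Lemma ptXU i l : ptX i 'X_l = chi i l.
Proof. by rewrite /ptX mmapX mmap1U. Qed.

Lemma ptX_lin i j : ptX i ('X_i2 - tau j *: 'X_i1) =
  (tau i - tau j)%:P + (v i i2 / h0 i ^+ 2) *: 'X.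
Proof.
rewrite rmorphB /= [ptX i (_ *: _)]mmapZ -/(ptX i _) !ptXU /chi /= mulr1 polyCB.
by rewrite addrAC.
Qed.

Lemma ptX_Qpt i l : ptX i (Qpt i l) = hh i ^+ 2 *
  (if l == i1 then 1 else (v i l / h0 i ^+ 2) *: 'X).
Proof.
rewrite /Qpt !ptXM !ptXXn ptXU {1}/chi eqxx.
rewrite expr1n mulr1; congr (_ * _); case: (eqVneq l i2) => [->|li2].
  by rewrite ptX_lin subrr add0r.
by rewrite ptXU /chi (negPf li2) add0r.
Qed.

(** A factor of [hker j] vanishes at the starting position of the i-th point, and it enters
    squared. *)
Lemma ptX_Qpt_neq i j l : i != j -> exists q, ptX i (Qpt j l) = 'X^2 * q.
Proof.
move=> ij; have -> : ptX i (Qpt j l) = ptX i (hker j) ^+ 2 *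
    ptX i ('X_i1 ^+ (d - s.*2.-1) * (if l == i2 then 'X_i2 - tau j *: 'X_i1 else 'X_l)).
  by rewrite /Qpt -mulrA ptXM ptXXn.
have -> : ptX i (hker j) = ptX i ('X_i2 - tau i *: 'X_i1) *
    ptX i (\prod_(m | (m != j) && (m != i)) ('X_i2 - tau m *: 'X_i1)).
  by rewrite -ptXM /hker (bigD1 i).
rewrite ptX_lin subrr add0r exprMn exprZn -!mulrA -scalerAl -mul_polyC mulrCA.
by eexists.
Qed.

Lemma hh0 i : (hh i)`_0 = h0 i.
Proof.
rewrite /hh /hker rmorph_prod /= -horner_coef0 horner_prod; apply: eq_bigr => j _.
by rewrite ptX_lin hornerD hornerC hornerZ hornerX mulr0 addr0.
Qed.

Lemma wt_Qpt_coef0 i l : (wt i * ptX i (Qpt i l))`_0 = if l == i1 then h0 i ^+ 2 else 0.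
Proof.
rewrite -horner_coef0 hornerM ptX_Qpt hornerM horner_exp !horner_coef0 hh0.
rewrite coefD coef1 coefZ coefX mulr0 addr0 mul1r.
by case: ifP => _; rewrite ?coef1 ?coefZ ?coefX ?mulr1 // mulr0 mulr0.
Qed.

Lemma wt_Qpt_coef1 i l : (wt i * ptX i (Qpt i l))`_1 = v i l.
Proof.
have h20 : (hh i ^+ 2)`_0 = h0 i ^+ 2 by rewrite -!horner_coef0 horner_exp horner_coef0 hh0.
have hn : h0 i ^+ 2 != 0 by rewrite expf_neq0 // h0_neq0.
rewrite ptX_Qpt /wt mulrDl mul1r; case: (eqVneq l i1) => [->|_].
  rewrite mulr1 coefD -scalerAl coefZ coefXM /= h20 /kap mulfVK //.
  by rewrite addrC subrK.
rewrite -scalerAr -scalerAl -scalerAr coefD !coefZ coefMX coefXM coefMX /= h20.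
by rewrite !mulr0 addr0 divfK.
Qed.

End MovingPoints.

Section OsculatingExcess.
Variables (K : closedFieldType) (n' k s r d : nat).
Notation n := n'.+2.
Notation V := 'rV[K]_n.+1.
Notation poly := {mpoly K[n.+1]}.
Notation I := (option 'X_{1..n < k.*2.+2} + 'I_s * 'I_n.+1)%type.
Hypothesis kd : (k.*2 + 4 <= d)%N.
Hypothesis sd : (s.*2 <= d)%N.

Let i1 : 'I_n.+1 := lift ord0 ord0.
(** At t = 0 the osculating functional reads the single coefficient at [a1], of top degree 2k + 1.
    Moving the support along the first affine variable then shows at [astar], whose degree 2k + 2 is
    beyond the reach of the weights; this direction is therefore independent of theirs. *)
Let a1 : 'X_{1..n} := (U_(lift ord0 ord0) *+ k.*2.+1)%MM.
Let astar : 'X_{1..n} := (U_(ord0) + a1)%MM.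
Let w0 (a : 'X_{1..n}) : K := (a == a1)%:R.

Variable tau : 'I_s -> K.
Hypothesis tau_inj : injective tau.

(* Coordinates separating the tangent directions at F_0 of the family Ffam v below: those
   moving w, one moving the base point, and those moving the s points and their weights. *)
Definition Qfam (x : I) : poly :=
  match x with
  | inl (Some a) => 'X_[homogenize d a]
  | inl None => 'X_[homogenize d astar]
  | inr (i, l) => Qpt d tau i l
  end.

Lemma mdeg_a1 : mdeg a1 = k.*2.+1.
Proof. by rewrite mdegMn mdeg1 mul1n. Qed.

Lemma mdeg_astar : mdeg astar = k.*2.+2.
Proof. by rewrite mdegD mdeg1 mdeg_a1. Qed.

Lemma Qfam_homog x : Qfam x \is d.-homog.
Proof.
case: x => [[a|]|[i l]]; last exact: Qpt_homog.
  rewrite dhomogX /= mdeg_homogenize //; have := bmdeg a; move: kd.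
  by move: (mdeg a) => u; lia.
by rewrite dhomogX /= mdeg_homogenize // mdeg_astar; move: kd; lia.
Qed.

Lemma mtail_homogenize (a : 'X_{1..n}) i : mtail (homogenize d a) i =
  [multinom if j == ord0 then i else a j | j < n].
Proof. by apply/mnmP => j; rewrite !mnmE; case: ifP => // _; rewrite liftK. Qed.

Lemma mtail_homogenize_id (a : 'X_{1..n}) : mtail (homogenize d a) (a ord0) = a.
Proof. by rewrite mtail_homogenize; apply/mnmP => j; rewrite mnmE; case: eqP => [->|]. Qed.

Section Curve.
Variable v : I -> K.

Let w (a : 'X_{1..n}) : K :=
  if insub a is Some b then v (inl (Some b)) else 0.
Let c := v (inl None).
Let vp i l := v (inr (i, l)).

Definition Pfam (x : I) : {poly K} :=
  oscP k w0 w c (Qfam x) + \sum_i wt tau vp i * ptX tau vp i (Qfam x).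

(* A curve in the cone over the cactus variety, with velocity v at t = 0. *)
Definition Ffam (t : K) : SdV K n d :=
  restrS d (osc k w0 w c t) + \sum_i (wt tau vp i).[t] *: evS d (pt tau vp i t).

Lemma cactus_Ffam t : cactus ('C(k + n, k) + 'C(k + n, k) + s) (Ffam t).
Proof.
apply: cactusD; last by apply: cactus_sum_evS => i; apply: pt_neq0.
by rewrite -card_low; apply/cactus_local/osc_local.
Qed.

Lemma Ffam_horner t x : Ffam t (DHomog (Qfam_homog x)) = (Pfam x).[t].
Proof.
rewrite add_lfunE restrSE sum_lfunE hornerD [X in _ = _ + X]horner_sum; congr (_ + _).
  exact: oscP_horner.
apply: eq_bigr => i _; rewrite scale_lfunE lfunE /= /eval_form /= hornerM ptX_horner.
by [].
Qed.

(** The points start on the hyperplane x_0 = 0, so x_0^2 is divisible by t^2 along their paths. With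
    [oscP_Qpt], this separates the two kinds of coordinates to first order. *)
Lemma wt_ptX_monomial i (M : 'X_{1..n.+1}) : (1 < M ord0)%N ->
  (wt tau vp i * ptX tau vp i 'X_[M])`_0 = 0 /\ (wt tau vp i * ptX tau vp i 'X_[M])`_1 = 0.
Proof.
move=> M0; rewrite /ptX mmapX /mmap1 big_ord_recl {1 3}/chi /= add0r mulrCA.
rewrite coef0_expXM coef1_expXM.
by case: (M ord0) M0 => [|[|m]].
Qed.

Lemma Pfam_mon x (a : 'X_{1..n}) : (mdeg a <= k.*2.+2)%N -> Qfam x = 'X_[homogenize d a] ->
  (Pfam x)`_0 = (oscX k w0 w c (homogenize d a))`_0 /\
  (Pfam x)`_1 = (oscX k w0 w c (homogenize d a))`_1.
Proof.
move=> ak xE; rewrite /Pfam xE oscP_X !coefD !coef_sum.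
have M0 : (1 < homogenize d a ord0)%N by rewrite homogenize0; move: kd; lia.
by split; rewrite [X in _ + X]big1 ?addr0 // => i _; case: (wt_ptX_monomial i M0).
Qed.

Lemma homogenize1 (a : 'X_{1..n}) : homogenize d a (lift ord0 ord0) = a ord0.
Proof. exact: homogenizeS. Qed.

Lemma oscP_Qpt i l :
  (oscP k w0 w c (Qpt d tau i l))`_0 = 0 /\ (oscP k w0 w c (Qpt d tau i l))`_1 = 0.
Proof.
apply: (@oscP_high _ _ _ _ _ _ _ d 1); [by move: kd; lia|exact: Qpt_homog|].
by move=> M MQ; apply: (allP (Qpt_deg0 d tau i l)) MQ.
Qed.

Lemma wt_ptX_neq i j l : j != i ->
  (wt tau vp j * ptX tau vp j (Qpt d tau i l))`_0 = 0 /\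
  (wt tau vp j * ptX tau vp j (Qpt d tau i l))`_1 = 0.
Proof. by move=> ji; have [q ->] := ptX_Qpt_neq d tau vp l ji; rewrite mulrCA !coefXnM. Qed.

Lemma Pfam_coef0 x : (Pfam x)`_0 = match x with
  | inl (Some a) => w0 a | inl None => 0
  | inr (i, l) => if l == i1 then (\prod_(j | j != i) (tau i - tau j)) ^+ 2 else 0 end.
Proof.
case: x => [[a|]|[i l]].
- have ak : (mdeg a <= k.*2.+2)%N by rewrite ltnW ?bmdeg.
  have [-> _] := Pfam_mon (x := inl (Some a)) ak erefl.
  by rewrite oscX_coef0 homogenize1 mtail_homogenize_id bmdeg.
- have ak : (mdeg astar <= k.*2.+2)%N by rewrite mdeg_astar.
  have [-> _] := Pfam_mon (x := inl None) ak erefl.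
  by rewrite oscX_coef0 homogenize1 mtail_homogenize_id mdeg_astar ltnn.
rewrite /Pfam coefD [X in _ + X]coef_sum (proj1 (oscP_Qpt i l)) add0r (bigD1 i) //= wt_Qpt_coef0 //.
by rewrite [X in _ + X]big1 ?addr0 // => j /(wt_ptX_neq l)[].
Qed.

Lemma Pfam_coef1 x : (Pfam x)`_1 = v x.
Proof.
case: x => [[a|]|[i l]].
- have ak : (mdeg a <= k.*2.+2)%N by rewrite ltnW ?bmdeg.
  have [_ ->] := Pfam_mon (x := inl (Some a)) ak erefl.
  rewrite oscX_coef1 homogenize1 mtail_homogenize_id bmdeg /w valK.
  (* [T] is the initial weight at [a] with its first exponent lowered; the degree is then at most
     2k, so this is not [a1]. *)
  set T := (if _ then _ else _); suff T0 : T *+ a ord0 = 0 by rewrite -mulrnAr T0 mulr0 addr0.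
  rewrite /T; case: (posnP (a ord0)) => [->|a0]; first by rewrite mulr0n.
  case: ifP => _; last by rewrite mul0rn.
  rewrite /w0; case: eqP => [E|_]; last by rewrite mul0rn.
  have := mdeg_mtail (homogenize d a) (a ord0); rewrite mtail_homogenize_id.
  have := mdeg_mtail (homogenize d a) (a ord0).-1; rewrite E mdeg_a1.
  have := bmdeg a; move: a0 (\sum_(j < n'.+1) _)%N.
  by move: (mdeg a) (a ord0) => u1 u2 u3 u4; lia.
- have ak : (mdeg astar <= k.*2.+2)%N by rewrite mdeg_astar.
  have [_ ->] := Pfam_mon (x := inl None) ak erefl.
  rewrite oscX_coef1 homogenize1 mtail_homogenize_id mdeg_astar ltnn add0r.
  have -> : astar ord0 = 1%N by rewrite mnmDE mnm1E mulmnE mnm1E.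
  rewrite mulr1n mtail_homogenize.
  have -> : [multinom if j == ord0 then 1.-1 else astar j | j < n] = a1.
    apply/mnmP => j; rewrite mnmE; case: eqP => [->|/eqP j0]; first by rewrite mulmnE mnm1E.
    by rewrite mnmDE mnm1E eq_sym (negPf j0).
  by rewrite mdeg_a1 ltnSn /w0 eqxx mulr1.
rewrite /Pfam coefD [X in _ + X]coef_sum (proj2 (oscP_Qpt i l)) add0r (bigD1 i) //= wt_Qpt_coef1 //.
by rewrite [X in _ + X]big1 ?addr0 // => j /(wt_ptX_neq l)[].
Qed.

End Curve.

(** The independent directions are the weights of the osculating functional, one motion of its
    support, and n + 1 for each of the s points, including its weight. *)
Lemma osculating_excess :
  ('C(k + n, k) + 'C(k + n, k) + s <= r)%N ->
  (r * n.+1 < 'C(k.*2.+1 + n, k.*2.+1) + 1 + s * n.+1)%N ->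
  secant_variety r (range (@veronese K n d)) `<` Z_all K n d r.
Proof.
move=> lr rI; apply: (dimension_count (I := I) (Q := fun x => DHomog (Qfam_homog x))
  (q := fun x => match x with inl (Some a) => w0 a | inl None => 0
    | inr (i, l) => if l == i1 then (\prod_(j | j != i) (tau i - tau j)) ^+ 2 else 0 end)).
- by move: kd; lia.
- by rewrite card_sum card_option card_prod !card_ord card_low; move: rI; rewrite addn1.
move=> v; exists (Ffam v), (Pfam v); split=> [t|t x|x|x].
- exact: cactus_leq lr (cactus_Ffam _ _).
- exact: Ffam_horner.
- exact: Pfam_coef0.
- exact: Pfam_coef1.
Qed.

End OsculatingExcess.

(** * Products of catalecticant kernels *)

Section Tangency.
Variables (K : fieldType) (m : nat).
Notation poly := {mpoly K[m]}.
Implicit Types (x y : 'I_m -> K) (P Q : poly).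

Definition lineP x y P : {poly K} := mmap (@polyC K) (fun l => (x l)%:P + y l *: 'X) P.

HB.instance Definition _ x y := GRing.RMorphism.copy (lineP x y)
  (mmap (@polyC K) (fun l => (x l)%:P + y l *: 'X)).

Lemma linePM x y P Q : lineP x y (P * Q) = lineP x y P * lineP x y Q.
Proof. exact: rmorphM. Qed.

Lemma linePZ x y c P : lineP x y (c *: P) = c *: lineP x y P.
Proof. by rewrite -mul_polyC; apply: mmapZ. Qed.

Lemma linePXU x y l : lineP x y 'X_l = (x l)%:P + y l *: 'X.
Proof. by rewrite /lineP mmapX mmap1U. Qed.

Lemma lineP_sum x y (I : Type) (s : seq I) (F : I -> poly) :
  lineP x y (\sum_(i <- s) F i) = \sum_(i <- s) lineP x y (F i).
Proof. exact: rmorph_sum. Qed.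

Lemma lineP0 x y P : (lineP x y P)`_0 = P.@[x].
Proof.
rewrite -horner_coef0 /lineP /mmap horner_sum mevalE; apply: eq_bigr => M _.
rewrite hornerM hornerC /mmap1 horner_prod; congr (_ * _); apply: eq_bigr => l _.
by rewrite horner_exp hornerD hornerC hornerZ hornerX mulr0 addr0.
Qed.

Definition doubly_vanishes r (x : 'I_r -> 'I_m -> K) P : Prop :=
  forall i y, (lineP (x i) y P)`_0 = 0 /\ (lineP (x i) y P)`_1 = 0.

Lemma doubly_vanishesM r (x : 'I_r -> 'I_m -> K) P Q :
  (forall i, P.@[x i] = 0) -> (forall i, Q.@[x i] = 0) -> doubly_vanishes x (P * Q).
Proof.
move=> Px Qx i y; rewrite linePM coef0M coefM big_ord_recl big_ord1 /=.
by rewrite !lineP0 Px Qx !mul0r mulr0 addr0.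
Qed.

Lemma doubly_vanishes_lin r (x : 'I_r -> 'I_m -> K) (I : Type) (s : seq I) (c : I -> K) F :
  (forall i, doubly_vanishes x (F i)) -> doubly_vanishes x (\sum_(i <- s) c i *: F i).
Proof.
move=> hF i y; rewrite lineP_sum !coef_sum.
by split; apply: big1 => j _; rewrite linePZ coefZ; case: (hF j i y) => h0 h1; rewrite ?h0 ?h1 mulr0.
Qed.

Variables (r d : nat) (x : 'I_r -> 'I_m -> K).
Hypothesis rd : (r.*2.-1 <= d)%N.
Hypothesis xdist : forall i j, i != j -> exists p q, x j p * x i q != x j q * x i p.
Hypothesis xn0 : forall i, exists q, x i q != 0.

(** A product of squares of linear forms that vanish at the other points, padded by a coordinate
    that is nonzero at x_i. It has to have degree at least 2 (r - 1), hence [rd]. *)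
Lemma separating_form i : exists G : poly, [/\ G \is d.-1.-homog, G.@[x i] != 0 &
  forall j y, j != i -> (lineP (x j) y G)`_0 = 0 /\ (lineP (x j) y G)`_1 = 0].
Proof.
have r0 : (0 < r)%N by case: r i => [[]|].
have X1 (j : 'I_m) : ('X_j : poly) \is 1.-homog by rewrite dhomogX /= mdeg1.
have /choice[l lP] (j : 'I_r) : exists l : poly, j != i ->
    [/\ l \is 1.-homog, l.@[x j] = 0 & l.@[x i] != 0].
  have [->|ij] := eqVneq i j; first by exists 0 => /eqP.
  have [p [q pq]] := xdist ij; exists (x j p *: 'X_q - x j q *: 'X_p) => _; split.
  - by rewrite rpredB // dhomogZ.
  - by rewrite mevalB !mevalZ !mevalXU mulrC subrr.
  - by rewrite mevalB !mevalZ !mevalXU subr_eq0.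
have [q xq] := xn0 i.
exists ((\prod_(j | j != i) l j) ^+ 2 * 'X_q ^+ (d - r.*2.-1)); split.
- have -> : d.-1 = (r.-1 * 2 + 1 * (d - r.*2.-1))%N by move: rd r0; rewrite -!muln2; lia.
  apply: dhomogM; last exact: dhomogMn.
  apply: dhomogMn; have := @dhomog_bigprod _ _ _ (index_enum 'I_r) (fun j => j != i) l
    (fun=> 1%N) (fun j ji => let: And3 h _ _ := lP j ji in h).
  by rewrite sum1_card cardC1 card_ord.
- rewrite mevalM !rmorphXn rmorph_prod /= mevalXU mulf_neq0 ?expf_neq0 //.
  by apply/prodf_neq0 => j ji; case: (lP j ji).
move=> j y ji; rewrite (bigD1 j) //= exprMn [l j ^+ 2]expr2 -!mulrA !linePM.
have [_ lj _] := lP j ji.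
have [u ->] : exists u, lineP (x j) y (l j) = 'X * u.
  have /factor_theorem[u ->] : root (lineP (x j) y (l j)) 0.
    by rewrite /root horner_coef0 lineP0 lj.
  by exists u; rewrite subr0 mulrC.
have E (Z : {poly K}) : 'X * u * ('X * u * Z) = 'X^2 * (u * (u * Z)).
  by rewrite mulrACA ['X * ('X * u)]mulrA -expr2 -!mulrA.
by rewrite E !coefXnM.
Qed.

(** To first order at x_i only [G i] counts, and it is nonzero there, so the linear form sum_l c_il
    x_l has value 0 and derivative 0. Thus the r m forms G_i x_l are independent modulo the doubly
    vanishing ones. *)
Lemma doubly_vanishes_free (G : 'I_r -> poly) (c : 'I_r -> 'I_m -> K) :
  (forall i, (G i).@[x i] != 0) ->
  (forall i j y, j != i -> (lineP (x j) y (G i))`_0 = 0 /\ (lineP (x j) y (G i))`_1 = 0) ->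
  doubly_vanishes x (\sum_i \sum_l c i l *: (G i * 'X_l)) -> forall i l, c i l = 0.
Proof.
move=> Gi Gj D i l.
have E y : lineP (x i) y (\sum_i \sum_l c i l *: (G i * 'X_l)) =
    \sum_j lineP (x i) y (G j) * \sum_l ((c j l * x i l)%:P + (c j l * y l) *: 'X).
  rewrite lineP_sum; apply: eq_bigr => j _; rewrite lineP_sum mulr_sumr.
  apply: eq_bigr => l' _; rewrite linePZ linePM linePXU scalerAr scalerDr scalerA.
  by rewrite -mul_polyC -polyCM.
have [g gE] : exists g, g = \sum_l c i l * x i l by eexists.
have low y e : (e < 2)%N -> (lineP (x i) y (\sum_i \sum_l c i l *: (G i * 'X_l)))`_e =
    (lineP (x i) y (G i) * (g%:P + (\sum_l c i l * y l) *: 'X))`_e.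
  move=> e2; rewrite E coef_sum (bigD1 i) //= [X in _ + X]big1 ?addr0 => [|j ji].
    by rewrite big_split /= -scaler_suml gE raddf_sum.
  have ij : i != j by rewrite eq_sym.
  have [z0 z1] := Gj j i y ij.
  by case: e e2 => [|[|//]] _; rewrite coefM !big_ord_recl big_ord0 /= ?z0 ?z1 !mul0r ?addr0.
have g0 : g = 0.
  have [+ _] := D i (fun=> 0); rewrite low // coef0M lineP0 coefD coefC coefZ coefX mulr0 addr0.
  by move/eqP; rewrite mulf_eq0 (negPf (Gi i)) => /eqP.
have [_] := D i (fun l' => (l' == l)%:R); rewrite low // g0 add0r coefM.
rewrite !big_ord_recl big_ord0 /= !coefZ !coefX lineP0 !mulr1 !mulr0 !addr0.
rewrite (bigD1 l) //= eqxx mulr1 big1 ?addr0 => [/eqP|l' /negPf ->]; last exact: mulr0.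
by rewrite mulf_eq0 (negPf (Gi i)) => /eqP.
Qed.

End Tangency.

Lemma is_form_adj (K : fieldType) (W : vectType K) r (M : 'I_r -> 'I_r -> W -> K) i j :
  (forall i j, is_form 1 (M i j)) ->
  is_form r.-1 (fun w => (\adj (\matrix_(i, j) M i j w)) i j).
Proof.
move=> fM; have h := is_form_det (fun i' j' => fM (lift j i') (lift i j')).
rewrite muln1 in h; apply: is_form_ext (is_formMl ((-1) ^+ (j + i)) h) => w.
rewrite mxE /cofactor; congr (_ * \det _).
by apply/matrixP => i' j'; rewrite !mxE.
Qed.

(** * A polynomial condition on sums of r weighted points *)

Section Criterion.
Variables (K : closedFieldType) (m : nat) (W : vectType K).
Notation poly := {mpoly K[m]}.
Variable L : W -> poly -> K.
Hypothesis LP : forall F c P Q, L F (c *: P + Q) = c * L F P + L F Q.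
Hypothesis LF : forall P, is_form 1 (L ^~ P).
Variables (r da db : nat) (p q : 'I_r -> poly).
Hypothesis pa : forall i, p i \is da.-homog.
Hypothesis qb : forall i, q i \is db.-homog.
Hypothesis da0 : (0 < da)%N.
Hypothesis rab : (r.*2.-1 <= da + db)%N.

Let M F := \matrix_(i, j) L F (p i * q j).
Let delta F := \det (M F).

Lemma L_lin F (I : Type) (s : seq I) (c : I -> K) (P : I -> poly) Q :
  L F ((\sum_(i <- s) c i *: P i) * Q) = \sum_(i <- s) c i * L F (P i * Q).
Proof.
have L0 : L F 0 = 0.
  by apply: (addIr (L F 0)); rewrite add0r -{1}[L F 0]mul1r -LP scaler0 add0r.
elim: s => [|i s IH]; first by rewrite !big_nil mul0r.
by rewrite !big_cons mulrDl -scalerAl LP IH.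
Qed.

(* Cramer's rule makes A orthogonal to q_1, ..., q_r, and B to p_1, ..., p_r, with
   coefficients that are forms in F. *)
Definition adjl F (A : poly) : poly := delta F *: A -
  \sum_i (\sum_j L F (A * q j) * (\adj (M F)) j i) *: p i.
Definition adjr F (B : poly) : poly := delta F *: B -
  \sum_j (\sum_i L F (p i * B) * (\adj (M F)) j i) *: q j.

Lemma LB F P Q : L F (P - Q) = L F P - L F Q.
Proof. by rewrite addrC -scaleN1r LP mulN1r addrC. Qed.

Lemma LZ F c P Q : L F ((c *: P) * Q) = c * L F (P * Q).
Proof. by have := L_lin F [:: tt] (fun=> c) (fun=> P) Q; rewrite !big_seq1. Qed.

Lemma adjl_orth F A l : L F (adjl F A * q l) = 0.
Proof.
rewrite /adjl mulrBl LB LZ L_lin; apply/eqP; rewrite subr_eq0; apply/eqP.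
under eq_bigr do rewrite mulr_suml; rewrite exchange_big /=.
have E j : \sum_i L F (A * q j) * (\adj (M F)) j i * L F (p i * q l) =
    L F (A * q j) * (delta F *+ (j == l)).
  have /matrixP/(_ j l) := mul_adj_mx (M F); rewrite !mxE => <-.
  rewrite mulr_sumr; apply: eq_bigr => i _; by rewrite !mxE -mulrA.
rewrite (eq_bigr _ (fun j _ => E j)).
rewrite (bigD1 l) //= eqxx mulr1n big1 ?addr0 => [|j /negPf ->]; first exact: mulrC.
by rewrite mulr0n mulr0.
Qed.

Lemma adjr_orth F B l : L F (p l * adjr F B) = 0.
Proof.
rewrite mulrC /adjr mulrBl LB LZ L_lin; apply/eqP; rewrite subr_eq0; apply/eqP.
under eq_bigr do rewrite mulr_suml; rewrite exchange_big /=.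
have E i : \sum_j L F (p i * B) * (\adj (M F)) j i * L F (q j * p l) =
    L F (p i * B) * (delta F *+ (l == i)).
  have /matrixP/(_ l i) := mul_mx_adj (M F); rewrite !mxE => <-.
  rewrite mulr_sumr; apply: eq_bigr => j _; rewrite !mxE [q j * _]mulrC -mulrA.
  by congr (_ * _); apply: mulrC.
rewrite (eq_bigr _ (fun j _ => E j)).
rewrite (bigD1 l) //= eqxx mulr1n big1 ?addr0 => [|j jl]; first by rewrite mulrC [B * _]mulrC.
by rewrite eq_sym (negPf jl) mulr0n mulr0.
Qed.

Lemma is_form_delta : is_form r delta.
Proof. by rewrite -[r]muln1; apply: is_form_det => i j; apply: LF. Qed.

Lemma is_form_adjl A mon : is_form r (fun F => (adjl F A)@_mon).
Proof.
have E F : delta F * A@_mon - \sum_i (\sum_j L F (A * q j) * (\adj (M F)) j i) * (p i)@_mon =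
    (adjl F A)@_mon.
  rewrite mcoeffB mcoeffZ; congr (_ - _); rewrite raddf_sum; apply: eq_bigr => i _ /=.
  by rewrite mcoeffZ.
apply: is_form_ext E _; apply: is_formB.
  by apply: is_form_ext (is_formMl A@_mon is_form_delta) => F; rewrite mulrC.
apply: is_form_sum => i _.
have h : is_form r (fun F => \sum_j L F (A * q j) * (\adj (M F)) j i).
  apply: is_form_sum => j _.
  have := is_formM (LF _) (is_form_adj j i (fun i j => LF (p i * q j))).
  by rewrite add1n prednK //; case: r i => [[]|].
by apply: is_form_ext (is_formMl (p i)@_mon h) => F; rewrite mulrC.
Qed.

Lemma is_form_adjr B mon : is_form r (fun F => (adjr F B)@_mon).
Proof.
have E F : delta F * B@_mon - \sum_j (\sum_i L F (p i * B) * (\adj (M F)) j i) * (q j)@_mon =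
    (adjr F B)@_mon.
  rewrite mcoeffB mcoeffZ; congr (_ - _); rewrite raddf_sum; apply: eq_bigr => i _ /=.
  by rewrite mcoeffZ.
apply: is_form_ext E _; apply: is_formB.
  by apply: is_form_ext (is_formMl B@_mon is_form_delta) => F; rewrite mulrC.
apply: is_form_sum => j _.
have h : is_form r (fun F => \sum_i L F (p i * B) * (\adj (M F)) j i).
  apply: is_form_sum => i _.
  have := is_formM (LF _) (is_form_adj j i (fun i j => LF (p i * q j))).
  by rewrite add1n prednK //; case: r i => [[]|].
by apply: is_form_ext (is_formMl (q j)@_mon h) => F; rewrite mulrC.
Qed.

Lemma is_form_adjM A B mon : is_form (r + r) (fun F => (adjl F A * adjr F B)@_mon).
Proof.
apply: (is_form_ext (G := fun F => \sum_(k : 'X_{1..m < (mdeg mon).+1, (mdeg mon).+1} |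
   mon == (k.1 + k.2)%MM) (adjl F A)@_k.1 * (adjr F B)@_k.2)).
  by move=> F; rewrite mcoeffM.
apply: is_form_sum => k _; apply: is_formM; [exact: is_form_adjl | exact: is_form_adjr].
Qed.

Lemma adjl_homog F A : A \is da.-homog -> adjl F A \is da.-homog.
Proof.
move=> hA; rewrite rpredB ?dhomogZ //; apply: rpred_sum => i _; exact: dhomogZ.
Qed.

Lemma adjr_homog F B : B \is db.-homog -> adjr F B \is db.-homog.
Proof.
move=> hB; rewrite rpredB ?dhomogZ //; apply: rpred_sum => i _; exact: dhomogZ.
Qed.

Definition is_secant F (c : 'I_r -> K) (x : 'I_r -> 'I_m -> K) :=
  forall P, P \is (da + db).-homog -> L F P = \sum_i c i * P.@[x i].

Section Secant.
Variables (F : W) (c : 'I_r -> K) (x : 'I_r -> 'I_m -> K).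
Hypothesis Fx : is_secant F c x.
Hypothesis dF : delta F != 0.

Let Pm := \matrix_(k, i) (p k).@[x i].
Let Qm := \matrix_(i, l) (q l).@[x i].
Let Dm := diag_mx (\row_i c i).

Lemma M_secant : M F = Pm *m Dm *m Qm.
Proof.
apply/matrixP => k l; rewrite !mxE Fx; last exact: dhomogM.
apply: eq_bigr => i _; rewrite mevalM !mxE (bigD1 i) //= big1 => [|j /negPf ji].
  by rewrite addr0 !mxE eqxx mulr1n; ring.
by rewrite !mxE ji mulr0n mulr0.
Qed.

(** [M F] factors through the values at the r points, and all three factors are square. *)
Lemma secant_units : [/\ Pm \in unitmx, Qm \in unitmx & Dm \in unitmx].
Proof.
move: dF; rewrite /delta M_secant !det_mulmx !mulf_eq0 !negb_or -!unitfE -!unitmxE.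
by case/andP => /andP[].
Qed.

Lemma secant_weights i : c i != 0.
Proof.
have [_ _] := secant_units; rewrite unitmxE unitfE det_diag => /prodf_neq0/(_ i isT).
by rewrite mxE.
Qed.

(** The weighted values of A at the points form a row annihilated by the invertible [Qm]. *)
Lemma secant_vanish_l A : A \is da.-homog -> (forall l, L F (A * q l) = 0) ->
  forall i, A.@[x i] = 0.
Proof.
move=> hA AQ i; have [_ uQ _] := secant_units.
pose u := \row_i (c i * A.@[x i]).
have uQ0 : u *m Qm = 0.
  apply/rowP => l; rewrite !mxE -[RHS](AQ l) Fx; last exact: dhomogM.
  by apply: eq_bigr => j _; rewrite !mxE mevalM mulrA.
have u0 : u = 0 by rewrite -[u](mulmxK uQ) uQ0 mul0mx.
move/rowP/(_ i)/eqP: u0; rewrite !mxE mulf_eq0 (negPf (secant_weights i)).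
by move/eqP.
Qed.

Lemma secant_vanish_r B : B \is db.-homog -> (forall l, L F (p l * B) = 0) ->
  forall i, B.@[x i] = 0.
Proof.
move=> hB PB i; have [uP _ _] := secant_units.
pose u := \col_i (c i * B.@[x i]).
have uP0 : Pm *m u = 0.
  apply/colP => l; rewrite !mxE -[RHS](PB l) Fx; last exact: dhomogM.
  by apply: eq_bigr => j _; rewrite !mxE mevalM; ring.
have u0 : u = 0 by rewrite -[u](mulKmx uP) uP0 mulmx0.
move/colP/(_ i)/eqP: u0; rewrite !mxE mulf_eq0 (negPf (secant_weights i)).
by move/eqP.
Qed.

Lemma secant_products A B : A \is da.-homog -> B \is db.-homog ->
  doubly_vanishes x (adjl F A * adjr F B).
Proof.
move=> hA hB; apply: doubly_vanishesM.
  by apply: secant_vanish_l => [|l]; [exact: adjl_homog | exact: adjl_orth].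
by apply: secant_vanish_r => [|l]; [exact: adjr_homog | exact: adjr_orth].
Qed.

(** A zero point would give a zero column of the invertible [Pm], as [da] is positive; in the next
    lemma, proportional points would give proportional columns. *)
Lemma secant_points_neq0 i : exists l, x i l != 0.
Proof.
apply: contrapT => /forallNP x0; have [uP _ _] := secant_units.
have /(congr1 (mulmx (invmx Pm))) : Pm *m delta_mx i (ord0 : 'I_1) = 0.
  apply/colP => k; rewrite -colE !mxE; have -> : (p k).@[x i] = (p k).@[fun l => 0 * x i l].
    by apply: meval_eq => l; rewrite mul0r; apply/eqP/negPn/negP; apply: x0.
  by rewrite (meval_scale_dhomog _ _ (pa k)) expr0n gtn_eqF // mul0r.
rewrite mulKmx // mulmx0 => /colP/(_ i)/eqP; rewrite !mxE !eqxx.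
by rewrite oner_eq0.
Qed.

Lemma secant_points_distinct i j : i != j -> exists k l, x j k * x i l != x j l * x i k.
Proof.
move=> ij; apply: contrapT => /forallNP xx; have [uP _ _] := secant_units.
have [l0 xl0] := secant_points_neq0 i; pose mu := x j l0 / x i l0.
have xj l : x j l = mu * x i l.
  have /forallNP/(_ l0) := xx l; move/negP/negPn/eqP => E.
  by rewrite /mu mulrAC -E mulfK.
have /(congr1 (mulmx (invmx Pm))) : Pm *m (delta_mx j (ord0 : 'I_1) - mu ^+ da *: delta_mx i 0) = 0.
  rewrite mulmxBr -scalemxAr -!colE; apply/colP => k; rewrite !mxE.
  by rewrite -(meval_scale_dhomog _ _ (pa k)) (meval_eq _ (xj)) subrr.
rewrite mulKmx // mulmx0 => /colP/(_ j)/eqP; rewrite !mxE !eqxx [j == i]eq_sym (negPf ij).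
by rewrite mulr0 subr0 oner_eq0.
Qed.

End Secant.

Notation low k := 'X_{1..m < k.+1}.
Notation T := {t : low (da + db) | mdeg t == (da + db)%N}.
Let N := #|{: T}|.
Let mon (i : 'I_N) : 'X_{1..m} := val (val (enum_val i : T)).

Lemma mdeg_mon i : mdeg (mon i) = (da + db)%N.
Proof. by rewrite /mon; apply/eqP; case: (enum_val i). Qed.

Lemma mon_surj (M0 : 'X_{1..m}) : mdeg M0 = (da + db)%N -> exists i, mon i = M0.
Proof.
move=> Md; have M1 : (mdeg M0 < (da + db).+1)%N by rewrite Md.
have M2 : mdeg (BMultinom M1) == (da + db)%N by rewrite /= Md.
by exists (enum_rank (Sub (BMultinom M1) M2 : T)); rewrite /mon enum_rankK.
Qed.

Lemma mon_inj : injective mon.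
Proof. by move=> i j /val_inj/val_inj/enum_val_inj. Qed.

Let toP (u : 'rV[K]_N) : poly := \sum_i u 0 i *: 'X_[mon i].
Let coefs (P : poly) : 'rV[K]_N := \row_i P@_(mon i).

Lemma toPK P : P \is (da + db).-homog -> toP (coefs P) = P.
Proof.
move=> hP; apply/mpolyP => M0; rewrite raddf_sum /=.
have [Md|Md] := eqVneq (mdeg M0) (da + db)%N.
  have [i <-] := mon_surj Md; rewrite (bigD1 i) //= mcoeffZ mcoeffX eqxx mulr1 mxE.
  rewrite big1 ?addr0 // => j ji; rewrite mcoeffZ mcoeffX (inj_eq mon_inj).
  by rewrite (negPf ji) mulr0.
rewrite big1 ?(dhomog_nemf_coeff hP) // => i _; rewrite mcoeffZ mcoeffX.
by case: eqP => [E|_]; [rewrite -E mdeg_mon eqxx in Md | rewrite mulr0].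
Qed.

Lemma toP_mul k (u : 'rV[K]_k) (X : 'M[K]_(k, N)) :
  toP (u *m X) = \sum_j u 0 j *: toP (row j X).
Proof.
rewrite /toP; under [RHS]eq_bigr do rewrite scaler_sumr.
rewrite exchange_big; apply: eq_bigr => i _; rewrite mxE scaler_suml.
by apply: eq_bigr => j _; rewrite scalerA mxE.
Qed.

(** The span of the doubly vanishing rows meets the r m-dimensional span of the forms G_i x_l in
    0. *)
Lemma doubly_vanishing_rank k (X : 'M[K]_(k, N)) (x : 'I_r -> 'I_m -> K) :
  (forall i j, i != j -> exists k l, x j k * x i l != x j l * x i k) ->
  (forall i, exists l, x i l != 0) ->
  (forall j, doubly_vanishes x (toP (row j X))) -> (\rank X + r * m <= N)%N.
Proof.
move=> xd xn0 DX; have /choice[G GP] i := separating_form rab xd xn0 i.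
have hG i l : G i * 'X_l \is (da + db).-homog.
  have [h _ _] := GP i; rewrite -(prednK (n := da + db)) ?addn_gt0 ?da0 // -addn1.
  by apply: dhomogM h _; rewrite dhomogX /= mdeg1.
pose ij (j : 'I_(r * m)) : 'I_r * 'I_m := enum_val (cast_ord (esym (mxvec_cast r m)) j).
have ij_bij : bijective ij.
  by apply: bij_comp; [exact: enum_val_bij | exact: Bijective (cast_ordK _) (cast_ordKV _)].
pose Y : 'M[K]_(r * m, N) := \matrix_j coefs (G (ij j).1 * 'X_(ij j).2).
have Yfree u : doubly_vanishes x (toP (u *m Y)) -> u = 0.
  have [g gK Kg] := ij_bij.
  have -> : toP (u *m Y) = \sum_i \sum_l u 0 (g (i, l)) *: (G i * 'X_l).
    rewrite toP_mul pair_big (reindex ij) /=; last exact: onW_bij.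
    by apply: eq_bigr => j _; rewrite rowK toPK // -surjective_pairing gK.
  move=> /doubly_vanishes_free H; apply/rowP => j; rewrite mxE -[j]gK [ij j]surjective_pairing.
  apply: H => [i|i j' y]; first by have [_] := GP i.
  by have [_ _ h] := GP i; apply: h.
have Yrank : \rank Y = (r * m)%N.
  apply/eqP; rewrite -[_ == _]/(row_free Y) -kermx_eq0; apply/rowV0P => u /sub_kermxP uY.
  apply: Yfree; rewrite uY => i y; rewrite /toP big1 => [|j _]; last by rewrite mxE scale0r.
  by rewrite /lineP mmap0 !coef0.
have cap : (X :&: Y = 0)%MS.
  apply/eqP; rewrite -submx0; apply/rV_subP => u; rewrite sub_capmx => /andP[].
  move=> /submxP[v1 ->] /submxP[v2 E]; rewrite E (Yfree v2) ?mul0mx ?sub0mx //.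
  by rewrite -E toP_mul; apply: doubly_vanishes_lin.
by rewrite -Yrank -(mxrank_disjoint_sum cap) rank_leq_col.
Qed.

Variables (F0 : W) (Bs : seq 'X_{1..m}).
Hypothesis pq0 : forall i j, L F0 (p i * q j) = (i == j)%:R.
Hypothesis Bsize : (size Bs < r * m)%N.
(** In dual form: the products of elements of the left and right kernels of F0 span all forms of
    degree da + db together with the monomials of [Bs], hence have codimension less than r m. *)
Hypothesis span : forall lam : poly -> K,
  (forall c P Q, lam (c *: P + Q) = c * lam P + lam Q) ->
  (forall A B, A \is da.-homog -> B \is db.-homog ->
    (forall B', B' \is db.-homog -> L F0 (A * B') = 0) ->
    (forall A', A' \is da.-homog -> L F0 (A' * B) = 0) -> lam (A * B) = 0) ->
  (forall M0, M0 \in Bs -> lam 'X_[M0] = 0) ->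
  forall M0 : 'X_{1..m}, mdeg M0 = (da + db)%N -> lam 'X_[M0] = 0.

Let mA (u : low da) : poly := if mdeg u == da then 'X_[u] else 0.
Let mB (u : low db) : poly := if mdeg u == db then 'X_[u] else 0.

Lemma mA_homog u : mA u \is da.-homog.
Proof. by rewrite /mA; case: ifP => h; [rewrite dhomogX | exact: dhomog0]. Qed.

Lemma mB_homog u : mB u \is db.-homog.
Proof. by rewrite /mB; case: ifP => h; [rewrite dhomogX | exact: dhomog0]. Qed.

Let prods F (u : low da * low db) := adjl F (mA u.1) * adjr F (mB u.2).
Let Xp F : 'M[K]_(#|{: low da * low db}|, N) :=
  \matrix_j coefs (prods F (enum_val j)).
(** The factor [delta F ^+ 2] gives the entries the degree 2 r of those of [Xp], and is 1 at F0. *)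
Let Xb F : 'M[K]_(size Bs, N) :=
  \matrix_(i, j) (delta F ^+ 2 * (nth 0%MM Bs i == mon j)%:R).
Let X F := col_mx (Xp F) (Xb F).

Lemma is_form_X i j : is_form (r + r) (fun F => X F i j).
Proof.
rewrite /X -[i]splitK; case: (fintype.split i) => l /=.
  apply: (is_form_ext (G := fun F => (prods F (enum_val l))@_(mon j))).
    by move=> F; rewrite col_mxEu !mxE.
  exact: is_form_adjM.
apply: (is_form_ext (G := fun F => (nth 0%MM Bs l == mon j)%:R * (delta F * delta F))).
  by move=> F; rewrite col_mxEd !mxE mulrC.
by apply: is_formMl; apply: is_formM; apply: is_form_delta.
Qed.

Lemma secant_rank F c x : is_secant F c x -> delta F != 0 -> (\rank (X F) < N)%N.
Proof.
move=> Fx dF; have : (\rank (Xp F) + r * m <= N)%N.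
  apply: (doubly_vanishing_rank (x := x)).
  - exact: (secant_points_distinct Fx dF).
  - exact: (secant_points_neq0 Fx dF).
  move=> j; rewrite rowK toPK.
    by apply: (secant_products Fx dF); [exact: mA_homog | exact: mB_homog].
  by apply: dhomogM; [apply/adjl_homog/mA_homog | apply/adjr_homog/mB_homog].
have rX : (\rank (X F) <= \rank (Xp F) + size Bs)%N.
  rewrite /X -addsmxE; apply: leq_trans (mxrank_adds_leqif _ _) _.
  by rewrite leq_add2l rank_leq_row.
by move=> h; apply: leq_ltn_trans rX _; apply: leq_trans h; rewrite ltn_add2l.
Qed.

Lemma delta0 : delta F0 = 1.
Proof.
rewrite /delta; have -> : M F0 = 1%:M by apply/matrixP => i j; rewrite !mxE pq0.
exact: det1.
Qed.

Lemma lin_ext_msupp (f : poly -> K) (A : poly) :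
  (forall c P Q, f (c *: P + Q) = c * f P + f Q) ->
  (forall M0, M0 \in msupp A -> f 'X_[M0] = 0) -> f A = 0.
Proof.
move=> fL fA; have f0 : f 0 = 0.
  by apply: (addIr (f 0)); rewrite add0r -{1}[f 0]mul1r -fL scaler0 add0r.
rewrite [A]mpolyE; elim: (msupp A) fA => [|M0 s IH] fA; first by rewrite big_nil.
rewrite big_cons fL fA ?mem_head // mulr0 add0r; apply: IH => M1 M1s.
by apply: fA; rewrite inE M1s orbT.
Qed.

Lemma adjl_lin F c P Q : adjl F (c *: P + Q) = c *: adjl F P + adjl F Q.
Proof.
rewrite /adjl scalerBr scalerDr !scalerA [delta F * c]mulrC addrACA; congr (_ + _).
rewrite -opprD scaler_sumr -big_split; congr (- _); apply: eq_bigr => i _ /=.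
rewrite scalerA -scalerDl; congr (_ *: _); rewrite mulr_sumr -big_split.
by apply: eq_bigr => j _ /=; rewrite mulrDl -scalerAl LP mulrDl mulrA.
Qed.

Lemma adjr_lin F c P Q : adjr F (c *: P + Q) = c *: adjr F P + adjr F Q.
Proof.
rewrite /adjr scalerBr scalerDr !scalerA [delta F * c]mulrC addrACA; congr (_ + _).
rewrite -opprD scaler_sumr -big_split; congr (- _); apply: eq_bigr => i _ /=.
rewrite scalerA -scalerDl; congr (_ *: _); rewrite mulr_sumr -big_split.
by apply: eq_bigr => j _ /=; rewrite mulrDr -scalerAr LP mulrDl mulrA.
Qed.

Lemma full_rank0 : row_full (X F0).
Proof.
rewrite /row_full -mxrank_tr -[_ == _]/(row_free _) -kermx_eq0.
apply/rowV0P => u /sub_kermxP uX; pose lam (P : poly) := \sum_i u 0 i * P@_(mon i).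
have lamL c P Q : lam (c *: P + Q) = c * lam P + lam Q.
  rewrite /lam mulr_sumr -big_split; apply: eq_bigr => i _ /=.
  by rewrite mcoeffD mcoeffZ mulrDr mulrCA.
have lamX j : \sum_i u 0 i * X F0 j i = 0.
  have := congr1 (fun v : 'rV_(_ + _) => v 0 j) uX; rewrite mxE [RHS]mxE => E.
  by rewrite -[RHS]E; apply: eq_bigr => i _; rewrite [in RHS]mxE.
have lam_mon A0 B0 : mdeg A0 = da -> mdeg B0 = db ->
    lam (adjl F0 'X_[A0] * adjr F0 'X_[B0]) = 0.
  move=> dA dB; have A1 : (mdeg A0 < da.+1)%N by rewrite dA.
  have B1 : (mdeg B0 < db.+1)%N by rewrite dB.
  have := lamX (lshift _ (enum_rank (BMultinom A1, BMultinom B1))).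
  move=> E; rewrite -[RHS]E; apply: eq_bigr => i _; rewrite col_mxEu !mxE enum_rankK.
  by rewrite /prods /mA /mB /= dA dB !eqxx.
have lam_prod A B : A \is da.-homog -> B \is db.-homog -> lam (adjl F0 A * adjr F0 B) = 0.
  move=> hA hB; apply: (lin_ext_msupp (f := fun P => lam (adjl F0 P * adjr F0 B))).
    by move=> c P Q; rewrite adjl_lin mulrDl -scalerAl lamL.
  move=> A0 /(dhomogP _ _ _ hA) dA.
  apply: (lin_ext_msupp (f := fun P => lam (adjl F0 'X_[A0] * adjr F0 P))).
    by move=> c P Q; rewrite adjr_lin mulrDr -scalerAr lamL.
  by move=> B0 /(dhomogP _ _ _ hB) dB; apply: lam_mon.
have lam0 := span lamL _ _; apply/rowP => i; rewrite mxE.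
have -> : u 0 i = lam 'X_[mon i].
  rewrite /lam (bigD1 i) //= mcoeffX eqxx mulr1 big1 ?addr0 // => j ji.
  by rewrite mcoeffX (inj_eq mon_inj) eq_sym (negPf ji) mulr0.
apply: lam0 (mdeg_mon i) => [A B hA hB Aq pB|M0 M0B].
  (* For A and B in the kernels the corrections vanish, and [delta F0] is 1, so [adjl] and [adjr]
     fix them. *)
  have := lam_prod A B hA hB; rewrite /adjl /adjr delta0 !scale1r big1 => [|j _]; last first.
    by rewrite big1 ?scale0r // => l _; rewrite Aq // mul0r.
  rewrite subr0 big1 ?subr0 // => j _.
  by rewrite big1 ?scale0r // => l _; rewrite pB // mul0r.
have sB : (index M0 Bs < size Bs)%N by rewrite index_mem.
have := lamX (rshift _ (Ordinal sB)) => E; rewrite -[RHS]E; apply: eq_bigr => i' _.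
by rewrite col_mxEd !mxE /= nth_index // delta0 expr1n mul1r mcoeffX.
Qed.

Lemma secant_criterion : exists k G, [/\ is_form k G,
  forall F c x, is_secant F c x -> G F = 0 & G F0 != 0].
Proof.
pose f := fullrankfun full_rank0.
(* The rows [f] are independent at F0. The factor [delta F] makes the form vanish where the kernels
   are not controlled; elsewhere [secant_rank] makes the minor vanish. *)
exists (r + N * (r + r))%N, (fun F => delta F * \det (\matrix_(i, j) X F (f i) j)); split.
- apply: is_formM is_form_delta _; apply: is_form_det => i j; exact: is_form_X.
- move=> F c x Fx; have [->|dF] := eqVneq (delta F) 0; first by rewrite mul0r.
  apply/eqP; rewrite mulf_eq0 (negPf dF) /=; apply: contraTT (secant_rank Fx dF) => dX.
  rewrite -leqNgt -[N in (N <= _)%N](mxrank_unit (A := rowsub f (X F))).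
    exact/mxrankS/rowsub_sub.
  by rewrite unitmxE unitfE.
by rewrite delta0 mul1r -unitfE -unitmxE; apply: fullrowsub_unit.
Qed.

End Criterion.

(** * A cubic in six variables *)

(* The monomials of degree k in n variables, as lists of exponents. *)
Fixpoint exponents (n k : nat) : seq (seq nat) :=
  if n is n'.+1 then flatten [seq [seq i :: e | e <- exponents n' (k - i)] | i <- iota 0 k.+1]
  else if k == 0%N then [:: [::]] else [::].

Arguments exponents : simpl never.

Definition addexp (e1 e2 : seq nat) : seq nat := [seq e.1 + e.2 | e <- zip e1 e2]%N.

(* x0 x1 x3 + x0 x4 x5 + x1 x2 x4 + x2^2 x5 + x3 x5^2 + x4^3, in divided powers; each
   product of two variables divides at most one of the six monomials. *)
Definition cubic : seq (seq nat) :=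
  [:: [:: 1; 1; 0; 1; 0; 0]; [:: 1; 0; 0; 0; 1; 1]; [:: 0; 1; 1; 0; 1; 0];
      [:: 0; 0; 2; 0; 0; 1]; [:: 0; 0; 0; 1; 0; 2]; [:: 0; 0; 0; 0; 3; 0]]%N.

(* Generators of the apolar ideal in degree k: [:: m] stands for the monomial m and
   [:: m; m'] for the binomial m - m'. *)
Definition apolar_test (k : nat) (g : seq (seq nat)) : bool :=
  all (fun e => if g is [:: m; m'] then (addexp m e \in cubic) == (addexp m' e \in cubic)
    else if g is [:: m] then addexp m e \notin cubic else false) (exponents 6 (3 - k)).

Definition passing (test : pred (seq (seq nat))) (ms : seq (seq nat)) : seq (seq (seq nat)) :=
  let zs := [seq m <- ms | test [:: m]] in
  let nzs := [seq m <- ms | m \notin zs] in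
  [seq g <- [seq [:: m] | m <- zs] ++ [seq [:: m; m'] | m <- nzs, m' <- nzs] | test g].

Definition apolar_gens (k : nat) : seq (seq (seq nat)) := passing (apolar_test k) (exponents 6 k).

Definition mono_or_bino (ms : seq (seq nat)) (g : seq (seq nat)) : bool :=
  if g is [:: m; m'] then (m \in ms) && (m' \in ms)
  else if g is [:: m] then m \in ms else false.

Lemma mono_or_binoP ms g : mono_or_bino ms g ->
  (exists2 m, m \in ms & g = [:: m]) \/ exists m m', [/\ m \in ms, m' \in ms & g = [:: m; m']].
Proof.
case: g => [|m [|m' [|]]] //= => [mm|/andP[mm mm']]; first by left; exists m.
by right; exists m, m'.
Qed.

Lemma passingP test ms g : g \in passing test ms -> test g /\ mono_or_bino ms g.
Proof.
rewrite /passing mem_filter mem_cat => /andP[-> /orP[/mapP[m]|/allpairsP[[m m'] /=]]].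
  by rewrite mem_filter => /andP[_ mk] ->.
by rewrite !mem_filter => -[/andP[_ mk] /andP[_ mk'] ->] /=; rewrite mk mk'.
Qed.

(* If a functional kills the product g h and all of its monomials but one, it kills
   the last one too. *)
Definition kill_step (killed : seq (seq nat)) (g h : seq (seq nat)) : seq (seq nat) :=
  if [seq e <- [seq addexp m m' | m <- g, m' <- h] | e \notin killed] is [:: e]
  then e :: killed else killed.

Definition kill (gs hs : seq (seq (seq nat))) (cert : seq (nat * nat)) (killed : seq (seq nat)) :=
  foldl (fun k ij => kill_step k (nth [::] gs ij.1) (nth [::] hs ij.2)) killed cert.

(** The quadrics apolar to the cubic form a space of dimension 21 - 6 = 15, with symmetric square of
    dimension 120, against 126 quartics: at least six have to be left over. *)
Definition exceptional_quartics : seq (seq nat) :=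
  [:: [:: 1; 1; 0; 1; 1; 0]; [:: 1; 1; 1; 0; 1; 0]; [:: 1; 0; 0; 1; 1; 1];
      [:: 1; 1; 1; 1; 0; 0]; [:: 1; 1; 0; 1; 0; 1]; [:: 1; 1; 0; 0; 1; 1]]%N.

(* Found by a greedy search. *)
Definition quartic_cert : seq (nat * nat) :=
  [:: (0, 0); (0, 1); (0, 2); (0, 3); (0, 4); (0, 5); (0, 6); (1, 1); (1, 2); (1, 3); (1,
      4); (1, 5); (1, 6); (2, 2); (2, 3); (2, 4); (2, 5); (2, 6); (3, 3); (3, 4); (3, 5);
      (3, 6); (4, 4); (4, 5); (4, 6); (5, 5); (5, 6); (6, 6); (0, 8); (0, 13); (0, 28);
      (1, 12); (1, 13); (1, 15); (1, 16); (1, 20); (2, 8); (2, 10); (2, 16); (2, 18); (2,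
      20); (2, 21); (3, 16); (3, 20); (3, 21); (4, 8); (5, 10); (5, 18); (5, 20); (6, 15);
      (6, 16); (15, 0); (16, 0); (18, 0); (18, 1); (20, 0); (26, 0); (26, 1); (28, 2);
      (30, 2); (34, 5); (35, 5); (37, 6); (10, 10); (10, 12); (10, 13); (10, 15); (10,
      16); (12, 16); (13, 20); (15, 16); (15, 20); (15, 21); (16, 16); (16, 18); (16, 20);
      (18, 20); (20, 12); (20, 20); (21, 12); (21, 13); (21, 18); (23, 13); (28, 8); (28,
      13); (28, 28); (30, 8); (30, 13); (1, 8); (3, 18); (4, 10); (4, 15); (4, 16); (5,
      12); (5, 13); (6, 8); (6, 10); (6, 12); (6, 13); (6, 18); (8, 5); (10, 3); (8, 16);
      (8, 18); (8, 20); (8, 21); (10, 18); (10, 20); (13, 18); (18, 12); (18, 18); (3,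
      12); (3, 13); (4, 12); (4, 13); (4, 18); (4, 20); (8, 3); (8, 8); (8, 10)]%N.

Definition quintic_cert : seq (nat * nat) :=
  [:: (0, 31); (1, 1); (0, 51); (0, 54); (0, 33); (0, 36); (4, 9); (3, 53); (3, 54); (3,
      32); (3, 33); (0, 40); (0, 41); (1, 40); (1, 41); (3, 37); (5, 19); (2, 40); (0,
      42); (1, 42); (2, 31); (5, 51); (5, 53); (2, 42); (3, 41); (4, 33); (0, 43); (4,
      37); (2, 43); (0, 44); (3, 45); (3, 46); (0, 48); (5, 41); (2, 48)]%N.

Lemma quartics_killed :
  let ks := kill (apolar_gens 2) (apolar_gens 2) quartic_cert exceptional_quartics in
  all (fun e => e \in ks) (exponents 6 4).
Proof. by vm_compute. Qed.

(** Multiples of the exceptional quartics suffice: for the other quintics, [quartics_span] is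
    applied to the functional taking P to mu (P x_i). *)
Lemma quintics_killed :
  let ks := kill (apolar_gens 2) (apolar_gens 3) quintic_cert [::] in
  all (fun e => e \in ks) [seq addexp e x | e <- exceptional_quartics, x <- exponents 6 1].
Proof. by vm_compute. Qed.

Lemma exponentsP n k e : reflect
  (exists i e', [/\ (i <= k)%N, e' \in exponents n (k - i) & e = i :: e'])
  (e \in exponents n.+1 k).
Proof.
apply: (iffP flattenP) => [[s /mapP[i]]|[i [e' [ik e'k ->]]]].
  by rewrite mem_iota => ik -> /mapP[e' e'k ->]; exists i, e'.
exists [seq i :: e | e <- exponents n (k - i)]; last by apply/mapP; exists e'.
by apply/mapP; exists i; rewrite // mem_iota.
Qed.

Lemma size_exponents n k e : e \in exponents n k -> size e = n.
Proof.
elim: n k e => [|n IH] k e.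
  by rewrite /exponents; case: ifP => // _; rewrite inE => /eqP ->.
by move=> /exponentsP[i [e' [_ /IH <- ->]]].
Qed.

Lemma sumn_exponents n k e : e \in exponents n k -> sumn e = k.
Proof.
elim: n k e => [|n IH] k e.
  by rewrite /exponents; case: eqP => // ->; rewrite inE => /eqP ->.
by move=> /exponentsP[i [e' [ik /IH E ->]]] /=; rewrite E subnKC.
Qed.

Lemma mem_exponents e : e \in exponents (size e) (sumn e).
Proof.
elim: e => [|i e IH] //; apply/exponentsP; exists i, e.
by rewrite /= leq_addr addKn.
Qed.

Definition mexp (e : seq nat) : 'X_{1..6} := [multinom nth 0%N e i | i < 6].

Definition expm (M : 'X_{1..6}) : seq nat := [seq M i | i <- enum 'I_6].

Lemma expmK M : mexp (expm M) = M.
Proof.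
apply/mnmP => i; rewrite mnmE (nth_map i) ?size_enum_ord //.
by congr (M _); apply: val_inj; rewrite /= nth_enum_ord.
Qed.

Lemma size_expm M : size (expm M) = 6%N.
Proof. by rewrite size_map size_enum_ord. Qed.

Lemma mexpK e : size e = 6%N -> expm (mexp e) = e.
Proof.
move=> e6; apply: (@eq_from_nth _ 0%N) => [|i]; rewrite size_expm ?e6 // => i6.
rewrite (nth_map (Ordinal i6)) ?size_enum_ord // mnmE; congr (nth _ _ _).
by rewrite nth_enum_ord.
Qed.

Lemma sumn_expm M : sumn (expm M) = mdeg M.
Proof. by rewrite mdegE sumnE /expm big_map big_enum. Qed.

Lemma mem_expm M : expm M \in exponents 6 (mdeg M).
Proof. by have := mem_exponents (expm M); rewrite size_expm sumn_expm. Qed.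

Lemma expmD M1 M2 : expm (M1 + M2) = addexp (expm M1) (expm M2).
Proof. by rewrite /addexp /expm zip_map -map_comp; apply: eq_map => i; rewrite /= mnmDE. Qed.

Lemma mexpD e1 e2 : size e1 = 6%N -> size e2 = 6%N ->
  mexp (addexp e1 e2) = (mexp e1 + mexp e2)%MM.
Proof. by move=> s1 s2; rewrite -[RHS]expmK expmD !mexpK. Qed.

Lemma mdeg_mexp e k : e \in exponents 6 k -> mdeg (mexp e) = k.
Proof.
by move=> ek; rewrite -sumn_expm mexpK ?(size_exponents ek) // (sumn_exponents ek).
Qed.

Section Apolar.
Variable K : fieldType.
Notation poly := {mpoly K[6]}.

Definition cubic_weight (M : 'X_{1..6}) : K := (expm M \in cubic)%:R.

Definition cubic_fun : {linear poly -> K^o} := coef_fun 4 cubic_weight.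

Lemma cubic_degree e : e \in cubic -> sumn e = 3%N.
Proof. by move=> ec; apply/eqP; move: e ec; apply/allP. Qed.

Lemma cubic_funX M : cubic_fun 'X_[M] = (expm M \in cubic)%:R.
Proof.
rewrite /cubic_fun /= coef_funX; case: ltnP => // M4; case: (boolP (_ \in _)) => // /cubic_degree.
by rewrite sumn_expm => M3; rewrite M3 in M4.
Qed.

Definition apolar (g : poly) : Prop := forall h, cubic_fun (g * h) = 0.

Lemma apolarM g h : apolar g -> apolar (g * h).
Proof. by move=> ag h'; rewrite -mulrA. Qed.

Lemma apolar_monomials g : (forall M, cubic_fun (g * 'X_[M]) = 0) -> apolar g.
Proof.
move=> gM h; rewrite [h]mpolyE mulr_sumr linear_sum big1 // => M _.
by rewrite -scalerAr linearZ gM [LHS]mulr0.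
Qed.

Lemma apolar_high M : (3 < mdeg M)%N -> apolar 'X_[M].
Proof.
move=> M3; apply: apolar_monomials => M'; rewrite -mpolyXD cubic_funX.
case: (boolP (_ \in _)) => // /cubic_degree; rewrite sumn_expm mdegD => E.
by have := leq_addr (mdeg M') (mdeg M); rewrite E leqNgt M3.
Qed.

Definition gpoly (g : seq (seq nat)) : poly :=
  if g is [:: m; m'] then 'X_[mexp m] - 'X_[mexp m']
  else if g is [:: m] then 'X_[mexp m] else 0.

Lemma apolar_gens_homog k g : g \in apolar_gens k -> gpoly g \is k.-homog.
Proof.
case/passingP=> _ /mono_or_binoP[[m /mdeg_mexp E ->]|[m [m' [/mdeg_mexp E /mdeg_mexp E' ->]]]].
  by rewrite /gpoly dhomogX /= E.
by rewrite /gpoly rpredB // dhomogX /= ?E ?E'.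
Qed.

(** The cubic is homogeneous, so only multipliers of degree 3 - k matter, and these are the ones
    tested. *)
Lemma apolar_gens_apolar k g : g \in apolar_gens k -> apolar (gpoly g).
Proof.
move=> /passingP[test gs]; apply: apolar_monomials => M.
have fX m : m \in exponents 6 k ->
    cubic_fun ('X_[mexp m] * 'X_[M]) = (addexp m (expm M) \in cubic)%:R.
  by move=> mk; rewrite -mpolyXD cubic_funX expmD mexpK ?(size_exponents mk).
have deg m : m \in exponents 6 k -> addexp m (expm M) \in cubic ->
    expm M \in exponents 6 (3 - k).
  move=> mk; rewrite -[m in addexp m _]mexpK ?(size_exponents mk) // -expmD.
  move/cubic_degree; rewrite sumn_expm mdegD (mdeg_mexp mk) => E.
  by have := mem_expm M; rewrite -(addKn k (mdeg M)) E.
case/mono_or_binoP: gs test => [[m mk ->] /allP test|[m [m' [mk mk' ->]]] /allP test].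
  rewrite fX //; case: (boolP (_ \in cubic)) => // mM.
  by have := test _ (deg _ mk mM); rewrite mM.
have fB (P Q : poly) : cubic_fun (P - Q) = (cubic_fun P : K) - cubic_fun Q by exact: linearB.
rewrite /gpoly mulrBl fB !fX //.
have [mM|mM] := boolP (addexp m _ \in _).
  by have /eqP := test _ (deg _ mk mM); rewrite mM => <-; rewrite subrr.
have [mM'|] := boolP (addexp m' _ \in _); last by rewrite subrr.
by have /eqP := test _ (deg _ mk' mM'); rewrite mM' (negPf mM).
Qed.

Section Kill.
Variable mu : poly -> K.
Hypothesis muL : forall c P Q, mu (c *: P + Q) = c * mu P + mu Q.

Definition dead (ks : seq (seq nat)) := forall e, e \in ks -> mu 'X_[mexp e] = 0.

Definition signed (g : seq (seq nat)) : seq (K * seq nat) :=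
  if g is [:: m; m'] then [:: (1, m); (-1, m')] else [seq (1, m) | m <- g].

Lemma gpoly_signed ms g : mono_or_bino ms g ->
  gpoly g = \sum_(p <- signed g) p.1 *: 'X_[mexp p.2].
Proof.
case: g => [|m [|m' [|]]] //= _; first by rewrite big_seq1 scale1r.
by rewrite big_cons big_seq1 /= scale1r scaleN1r.
Qed.

Lemma signedP ms g p : mono_or_bino ms g -> p \in signed g -> p.1 != 0 /\ p.2 \in ms.
Proof.
case: g => [|m [|m' [|]]] //=; first by rewrite inE => mm /eqP -> /=; rewrite oner_eq0.
by case/andP=> mm mm'; rewrite !inE => /orP[] /eqP -> /=; rewrite ?oppr_eq0 oner_eq0.
Qed.

Lemma signed_snd ms g : mono_or_bino ms g -> [seq p.2 | p <- signed g] = g.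
Proof. by case: g => [|m [|m' [|]]]. Qed.

Lemma mu_sum (I : Type) (s : seq I) (c : I -> K) (P : I -> poly) :
  mu (\sum_(i <- s) c i *: P i) = \sum_(i <- s) c i * mu (P i).
Proof.
elim: s => [|i s IH]; last by rewrite !big_cons muL IH.
by rewrite !big_nil; apply: (addIr (mu 0)); rewrite add0r -{1}[mu 0]mul1r -muL scaler0 add0r.
Qed.

(** Surviving terms are listed with multiplicity, so a single survivor has coefficient 1 or -1,
    which is invertible in every characteristic. *)
Lemma kill_step_dead k l ks g h : mono_or_bino (exponents 6 k) g ->
  mono_or_bino (exponents 6 l) h ->
  mu (gpoly g * gpoly h) = 0 -> dead ks -> dead (kill_step ks g h).
Proof.
move=> sg sh mgh dks.
pose es := [seq (p.1 * q.1, addexp p.2 q.2) | p <- signed g, q <- signed h].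
have esE : [seq addexp m m' | m <- g, m' <- h] = [seq p.2 | p <- es].
  by rewrite -{1}(signed_snd sg) -{1}(signed_snd sh) allpairs_mapl allpairs_mapr map_allpairs.
have es0 : \sum_(p <- es) p.1 * mu 'X_[mexp p.2] = 0.
  rewrite -mu_sum -[RHS]mgh (gpoly_signed sg) (gpoly_signed sh) big_distrlr big_allpairs_dep.
  congr mu; rewrite big_seq [RHS]big_seq; apply: eq_bigr => p /(signedP sg)[_ /size_exponents pg].
  rewrite big_seq [RHS]big_seq; apply: eq_bigr => q /(signedP sh)[_ /size_exponents qh].
  by rewrite /= mexpD // mpolyXD -scalerAl -scalerAr scalerA.
rewrite /kill_step esE filter_map; set fs := filter _ es.
case E : fs => [|p [|]] //= e; rewrite inE => /orP[/eqP ->|/dks //].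
have p0 : p.1 != 0.
  have : p \in fs by rewrite E mem_head.
  rewrite /fs mem_filter => /andP[_].
  case/allpairsP => [[u w] /= [/(signedP sg)[u0 _] /(signedP sh)[w0 _] ->]].
  by rewrite mulf_neq0.
move: es0; rewrite (bigID (fun p : K * seq nat => p.2 \in ks)) /= big1 => [|q /dks ->]; last first.
  by rewrite mulr0.
rewrite -big_filter -/fs E big_seq1 add0r => /eqP.
by rewrite mulf_eq0 (negPf p0) => /eqP.
Qed.

Lemma kill_dead k l gs hs cert ks :
  (forall g, g \in gs -> mono_or_bino (exponents 6 k) g) ->
  (forall h, h \in hs -> mono_or_bino (exponents 6 l) h) ->
  (forall g h, g \in gs -> h \in hs -> mu (gpoly g * gpoly h) = 0) ->
  dead ks -> dead (kill gs hs cert ks).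
Proof.
move=> sg sh mgh; rewrite /kill; elim: cert ks => //= -[i j] cert IH ks dks /=.
apply: IH; have [gi|gi] := ltnP i (size gs); last by rewrite nth_default.
have [hj|hj] := ltnP j (size hs).
  by apply: (kill_step_dead (sg _ _) (sh _ _)); rewrite ?mgh ?mem_nth.
rewrite (nth_default _ hj) /kill_step.
by rewrite allpairs0r.
Qed.

End Kill.

(* The square of the apolar ideal has codimension at most 6 in degree 4. *)
Lemma quartics_span (mu : poly -> K) :
  (forall c P Q, mu (c *: P + Q) = c * mu P + mu Q) ->
  (forall g h, g \is 2.-homog -> h \is 2.-homog -> apolar g -> apolar h -> mu (g * h) = 0) ->
  dead mu exceptional_quartics -> forall M, mdeg M = 4%N -> mu 'X_[M] = 0.
Proof.
move=> muL mgh dex M M4; rewrite -[M]expmK; have := mem_expm M; rewrite M4.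
move=> /(allP quartics_killed); move: (expm M).
apply: (kill_dead muL (k := 2) (l := 2)) dex => [g /passingP[]|h /passingP[]|g h gk hk] //.
by apply: mgh; [exact: apolar_gens_homog..|exact: apolar_gens_apolar gk|exact: apolar_gens_apolar hk].
Qed.

(* It contains all forms of degree 5. *)
Lemma quintics_span (mu : poly -> K) :
  (forall c P Q, mu (c *: P + Q) = c * mu P + mu Q) ->
  (forall g h, g \is 2.-homog -> h \is 3.-homog -> apolar g -> apolar h -> mu (g * h) = 0) ->
  forall M, mdeg M = 5%N -> mu 'X_[M] = 0.
Proof.
move=> muL mgh M M5.
have exc e i : e \in exceptional_quartics -> mu ('X_[mexp e] * 'X_i) = 0.
  move=> ee; have ee4 : size e = 6%N by apply/eqP; move: e ee; apply/allP.
  have iE : 'X_i = 'X_[mexp (expm U_(i))] :> poly by rewrite expmK.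
  have i1 : expm U_(i) \in exponents 6 1 by have := mem_expm U_(i); rewrite mdeg1.
  rewrite iE -mpolyXD -mexpD ?size_expm //.
  have : addexp e (expm U_(i)) \in kill (apolar_gens 2) (apolar_gens 3) quintic_cert [::].
    by apply: (allP quintics_killed); apply/allpairsP; exists (e, expm U_(i)).
  move: (addexp _ _); apply: (kill_dead muL (k := 2) (l := 3)) => [g /passingP[]|h /passingP[]|g h gk hk|] //.
  by apply: mgh; [exact: apolar_gens_homog..|exact: apolar_gens_apolar gk|exact: apolar_gens_apolar hk].
have [i Mi] : exists i, (U_(i) <= M)%MM.
  apply: contrapT => /forallNP Mi; have M0 : M = 0%MM.
    by apply/mnmP => i; rewrite mnm0E; apply/eqP/negPn/negP; rewrite -lep1mP; apply: Mi.
  by rewrite M0 mdeg0 in M5.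
rewrite -(submK Mi) mpolyXD.
apply: (quartics_span (mu := fun P => mu (P * 'X_i))) => [c P Q|g h hg hh ag ah|e ee|].
- by rewrite mulrDl -scalerAl muL.
- rewrite -mulrA; apply: mgh => //; last exact: apolarM.
  by have := dhomogM hh (_ : ('X_i : poly) \is 1.-homog); apply; rewrite dhomogX /= mdeg1.
- exact: exc.
by have := mdegD (M - U_(i)) U_(i); rewrite submK // M5 mdeg1 addn1 => -[].
Qed.

End Apolar.

(** * A cubic and a curvilinear scheme *)

Lemma multinom_between n (u e : 'X_{1..n}) k : (u <= e)%MM -> (mdeg u <= k <= mdeg e)%N ->
  exists2 f, mdeg f = k & (u <= f)%MM && (f <= e)%MM.
Proof.
move=> ue /andP[]; move: {2}(k - mdeg u)%N (leqnn (k - mdeg u)) => l.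
elim: l u ue => [|l IH] u ue kl uk ke.
  by exists u; rewrite ?ue ?lepm_refl //; apply/eqP; rewrite eqn_leq uk -subn_eq0 -leqn0.
have [<-|uk'] := eqVneq (mdeg u) k; first by exists u; rewrite ?lepm_refl.
have {uk uk'} uk : (mdeg u < k)%N by rewrite ltn_neqAle uk' uk.
have [i ui] : exists i, (u i < e i)%N.
  apply: contrapT => /forallNP H; have : (mdeg e <= mdeg u)%N.
    by rewrite !mdegE; apply: leq_sum => i _; rewrite leqNgt; apply/negP.
  by rewrite leqNgt (leq_trans uk ke).
have [||||f fk /andP[uf fe]] := IH (u + U_(i))%MM.
- apply/mnm_lepP => j; rewrite mnmDE mnm1E; case: eqP => [<-|_]; first by rewrite addn1.
  by rewrite addn0; move/mnm_lepP: ue.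
- by rewrite mdegD mdeg1; lia.
- by rewrite mdegD mdeg1 addn1.
- exact: ke.
exists f => //; rewrite fe andbT; apply: lepm_trans uf; exact: lem_addr.
Qed.

Lemma multinom_split n (u1 u2 e : 'X_{1..n}) k : (u1 + u2 <= e)%MM ->
  (mdeg u1 <= k)%N -> (mdeg u2 <= mdeg e - k)%N -> (k <= mdeg e)%N ->
  exists e1 e2, [/\ e = (e1 + e2)%MM, mdeg e1 = k, (u1 <= e1)%MM & (u2 <= e2)%MM].
Proof.
move=> ue u1k u2k ke; have u2e : (u2 <= e)%MM by apply: lepm_trans ue; apply: lem_addl.
have de : mdeg (e - u2)%MM = (mdeg e - mdeg u2)%N by rewrite -{2}(submK u2e) mdegD addnK.
have [||f fk /andP[uf fe]] := @multinom_between _ u1 (e - u2)%MM k.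
- by apply/mnm_lepP => i; move/mnm_lepP/(_ i): ue; rewrite mnmDE mnmBE; lia.
- by rewrite u1k de; lia.
have fe' : (f <= e)%MM by apply: lepm_trans fe _; apply: lem_subr.
exists f, (e - f)%MM; split=> //; first by rewrite addmC submK.
apply/mnm_lepP => i; move/mnm_lepP/(_ i): fe; move/mnm_lepP/(_ i): u2e.
by rewrite !mnmBE; lia.
Qed.

Lemma homogenizeD n k l (a b : 'X_{1..n}) : (mdeg a <= k)%N -> (mdeg b <= l)%N ->
  homogenize (k + l) (a + b)%MM = (homogenize k a + homogenize l b)%MM.
Proof.
move=> ak bl; apply/mnmP => i; rewrite mnmDE; case: (unliftP ord0 i) => [j|] ->.
  by rewrite !homogenizeS mnmDE.
by rewrite !homogenize0 mdegD; lia.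
Qed.

Definition affine_part n (M : 'X_{1..n.+1}) : 'X_{1..n} := [multinom M (lift ord0 j) | j < n].

Lemma affine_part_homogenize n k (a : 'X_{1..n}) : affine_part (homogenize k a) = a.
Proof. by apply/mnmP => j; rewrite mnmE homogenizeS. Qed.

Lemma mdeg_affine_part n (M : 'X_{1..n.+1}) : mdeg M = (M ord0 + mdeg (affine_part M))%N.
Proof.
by rewrite !mdegE big_ord_recl; congr (_ + _)%N; apply: eq_bigr => j _; rewrite mnmE.
Qed.

Lemma homogenize_affine_part n (M : 'X_{1..n.+1}) : homogenize (mdeg M) (affine_part M) = M.
Proof.
apply/mnmP => i; case: (unliftP ord0 i) => [j|] ->; first by rewrite homogenizeS mnmE.
by rewrite homogenize0 mdeg_affine_part addnK.
Qed.

Lemma affine_partD n (M M' : 'X_{1..n.+1}) :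
  affine_part (M + M')%MM = (affine_part M + affine_part M')%MM.
Proof. by apply/mnmP => i; rewrite mnmDE !mnmE. Qed.

Lemma comp_mpolyA (K : comNzRingType) k l m (P : {mpoly K[k]}) (t : k.-tuple {mpoly K[l]})
    (u : l.-tuple {mpoly K[m]}) :
  (P \mPo t) \mPo u = P \mPo [tuple tnth t i \mPo u | i < k].
Proof.
rewrite (comp_mpolyEX P t) (comp_mpolyEX P [tuple _ | _ < k]) raddf_sum; apply: eq_bigr => M _ /=.
rewrite comp_mpolyZ !comp_mpolyX rmorph_prod; congr (_ *: _); apply: eq_bigr => i _.
by rewrite rmorphXn /= tnth_mktuple.
Qed.

Section CubicAndCurve.
Variable K : closedFieldType.
Variable s : nat.

Section AnyDimension.
Variable n : nat.
Notation V := 'rV[K]_n.+1.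
Notation poly := {mpoly K[n.+1]}.

(** Affine coordinates at (1, 0, ..., 0) in a fixed P^6: the variables after the seventh are set to
    0. *)
Definition affine_var (i : nat) : {mpoly K[6]} :=
  if i is i'.+1 then (if (i' < 6)%N then 'X_(inord i') else 0) else 1.

Definition dehom : n.+1.-tuple {mpoly K[6]} := [tuple affine_var i | i < n.+1].

Definition cubic_part : {linear poly -> K^o} := cubic_fun K \o comp_mpoly dehom.

(** The line through (0, 1, t, 0, ...), whose point t = 0 differs from the support of the cubic. *)
Definition curve_var (i : nat) : {poly K} :=
  if i == 1%N then 1 else if i == 2 then 'X else 0.

Definition on_curve (P : poly) : {poly K} := mmap (@polyC K) (fun i => curve_var i) P.

HB.instance Definition _ := GRing.RMorphism.copy on_curve
  (mmap (@polyC K) (fun i : 'I_n.+1 => curve_var i)).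

Lemma on_curveM P Q : on_curve (P * Q) = on_curve P * on_curve Q.
Proof. exact: rmorphM. Qed.

Lemma on_curveXn P e : on_curve (P ^+ e) = on_curve P ^+ e.
Proof. exact: rmorphXn. Qed.

(* The coefficient of x_1^(d-s+1) x_2^(s-1) in forms of degree d; the shift by 'X
   makes it vanish for s = 0. *)
Definition curve_part (P : poly) : K^o := ('X * on_curve P)`_s.

Fact curve_part_linear : linear curve_part.
Proof.
move=> c P Q; rewrite /curve_part /on_curve mmapD mmapZ -/(on_curve P) -/(on_curve Q).
by rewrite mulrDr coefD mulrCA coefCM.
Qed.

HB.instance Definition _ := GRing.isLinear.Build K poly K^o _ curve_part curve_part_linear.

Lemma cubic_part_local :
  local_functional (\row_i ((i : nat) == 0%N)%:R : V) 14 cubic_part.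
Proof.
(* With k = 1 the length is 2 C(7, 1) = 14. *)
have := @osculating_local K n 6 1 (@cubic_weight K) dehom (\row_i ((i : nat) == 0%N)%:R).
rewrite card_low; apply=> [|i].
  by apply/eqP => /rowP/(_ ord0)/eqP; rewrite !mxE eqxx oner_eq0.
rewrite tnth_mktuple mxE /affine_var; case: (i : nat) => [|j]; first by rewrite mcoeff1 eqxx.
by case: ifP => _; rewrite ?mcoeff0 // mcoeffX mnm1_eq0.
Qed.

Hypothesis n2 : (2 <= n)%N.

Lemma curve_part_local :
  local_functional (\row_i ((i : nat) == 1%N)%:R : V) s curve_part.
Proof.
split.
- apply/eqP => /rowP/(_ (inord 1))/eqP; rewrite !mxE inordK; last by rewrite ltnS ltnW.
  by rewrite eqxx oner_eq0.
- exists s => h g hx; rewrite /curve_part on_curveM.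
  have : root (on_curve h) 0.
    rewrite /root /on_curve /mmap horner_sum; apply/eqP; rewrite -[RHS]hx mevalE.
    apply: eq_bigr => M _; rewrite hornerM hornerC /mmap1 horner_prod; congr (_ * _).
    apply: eq_bigr => i _; rewrite horner_exp mxE /curve_var.
    by case: eqP => _; rewrite ?hornerC //; case: eqP => _; rewrite ?hornerX ?horner0.
  case/factor_theorem => u; rewrite subr0 => hu.
  have -> : on_curve (h ^+ s) = 'X^s * u ^+ s.
    by rewrite on_curveXn hu exprMn mulrC.
  by rewrite -!mulrA mulrA -exprS coefXnM ltnSn.
exists (fun i g => (on_curve g)`_i), (fun i h => (on_curve h)`_(s.-1 - i)) => g h.
rewrite /curve_part on_curveM coefXM.
by case: s => [|s']; rewrite ?big_ord0 // coefM.
Qed.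

End AnyDimension.
End CubicAndCurve.

(** * The square of the ideal of the scheme in P^6 *)

Section SevenVariables.
Variables (K : closedFieldType) (s : nat).
Notation poly6 := {mpoly K[6]}.
Notation poly7 := {mpoly K[7]}.

Definition cubic_curve7 (P : poly7) : K := cubic_part K 6 P + curve_part s P.

Lemma dehomX M : 'X_[M] \mPo dehom K 6 = 'X_[affine_part M] :> poly6.
Proof.
rewrite comp_mpolyX big_ord_recl tnth_mktuple expr1n mul1r [RHS]mpolyXE_id.
by apply: eq_bigr => j _; rewrite tnth_mktuple /affine_var /= ltn_ord mnmE inord_val.
Qed.

Lemma cubic_partX M : cubic_part K 6 'X_[M] = (expm (affine_part M) \in cubic)%:R.
Proof. by rewrite /cubic_part /= dehomX; apply: cubic_funX. Qed.

(* The monomials in x_0, x_1 only; the variables are those of an affine chart of P^6,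
   so that x_0 and x_1 are the first two coordinates on the hyperplane at infinity. *)
Definition binary_mon (k i : nat) : 'X_{1..6} :=
  (U_(ord0) *+ (k - i) + U_(lift ord0 ord0) *+ i)%MM.

Definition binary (e : 'X_{1..6}) : bool := [forall j : 'I_6, (1 < j)%N ==> (e j == 0%N)].

Notation j1 := (lift ord0 ord0 : 'I_6).

Lemma binary_mon1 k i : binary_mon k i j1 = i.
Proof. by rewrite mnmDE !mulmnE !mnm1E /= mul0n mul1n. Qed.

Lemma binaryD e1 e2 : binary e1 -> binary e2 -> binary (e1 + e2)%MM.
Proof.
move=> /forallP b1 /forallP b2; apply/forallP => j; apply/implyP => j2.
by rewrite mnmDE addn_eq0 (implyP (b1 j)) // (implyP (b2 j)).
Qed.

Lemma mdeg_binary_mon k i : (i <= k)%N -> mdeg (binary_mon k i) = k.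
Proof. by move=> ik; rewrite mdegD !mdegMn !mdeg1 !mul1n subnK. Qed.

Lemma binary_mon_binary k i : binary (binary_mon k i).
Proof.
apply/forallP => j; apply/implyP => j2; rewrite mnmDE !mulmnE !mnm1E.
by case: j j2 => [[|[|j]] ?].
Qed.

Lemma binaryE e : binary e -> e = binary_mon (mdeg e) (e j1).
Proof.
move=> /forallP be; have e0 (j : 'I_6) : (1 < j)%N -> e j = 0%N.
  by move=> j2; have := be j; rewrite j2 => /eqP.
have de : mdeg e = (e ord0 + e j1)%N.
  rewrite mdegE big_ord_recl [X in (_ + X)%N]big_ord_recl [X in (_ + (_ + X))%N]big1 ?addn0 //.
  by move=> j _; apply: e0.
apply/mnmP => j; rewrite mnmDE !mulmnE !mnm1E de addnK.
case: (unliftP ord0 j) => [j'|] ->; last by rewrite mul1n mul0n addn0.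
rewrite mul0n; case: (unliftP ord0 j') => [j''|] ->; last by rewrite eqxx mul1n.
by rewrite mul0n e0.
Qed.

Lemma on_curveX M : on_curve 'X_[M] =
  if (M ord0 == 0%N) && binary (affine_part M) then 'X ^+ (affine_part M j1) else 0 :> {poly K}.
Proof.
rewrite /on_curve mmapX /mmap1; case: ifP => [/andP[/eqP M0 /forallP bM]|].
  rewrite big_ord_recl [X in _ * X]big_ord_recl [X in _ * (_ * X)]big_ord_recl /=.
  rewrite M0 expr0 mul1r expr1n mul1r mnmE [X in _ * X]big1 ?mulr1 // => j _.
  have /eqP := implyP (bM (lift ord0 (lift ord0 j))) isT.
  by rewrite mnmE => ->; rewrite expr0.
move/negbT; rewrite negb_and => H; apply/eqP.
have [i [i12 Mi]] : exists i : 'I_7, (i != 1 :> nat) && (i != 2 :> nat) /\ M i != 0%N.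
  case/orP: H => [M0|]; first by exists ord0.
  rewrite negb_forall => /existsP[j]; rewrite negb_imply mnmE => /andP[j2 Mj].
  by exists (lift ord0 j); split=> //; case: j j2 {Mj} => [[|[|j]] ?].
case/andP: i12 => i1 i2; rewrite prodf_seq_eq0; apply/hasP; exists i; first exact: mem_index_enum.
by rewrite /curve_var (negPf i1) (negPf i2) expf_eq0 eqxx andbT lt0n.
Qed.

Lemma curve_partX M : curve_part s ('X_[M] : poly7) =
  ((M ord0 == 0%N) && binary (affine_part M) && ((affine_part M j1).+1 == s))%:R.
Proof.
rewrite /curve_part on_curveX; case: ifP => _; last by rewrite mulr0 coef0.
by rewrite -exprS coefXn eq_sym.
Qed.

Lemma cubic_curve7X M : cubic_curve7 'X_[M] = (expm (affine_part M) \in cubic)%:R +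
  ((M ord0 == 0%N) && binary (affine_part M) && ((affine_part M j1).+1 == s))%:R.
Proof. by rewrite /cubic_curve7 cubic_partX curve_partX. Qed.

Variables (da db : nat).
Hypothesis daE : da = (s + 13)%N.
Hypothesis dbs : (s + 14 <= db)%N.

Definition basis_exps : seq (seq nat) := exponents 6 0 ++ exponents 6 1.

(* The complement of [:: m], for m in basis_exps, in some monomial of the cubic. *)
Definition dual_exps : seq (seq nat) :=
  [:: [:: 1; 1; 0; 1; 0; 0]; [:: 1; 0; 0; 0; 1; 0]; [:: 1; 0; 0; 0; 0; 1];
      [:: 1; 1; 0; 0; 0; 0]; [:: 0; 1; 0; 0; 1; 0]; [:: 1; 0; 0; 1; 0; 0];
      [:: 0; 1; 0; 1; 0; 0]]%N.

(** The two halves are exchanged in [right_exps], so that the i-th entries of the lists are dual to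
    each other under the cubic. *)
Definition left_exps := basis_exps ++ dual_exps.
Definition right_exps := dual_exps ++ basis_exps.
Arguments left_exps : simpl never.
Arguments right_exps : simpl never.

Lemma basis_dual : all (fun i => all (fun j =>
    (addexp (nth [::] left_exps i) (nth [::] right_exps j) \in cubic)
    == (i == j)) (iota 0 14)) (iota 0 14).
Proof. by vm_compute. Qed.

Definition left_mon (i : 'I_(14 + s)) : 'X_{1..6} := match fintype.split i with
  | inl a => mexp (nth [::] left_exps a) | inr b => binary_mon da b end.
Definition right_mon (i : 'I_(14 + s)) : 'X_{1..6} := match fintype.split i with
  | inl a => mexp (nth [::] right_exps a) | inr b => binary_mon db (s.-1 - b) end.

Lemma exps_low (a : 'I_14) :
  [/\ size (nth [::] left_exps a) = 6%N,
      (sumn (nth [::] left_exps a) <= 3)%N,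
      size (nth [::] right_exps a) = 6%N &
      (sumn (nth [::] right_exps a) <= 3)%N].
Proof.
have : all (fun i => [&& size (nth [::] left_exps i) == 6%N,
  (sumn (nth [::] left_exps i) <= 3)%N,
  size (nth [::] right_exps i) == 6%N &
  (sumn (nth [::] right_exps i) <= 3)%N]) (iota 0 14) by vm_compute.
move/allP/(_ (a : nat)); rewrite mem_iota ltn_ord => /(_ isT).
by case/and4P => /eqP ? ? /eqP ? ?.
Qed.

(** The mixed products vanish: their affine degree exceeds 3, which kills the cubic part, and they
    contain x_0, which kills the curve part. *)
Lemma left_right_dual i j :
  cubic_curve7 ('X_[homogenize da (left_mon i)] * 'X_[homogenize db (right_mon j)]) = (i == j)%:R.
Proof.
rewrite -mpolyXD cubic_curve7X affine_partD !affine_part_homogenize mnmDE !homogenize0 expmD /left_mon /right_mon.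
have big e : (3 < sumn e)%N -> e \in cubic = false.
  by move=> e3; apply/negbTE/negP => /cubic_degree E; rewrite E in e3.
have add_sumn M1 M2 : sumn (addexp (expm M1) (expm M2)) = (mdeg M1 + mdeg M2)%N.
  by rewrite -expmD sumn_expm mdegD.
rewrite -(splitK i) -(splitK j) (inj_eq (can_inj unsplitK)) !unsplitK.
case: (fintype.split i) => a; case: (fintype.split j) => b /=.
- have [a6 a3 _ _] := exps_low a; have [_ _ b6 b3] := exps_low b.
  rewrite !mexpK // -!sumn_expm !mexpK // (_ : (_ == 0%N) = false) /= ?addr0; last first.
    by apply/negbTE; rewrite -lt0n; lia.
  have /allP/(_ (a : nat)) := basis_dual; rewrite mem_iota ltn_ord => /(_ isT).
  by move=> /allP/(_ (b : nat)); rewrite mem_iota ltn_ord => /(_ isT) /eqP ->.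
- have [a6 a3 _ _] := exps_low a.
  rewrite big ?add_sumn ?mdeg_binary_mon /=; try by lia.
  by rewrite -[mdeg (mexp _)]sumn_expm mexpK // (_ : (_ == 0%N) = false) ?addr0 //; apply/negbTE; lia.
- have [_ _ b6 b3] := exps_low b; have as_ := ltn_ord a.
  rewrite big ?add_sumn ?mdeg_binary_mon /=; try by lia.
  by rewrite -[mdeg (mexp _)]sumn_expm mexpK // (_ : (_ == 0%N) = false) ?addr0 //; apply/negbTE; lia.
have as_ := ltn_ord a; have bs_ := ltn_ord b.
rewrite big ?add_sumn ?mdeg_binary_mon /=; try by lia.
rewrite add0r !subnn mnmDE !binary_mon1 /= binaryD ?binary_mon_binary //=.
suff -> : ((a + (s.-1 - b)).+1 == s) = (a == b) by [].
by rewrite -(inj_eq val_inj) /=; apply/eqP/eqP; lia.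
Qed.

Lemma mdeg_left_mon i : (mdeg (left_mon i) <= da)%N.
Proof.
rewrite /left_mon; case: (fintype.split i) => a.
  have [a6 a3 _ _] := exps_low a; rewrite -sumn_expm mexpK //; lia.
have as_ := ltn_ord a; rewrite mdeg_binary_mon; lia.
Qed.

Lemma mdeg_right_mon i : (mdeg (right_mon i) <= db)%N.
Proof.
rewrite /right_mon; case: (fintype.split i) => a.
  have [_ _ a6 a3] := exps_low a; rewrite -sumn_expm mexpK //; lia.
have as_ := ltn_ord a; rewrite mdeg_binary_mon; lia.
Qed.

(* Monomials spanning a complement of the square of the ideal of the scheme in degree
   da + db: 1 + 6 + 21 + 56 + 6 of them for the cubic, 7 s for the curve. *)
Definition complement : seq 'X_{1..6} :=
  [seq mexp e | e <- flatten [seq exponents 6 k | k <- iota 0 4] ++ exceptional_quartics] ++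
  [seq binary_mon (da + db).-1 i | i <- iota 0 s] ++
  [seq binary_mon (da + db) i | i <- iota 0 s.*2] ++
  [seq (binary_mon (da + db).-1 i + U_(lift ord0 (lift ord0 j)))%MM | i <- iota 0 s, j <- enum 'I_4].

Lemma size_complement : size complement = (90 + 7 * s)%N.
Proof.
have E : size (flatten [seq exponents 6 k | k <- iota 0 4]) = 84%N by vm_compute.
by rewrite /complement !size_cat !size_map size_cat E !size_iota size_allpairs size_iota size_enum_ord /=; lia.
Qed.

Definition shift_vars (g : poly6) : poly7 := g \mPo [tuple 'X_(lift ord0 i) | i < 6].

Lemma shift_varsM g h : shift_vars (g * h) = shift_vars g * shift_vars h.
Proof. exact: rmorphM. Qed.

Lemma shift_vars_homog k g : g \is k.-homog -> shift_vars g \is k.-homog.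
Proof. by move=> hg; apply: dhomog_comp => // i; rewrite tnth_mktuple dhomogX /= mdeg1. Qed.

Lemma mulXn_shift_vars_homog k m g : (k <= m)%N -> g \is k.-homog ->
  'X_ord0 ^+ (m - k) * shift_vars g \is m.-homog.
Proof.
move=> km hg; have X1 : ('X_ord0 : poly7) \is 1.-homog by rewrite dhomogX /= mdeg1.
by have := dhomogM (dhomogMn (m - k) X1) (shift_vars_homog hg); rewrite mul1n subnK.
Qed.

Lemma shift_varsX j e : 'X_ord0 ^+ j * shift_vars 'X_[e] = 'X_[homogenize (mdeg e + j) e].
Proof.
rewrite /shift_vars comp_mpolyX [RHS]mpolyXE_id [RHS]big_ord_recl homogenize0 addKn; congr (_ * _).
by apply: eq_bigr => i _; rewrite tnth_mktuple homogenizeS.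
Qed.

Lemma dehom_shift_vars g : shift_vars g \mPo dehom K 6 = g.
Proof.
rewrite /shift_vars comp_mpolyA -[RHS]comp_mpoly_id; congr (_ \mPo _).
apply: eq_from_tnth => i; rewrite !tnth_mktuple comp_mpolyXU -tnth_nth tnth_mktuple /=.
by rewrite ltn_ord inord_val.
Qed.

Lemma cubic_curve7_apolar g j B : apolar g -> (0 < j)%N ->
  cubic_curve7 ('X_ord0 ^+ j * shift_vars g * B) = 0.
Proof.
move=> ag j0; rewrite /cubic_curve7 /cubic_part /= !rmorphM rmorphXn /= dehom_shift_vars.
rewrite comp_mpolyXU -tnth_nth tnth_mktuple expr1n mul1r ag add0r.
rewrite /curve_part !on_curveM on_curveXn.
have -> : on_curve ('X_ord0 : poly7) = 0 :> {poly K} by rewrite /on_curve mmapX mmap1U.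
by rewrite expr0n gtn_eqF // !mul0r mulr0 coef0.
Qed.

(** The monomials without x_0 that lie in the ideal of the scheme of length s in the line. *)
Definition off_scheme (e : 'X_{1..6}) : bool := ~~ binary e || (s <= e j1)%N.

Lemma cubic_curve7_off_scheme e B : (3 < mdeg e)%N -> off_scheme e ->
  cubic_curve7 ('X_[homogenize (mdeg e) e] * B) = 0.
Proof.
move=> e3 ge; rewrite /cubic_curve7 /cubic_part /= rmorphM /= dehomX affine_part_homogenize.
rewrite (apolar_high (K := K) e3) add0r /curve_part on_curveM on_curveX affine_part_homogenize.
rewrite homogenize0 subnn eqxx /=; case: ifP ge => /= [be|_ _]; last by rewrite mul0r mulr0 coef0.
by rewrite /off_scheme be /= => es; rewrite mulrA -exprS coefXnM ltnS es.
Qed.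

Lemma off_scheme_le u e : (u <= e)%MM -> off_scheme u -> off_scheme e.
Proof.
move=> ue /orP[|su]; last by apply/orP; right; apply: leq_trans su _; move/mnm_lepP: ue.
rewrite negb_forall => /existsP[j]; rewrite negb_imply => /andP[j2 uj].
apply/orP; left; rewrite negb_forall; apply/existsP; exists j; rewrite negb_imply j2 -lt0n.
by apply: (@leq_trans (u j)); [rewrite lt0n | move/mnm_lepP: ue].
Qed.

Section Span.
Variable lam : poly7 -> K.
Hypothesis lamL : forall c P Q, lam (c *: P + Q) = c * lam P + lam Q.
Hypothesis lamW : forall A B, A \is da.-homog -> B \is db.-homog ->
  (forall B', B' \is db.-homog -> cubic_curve7 (A * B') = 0) ->
  (forall A', A' \is da.-homog -> cubic_curve7 (A' * B) = 0) -> lam (A * B) = 0.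
Hypothesis lamR : forall e, e \in complement -> lam 'X_[homogenize (da + db) e] = 0.

Let lam_shift m g := lam ('X_ord0 ^+ (da + db - m) * shift_vars g).

Lemma lam_shift_lin m c P Q : lam_shift m (c *: P + Q) = c * lam_shift m P + lam_shift m Q.
Proof. by rewrite /lam_shift {1}/shift_vars comp_mpolyD comp_mpolyZ mulrDr -scalerAr lamL. Qed.

Lemma lam_shiftX e : (mdeg e <= da + db)%N ->
  lam_shift (mdeg e) 'X_[e] = lam 'X_[homogenize (da + db) e].
Proof. by move=> ed; rewrite /lam_shift shift_varsX subnKC. Qed.

(** The strict inequalities leave a factor x_0 on both sides, which kills the curve part; apolarity
    kills the cubic part. *)
Lemma lam_shift_apolar k l g h : (k < da)%N -> (l < db)%N -> g \is k.-homog -> h \is l.-homog ->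
  apolar g -> apolar h -> lam_shift (k + l) (g * h) = 0.
Proof.
move=> kda ldb hg hh ag ah; rewrite /lam_shift shift_varsM.
have -> : (da + db - (k + l))%N = ((da - k) + (db - l))%N by lia.
rewrite exprD mulrACA; apply: lamW; [apply: mulXn_shift_vars_homog => //; exact: ltnW..| |].
  by move=> B' _; apply: cubic_curve7_apolar; rewrite ?subn_gt0.
by move=> A' _; rewrite mulrC; apply: cubic_curve7_apolar; rewrite ?subn_gt0.
Qed.

Lemma lam_low e : (mdeg e <= 3)%N -> lam 'X_[homogenize (da + db) e] = 0.
Proof.
move=> e3; apply: lamR; rewrite /complement mem_cat; apply/orP; left.
apply/mapP; exists (expm e); last by rewrite expmK.
rewrite mem_cat; apply/orP; left; apply/flattenP; exists (exponents 6 (mdeg e)); last exact: mem_expm.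
by apply: map_f; rewrite mem_iota ltnS.
Qed.

Lemma lam_quartic e : mdeg e = 4%N -> lam 'X_[homogenize (da + db) e] = 0.
Proof.
move=> e4; rewrite -lam_shiftX e4; last by lia.
apply: (quartics_span (lam_shift_lin 4)) => // [g h hg hh ag ah|e' ee'].
  by apply: (@lam_shift_apolar 2 2) => //; lia.
have e'4 : mdeg (mexp e') = 4%N.
  by apply: mdeg_mexp; move: e' ee'; apply/allP; vm_compute.
have := @lam_shiftX (mexp e'); rewrite e'4 => ->; last by lia.
apply: lamR; rewrite mem_cat; apply/orP; left; apply: map_f.
by rewrite mem_cat ee' orbT.
Qed.

Lemma lam_middle e : (4 < mdeg e)%N -> (mdeg e <= da + db - 2)%N ->
  lam 'X_[homogenize (da + db) e] = 0.
Proof.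
move=> e4 ed; have [f f5 /andP[_ fe]] : exists2 f : 'X_{1..6}, mdeg f = 5%N & (0 <= f)%MM && (f <= e)%MM.
  by apply: multinom_between; [apply/mnm_lepP => i; rewrite mnm0E | rewrite mdeg0].
pose e' := (e - f)%MM.
have de' : mdeg e = (mdeg e' + 5)%N by have := mdegD e' f; rewrite submK // f5.
(* Together with an apolar quadric, the left factor has degree at most da - 1; the bound on [mdeg e]
   leaves at most db - 1 for the right one, which contains an apolar cubic. *)
have [f1 f1d /andP[_ fe1]] : exists2 f1 : 'X_{1..6}, mdeg f1 = minn (mdeg e') (da - 3) & (0 <= f1)%MM && (f1 <= e')%MM.
  by apply: multinom_between; [apply/mnm_lepP => i; rewrite mnm0E | rewrite mdeg0 geq_minl].
pose f2 := (e' - f1)%MM.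
have d2 : mdeg e' = (mdeg f2 + mdeg f1)%N by rewrite -mdegD submK.
rewrite -lam_shiftX; last by lia.
have eE : 'X_[e] = 'X_[f] * ('X_[f1] * 'X_[f2]) :> poly6.
  by rewrite -!mpolyXD; congr 'X_[_]; rewrite [(f1 + _)%MM]addmC submK // addmC submK.
rewrite eE; apply: (quintics_span (mu := fun P => lam_shift (mdeg e) (P * ('X_[f1] * 'X_[f2])))) f5.
  by move=> c P Q; rewrite mulrDl -scalerAl lam_shift_lin.
move=> g h hg hh ag ah; rewrite mulrACA.
have -> : mdeg e = ((2 + mdeg f1) + (3 + mdeg f2))%N by lia.
apply: lam_shift_apolar; try exact: apolarM.
- by lia.
- by lia.
- by apply: dhomogM => //; rewrite dhomogX.
- by apply: dhomogM => //; rewrite dhomogX.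
Qed.

Lemma cubic_curve7_homogenize k e B : (3 < mdeg e <= k)%N -> (mdeg e < k)%N || off_scheme e ->
  cubic_curve7 ('X_[homogenize k e] * B) = 0.
Proof.
case/andP=> e3 ek; have [ek' _|] := ltnP (mdeg e) k.
  have := shift_varsX (k - mdeg e) e; rewrite subnKC // => <-.
  by apply: cubic_curve7_apolar; [apply: apolar_high | rewrite subn_gt0].
by move=> ke /= oe; rewrite (_ : k = mdeg e) ?cubic_curve7_off_scheme //; apply/eqP; rewrite eqn_leq ek ke.
Qed.

Lemma lam_split e1 e2 : (3 < mdeg e1 <= da)%N -> (3 < mdeg e2 <= db)%N ->
  (mdeg e1 < da)%N || off_scheme e1 -> (mdeg e2 < db)%N || off_scheme e2 ->
  lam 'X_[homogenize (da + db) (e1 + e2)%MM] = 0.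
Proof.
move=> d1 d2 o1 o2; have /andP[_ l1] := d1; have /andP[_ l2] := d2.
rewrite homogenizeD // mpolyXD; apply: lamW.
- by rewrite dhomogX /= mdeg_homogenize.
- by rewrite dhomogX /= mdeg_homogenize.
- by move=> B' _; apply: cubic_curve7_homogenize.
- by move=> A' _; rewrite mulrC; apply: cubic_curve7_homogenize.
Qed.

Lemma off_schemeP e : off_scheme e ->
  exists u, [/\ (u <= e)%MM, off_scheme u & (mdeg u <= maxn 1 s)%N].
Proof.
have le_mul j k : (k <= e j)%N -> (U_(j) *+ k <= e)%MM.
  move=> ke; apply/mnm_lepP => i; rewrite mulmnE mnm1E.
  by case: eqP => [<-|_]; rewrite ?mul1n ?mul0n.
case/orP=> [|es].
  rewrite negb_forall => /existsP[j]; rewrite negb_imply => /andP[j2 ej].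
  exists (U_(j) *+ 1)%MM; split; first by apply: le_mul; rewrite lt0n.
    apply/orP; left; rewrite negb_forall; apply/existsP; exists j.
    by rewrite negb_imply j2 mulmnE mnm1E eqxx.
  by rewrite mdegMn mdeg1 leq_maxl.
exists (U_(j1) *+ s)%MM; split; [exact: le_mul | | by rewrite mdegMn mdeg1 mul1n leq_maxr].
by apply/orP; right; rewrite mulmnE mnm1E eqxx mul1n.
Qed.

Lemma lam_subtop e : mdeg e = (da + db).-1 -> lam 'X_[homogenize (da + db) e] = 0.
Proof.
move=> de; have [/off_schemeP[u [ue ou u1]]|] := boolP (off_scheme e).
  (* The only factor x_0 goes to the left, where it kills the curve part; the right factor has full
     degree db and needs the divisor [u]. *)
  have [||||e1 [e2 [eE d1 _ ue2]]] := @multinom_split _ 0%MM u e da.-1; rewrite ?add0m ?mdeg0 //; try by lia.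
  have d2 : mdeg e2 = db by have := de; rewrite eE mdegD d1; lia.
  rewrite eE.
  apply: lam_split; rewrite ?(off_scheme_le ue2) ?orbT //; lia.
rewrite negb_or negbK -ltnNge => /andP[/binaryE be es]; apply: lamR.
rewrite mem_cat; apply/orP; right; rewrite mem_cat; apply/orP; left.
by rewrite be de; apply: map_f; rewrite mem_iota.
Qed.

Lemma lam_top_split u1 u2 e : mdeg e = (da + db)%N -> (u1 + u2 <= e)%MM ->
  off_scheme u1 -> off_scheme u2 -> (mdeg u1 <= da)%N -> (mdeg u2 <= db)%N ->
  lam 'X_[homogenize (da + db) e] = 0.
Proof.
move=> de ue o1 o2 l1 l2.
have [||||e1 [e2 [eE d1 ue1 ue2]]] := @multinom_split _ u1 u2 e da; rewrite ?de //; try by lia.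
have d2 : mdeg e2 = db by have := de; rewrite eE mdegD d1; lia.
by rewrite eE; apply: lam_split; rewrite ?(off_scheme_le ue2) ?(off_scheme_le ue1) ?orbT //; lia.
Qed.

(** Without x_0 both factors have to be off the scheme. This fails only for 2 s monomials in x_1,
    x_2 with x_2-exponent below 2 s, and for 4 s with one further variable and x_2-exponent below s;
    these are in [complement]. *)
Lemma lam_top e : mdeg e = (da + db)%N -> lam 'X_[homogenize (da + db) e] = 0.
Proof.
move=> de; have [be|] := boolP (binary e).
  have [es|es] := leqP s.*2 (e j1).
    have os : off_scheme (U_(j1) *+ s)%MM.
      by apply/orP; right; rewrite mulmnE mnm1E eqxx mul1n.
    apply: (lam_top_split _ _ os os) => //; try by rewrite mdegMn mdeg1; lia.
    apply/mnm_lepP => i; rewrite mnmDE !mulmnE mnm1E; case: eqP => [<-|_]; lia.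
  apply: lamR; rewrite mem_cat; apply/orP; right; rewrite mem_cat; apply/orP; right.
  rewrite mem_cat; apply/orP; left.
  by rewrite (binaryE be) de; apply: map_f; rewrite mem_iota.
rewrite negb_forall => /existsP[j]; rewrite negb_imply => /andP[j2 ej].
have je : (U_(j) <= e)%MM by rewrite lep1mP.
have [/off_schemeP[u [ue ou u1]]|] := boolP (off_scheme (e - U_(j))%MM).
  apply: (@lam_top_split U_(j)%MM u) => //; try by lia.
  - by apply/mnm_lepP => i; move/mnm_lepP/(_ i): ue; move/mnm_lepP/(_ i): je; rewrite mnmDE mnmBE; lia.
  - apply/orP; left; rewrite negb_forall; apply/existsP; exists j.
    by rewrite negb_imply j2 mnm1E eqxx.
  - by rewrite mdeg1; lia.
rewrite negb_or negbK -ltnNge => /andP[/binaryE be es]; apply: lamR.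
have dj : mdeg (e - U_(j))%MM = (da + db).-1.
  by have := mdegD (e - U_(j))%MM U_(j)%MM; rewrite submK // de mdeg1 addn1 => ->.
rewrite -(submK je) be dj.
rewrite !mem_cat; apply/orP; right; apply/orP; right; apply/orP; right.
have [j' jE] : exists j' : 'I_4, j = lift ord0 (lift ord0 j').
  case: (unliftP ord0 j) j2 => [j'|] -> //; case: (unliftP ord0 j') => [j''|] -> // _.
  by exists j''.
rewrite {2}jE; apply/allpairsP.
exists ((e - U_(j))%MM j1, j'); split; rewrite ?mem_iota ?mem_enum //=.
Qed.

Lemma lam_monomial (M : 'X_{1..7}) : mdeg M = (da + db)%N -> lam 'X_[M] = 0.
Proof.
move=> dM; rewrite -[M]homogenize_affine_part dM; have := mdeg_affine_part M; rewrite dM.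
set e := affine_part M => de.
have [|e3] := leqP (mdeg e) 3; first exact: lam_low.
have [|e4] := eqVneq (mdeg e) 4; first exact: lam_quartic.
have [|ed] := leqP (mdeg e) (da + db - 2); first by apply: lam_middle; lia.
have [|ed'] := eqVneq (mdeg e) (da + db); first exact: lam_top.
by apply: lam_subtop; lia.
Qed.
End Span.
End SevenVariables.

Section CubicAndCurveCase.
Variables (K : closedFieldType) (n s d : nat).
Hypothesis n6 : (6 <= n)%N.
Hypothesis sd : (s + 14 + (s + 13) <= d)%N.
Notation V := 'rV[K]_n.+1.
Notation S := (SdV K n d).
Notation poly7 := {mpoly K[7]}.

Lemma ord7_le (i : 'I_7) : (i < n.+1)%N.
Proof. by apply: leq_trans (ltn_ord i) _. Qed.

Definition lift7 (P : poly7) : {mpoly K[n.+1]} :=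
  P \mPo [tuple 'X_(inord i) | i < 7].

Lemma lift7_homog k P : P \is k.-homog -> lift7 P \is k.-homog.
Proof. by move=> hP; apply: dhomog_comp => // i; rewrite tnth_mktuple dhomogX /= mdeg1. Qed.

Lemma dehom_lift7 P : lift7 P \mPo dehom K n = P \mPo dehom K 6.
Proof.
rewrite comp_mpolyA; congr (_ \mPo _); apply: eq_from_tnth => i.
by rewrite !tnth_mktuple comp_mpolyXU -tnth_nth tnth_mktuple inordK ?ord7_le.
Qed.

Lemma on_curve_lift7 P : on_curve (lift7 P) = on_curve P.
Proof.
rewrite /lift7 comp_mpolyEX raddf_sum /= {2}/on_curve /mmap; apply: eq_bigr => M _.
rewrite [LHS]mmapZ -/(on_curve _); congr (_ * _).
rewrite comp_mpolyX rmorph_prod /=; apply: eq_bigr => i _.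
by rewrite on_curveXn tnth_mktuple /on_curve mmapX mmap1U inordK ?ord7_le.
Qed.

Lemma cubic_curve7_lift P : cubic_part K n (lift7 P) + curve_part s (lift7 P) = cubic_curve7 s P.
Proof. by rewrite /cubic_curve7 /cubic_part /curve_part /= dehom_lift7 on_curve_lift7. Qed.

(** Projecting to degree d extends F linearly to all polynomials, as [secant_criterion] expects; on
    forms of degree d nothing changes. *)
Definition eval7 (F : S) (P : poly7) : K := F (DHomog (pihomogP mdeg d (lift7 P))).

Lemma eval7_lin F c P Q : eval7 F (c *: P + Q) = c * eval7 F P + eval7 F Q.
Proof.
have E : F (c *: DHomog (pihomogP mdeg d (lift7 P)) + DHomog (pihomogP mdeg d (lift7 Q)))
    = c * eval7 F P + eval7 F Q by exact: linearP.
rewrite -E /eval7; congr (F _); apply: val_inj => /=.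
by rewrite /lift7 comp_mpolyD comp_mpolyZ linearP.
Qed.

Definition cubic_curve : S := restrS d (cubic_part K n) + restrS d (@curve_part K s n).

Lemma cubic_curve_cactus : cactus (14 + s) cubic_curve.
Proof.
apply: cactusD; first exact/cactus_local/cubic_part_local.
by apply/cactus_local/curve_part_local; apply: leq_trans n6.
Qed.

Lemma eval7_cubic_curve P : P \is d.-homog -> eval7 cubic_curve P = cubic_curve7 s P.
Proof.
move=> hP; rewrite /eval7 lfunE /= [X in X + _]restrSE [X in _ + X]restrSE /=.
by rewrite pihomog_dE ?lift7_homog // cubic_curve7_lift.
Qed.

Lemma eval7_evS r (c : 'I_r -> K) (x : 'I_r -> V) P : P \is d.-homog ->
  eval7 (\sum_i c i *: evS d (x i)) P = \sum_i c i * P.@[fun j => x i 0 (inord j)].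
Proof.
move=> hP; rewrite /eval7 sum_lfunE; apply: eq_bigr => i _.
rewrite lfunE /= lfunE /= /eval_form /= pihomog_dE ?lift7_homog // comp_mpoly_meval.
congr (_ * _); apply: meval_eq => j.
by rewrite tnth_mktuple mevalXU.
Qed.

Lemma cubic_curve_excess :
  secant_variety (14 + s) (range (@veronese K n d)) `<` Z_all K n d (14 + s).
Proof.
(* With r = 14 + s, the degrees are r - 1 and at least r, as d >= 2 r - 1 permits. *)
pose da := (s + 13)%N; pose db := (d - da)%N.
have dE : (da + db)%N = d by rewrite /db /da; lia.
have dbs : (s + 14 <= db)%N by rewrite /db /da; lia.
have homogX k (e : 'X_{1..6}) : (mdeg e <= k)%N -> ('X_[homogenize k e] : poly7) \is k.-homog.
  by move=> ek; rewrite dhomogX /= mdeg_homogenize.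
have prodE A B : A \is da.-homog -> B \is db.-homog ->
    eval7 cubic_curve (A * B) = cubic_curve7 s (A * B).
  by move=> hA hB; apply: eval7_cubic_curve; rewrite -dE; apply: dhomogM.
have pa (i : 'I_(14 + s)) : ('X_[homogenize da (left_mon da i)] : poly7) \is da.-homog.
  by apply: homogX; apply: mdeg_left_mon erefl dbs _.
have qb (i : 'I_(14 + s)) : ('X_[homogenize db (right_mon db i)] : poly7) \is db.-homog.
  by apply: homogX; apply: mdeg_right_mon erefl dbs _.
have LF P : is_form 1 (eval7 ^~ P).
  apply: is_form_lin => c F G; rewrite /eval7 lfunE /= lfunE; exact: erefl.
have da0 : (0 < da)%N by rewrite /da addn_gt0 orbT.
have rab : ((14 + s).*2.-1 <= da + db)%N by rewrite /db /da; lia.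
have [i j||lam lamL lamW lamR M|k [G [fG GS GF]]] :=
  @secant_criterion K 7 S eval7 eval7_lin LF (14 + s) da db
  (fun i => 'X_[homogenize da (left_mon da i)])
  (fun i => 'X_[homogenize db (right_mon db i)]) pa qb da0 rab cubic_curve
  [seq homogenize (da + db) e | e <- complement s da db].
- by rewrite prodE // (left_right_dual _ erefl dbs).
- by rewrite size_map size_complement; lia.
- apply: (lam_monomial erefl dbs lamL) => [A B hA hB lA lB|e ee]; last exact/lamR/map_f.
  apply: lamW => // [B' hB'|A' hA']; rewrite prodE //; [exact: lA | exact: lB].
apply: (secant_proper fG _ cubic_curve_cactus GF) => c x; apply: GS => P.
by rewrite dE => hP; apply: eval7_evS.
Qed.

End CubicAndCurveCase.

Theorem corollary5 (K : closedFieldType) (n r d : nat)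
  (hr : (0 < r)%N)
  (hnr : [\/ (6 <= n)%N /\ (14 <= r)%N,
             n = 5%N /\ (42 <= r)%N
           | n = 4%N /\ (140 <= r)%N])
  (hd : (2 * r - 1 <= d)%N) :
  secant_variety r (range (@veronese K n d)) `<` Z_all K n d r.
Proof.
have [t t_inj] := infinite_field K.
have tI s : injective (fun i : 'I_s => t i) by move=> i j /t_inj/val_inj.
case: hnr => [[n6 r14]|[-> r42]|[-> r140]].
- rewrite -(subnKC r14); apply: cubic_curve_excess => //; lia.
(* The length is 2 x 21 = 42 and the comparison is 252 + 1 > 42 x 6 = 252, where the 1 is the motion
   of the support; the other r - 42 points add equally to both sides. *)
- have B2 : 'C(2 + 5, 2) = 21%N by [].
  have B5 : 'C(5 + 5, 5) = 252%N by [].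
  by apply: (osculating_excess (k := 2) (n' := 3) (s := r - 42) _ _ (@tI _)); rewrite ?B2 ?B5; lia.
(* The length is 2 x 70 = 140 and the comparison is 715 + 1 > 140 x 5 = 700. *)
have B4 : 'C(4 + 4, 4) = 70%N by [].
have B9 : 'C(9 + 4, 9) = 715%N by [].
by apply: (osculating_excess (k := 4) (n' := 2) (s := r - 140) _ _ (@tI _)); rewrite ?B4 ?B9; lia.
Qed.
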